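(* For every $\rho\in L^2(\gamma)$ there exists a unique solution $(\mathbf{u},\boldsymbol\lambda)\in\mathbf{V}\times\boldsymbol\Lambda$ to the problem $$\begin{cases}\mathbf{a}(\mathbf{u},\mathbf{v})-\mathbf{b}(\boldsymbol\lambda,\mathbf{v})=\int_\gamma\rho\,v_\gamma\,dx, & \forall\,\mathbf{v}=(v_1,v_2,v_\gamma)\in\mathbf{V},\\ \mathbf{b}(\boldsymbol\mu,\mathbf{u})=0, & \forall\,\boldsymbol\mu\in\boldsymbol\Lambda.\end{cases}$$ Moreover, the following bounds hold: $$\|\mathbf{u}\|_{\mathbf{V}}\le\frac1{\alpha_2}\|\rho\|_{0,\gamma},\qquad \|\boldsymbol\lambda\|_{\boldsymbol\Lambda}\le\frac1\beta\Big(1+\frac{\alpha_1}{\alpha_2}\Big)\|\rho\|_{0,\gamma},$$ where $\alpha_1$, $\alpha_2$, $\beta$ are, respectively, the continuity constant of $\mathbf{a}$, the coercivity constant of $\mathbf{a}$, and the inf-sup constant of $\mathbf{b}$ specified in the context.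
   Context: Geometry. Let $L,l>0$, $\Omega=\,]0,L[\times]-\frac l2,\frac l2[$, $\Omega_1=\,]0,L[\times]0,\frac l2[$, $\Omega_2=\,]0,L[\times]-\frac l2,0[$, and let $\gamma=\,]0,L[$, identified with the segment $]0,L[\times\{0\}$ (the interface). The boundary splits as $\partial\Omega=\Gamma_D\cup\Gamma_N$ with $\Gamma_D\cap\Gamma_N=\emptyset$; put $\Gamma_D^i=\partial\Omega_i\cap\Gamma_D$, $\Gamma_N^i=\partial\Omega_i\cap\Gamma_N$. The set $\Gamma_D$ contains the endpoints $(0,0),(L,0)$ of $\gamma$, and $\overline{\Gamma_N^i}\cap\overline\gamma=\emptyset$ for $i=1,2$. The numbers $d,\epsilon_{ox},\epsilon_{ch}$ are positive constants. Notation. $\|\cdot\|_{m,D}$ is the $H^m(D)$ norm. For $\Gamma'\subset\partial\Omega_i$, $H^1_{0,\Gamma'}(\Omega_i)=\{v\in H^1(\Omega_i): v=0\text{ on }\Gamma'\}$. $H^{1/2}_{00}(\gamma)$ is the space of traces on $\gamma$ of functions in $H^1_{0,\partial\Omega_i\setminus\gamma}(\Omega_i)$, with norm $\|\sigma\|_{1/2,\gamma}=\inf\{\|v\|_{1,\Omega_i}: v\in H^1_{0,\partial\Omega_i\setminus\gamma}(\Omega_i),\ v|_\gamma=\sigma\}$ (the same space and norm for $i=1,2$ by reflection). $\langle\cdot,\cdot\rangle_\gamma$ is the duality between $(H^{1/2}_{00}(\gamma))'$ and $H^{1/2}_{00}(\gamma)$. Spaces. $V^i=H^1_{0,\Gamma_D^i}(\Omega_i)$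 ($i=1,2$), $V^\gamma=H^1_0(\gamma)$, $\mathbf{V}=V^1\times V^2\times V^\gamma$ with norm $\|\mathbf{u}\|_{\mathbf{V}}=\big(\sum_{i=1}^2\|u_i\|_{1,\Omega_i}^2+\|u_\gamma\|_{1,\gamma}^2\big)^{1/2}$ for $\mathbf{u}=(u_1,u_2,u_\gamma)$. $\Lambda^i=(H^{1/2}_{00}(\gamma))'$ and $\boldsymbol\Lambda=\Lambda^1\times\Lambda^2$ with norm $\|\boldsymbol\lambda\|_{\boldsymbol\Lambda}=\big(\sum_{i=1}^2\|\lambda_i\|_{-1/2,\gamma}^2\big)^{1/2}$, where $\|\lambda_i\|_{-1/2,\gamma}=\sup_{v\in H^1_{0,\partial\Omega_i\setminus\gamma}(\Omega_i)}\frac{\langle\lambda_i,v\rangle_\gamma}{\|v\|_{1,\Omega_i}}$. For $u_i\in V^i$ one has $u_i|_\gamma\in H^{1/2}_{00}(\gamma)$, and $V^\gamma\subset H^{1/2}_{00}(\gamma)$. Bilinear forms. For $\mathbf{u},\mathbf{v}\in\mathbf{V}$ and $\boldsymbol\mu=(\mu_1,\mu_2)\in\boldsymbol\Lambda$, $$\mathbf{a}(\mathbf{u},\mathbf{v})=\sum_{i=1}^2\int_{\Omega_i}\epsilon_{ox}\nabla u_i\cdot\nabla v_i\,dx\,dy+d\int_\gamma\epsilon_{ch}u_\gamma'v_\gamma'\,dx,\qquad \mathbf{b}(\boldsymbol\mu,\mathbf{u})=\sum_{i=1}^2\langle\mu_i,u_i|_\gamma-u_\gamma\rangle_\gamma .$$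 Constants. $\alpha_1,\alpha_2,\beta>0$ are constants (such constants exist) with $\mathbf{a}(\mathbf{u},\mathbf{v})\le\alpha_1\|\mathbf{u}\|_{\mathbf{V}}\|\mathbf{v}\|_{\mathbf{V}}$ and $\mathbf{a}(\mathbf{u},\mathbf{u})\ge\alpha_2\|\mathbf{u}\|_{\mathbf{V}}^2$ for all $\mathbf{u},\mathbf{v}\in\mathbf{V}$, and $\inf_{\boldsymbol\lambda\in\boldsymbol\Lambda\setminus\{0\}}\sup_{\mathbf{v}\in\mathbf{V}\setminus\{0\}}\frac{\mathbf{b}(\boldsymbol\lambda,\mathbf{v})}{\|\boldsymbol\lambda\|_{\boldsymbol\Lambda}\|\mathbf{v}\|_{\mathbf{V}}}\ge\beta$. *)

(* Defs.v *)
From HB Require Import structures.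
From mathcomp Require Import all_boot all_order all_algebra.
From mathcomp Require Import all_classical all_reals all_analysis.

Set Implicit Arguments.
Unset Strict Implicit.
Unset Printing Implicit Defensive.

Import Order.TTheory GRing.Theory Num.Theory.
Import numFieldNormedType.Exports.

Local Open Scope classical_set_scope.
Local Open Scope ring_scope.

(* Elements of L^2 and of the Sobolev spaces are represented by functions
   defined on the whole line or plane; only their values on the relevant domain
   matter, and equality of elements is equality almost everywhere there. *)

Section SquareIntegrable.
Context {d : measure_display} {T : measurableType d} {R : realType}.
Variables (mu : {measure set T -> \bar R}) (D : set T).

Definition L2 (f : T -> R) : Prop :=
  measurable_fun D f /\ mu.-integrable D (fun x => (f x ^+ 2)%:E).

Definition sqnormL2 (f : T -> R) : R := Rintegral mu D (fun x => f x ^+ 2).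

Definition normL2 (f : T -> R) : R := Num.sqrt (sqnormL2 f).
End SquareIntegrable.

Section Smooth.
Context {R : realType} {V : normedModType R}.

Fixpoint Ck (k : nat) (f : V -> R) : Prop :=
  continuous f /\
  match k with
  | 0%N => True
  | k'.+1 => forall v : V,
      (forall x, derivable f x v) /\ Ck k' (fun x => 'D_v f x)
  end.

Definition smooth (f : V -> R) : Prop := forall k, Ck k f.

Definition test_function (D : set V) (f : V -> R) : Prop :=
  smooth f /\
  exists K : set V, [/\ compact K, K `<=` D & forall x, ~ K x -> f x = 0].
End Smooth.

Section Sobolev.
Context {R : realType}.

Definition leb1 : {measure set (measurableTypeR R) -> \bar R} := @lebesgue_measure R.
Definition leb2 :
    {measure set (measurableTypeR R * measurableTypeR R)%type -> \bar R} :=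
  (@lebesgue_measure R \x @lebesgue_measure R)%E.

Definition weak_deriv1 (D : set R) (u g : R -> R) : Prop :=
  L2 leb1 D g /\
  forall phi : R -> R, test_function (V := R^o) D phi ->
    Rintegral leb1 D (fun x => u x * derive1 (V := R^o) phi x) =
    - Rintegral leb1 D (fun x => g x * phi x).

Definition inH1_1 (D : set R) (u : R -> R) : Prop :=
  L2 leb1 D u /\ exists g, weak_deriv1 D u g.

(* The weak derivative, a representative being chosen when it exists. *)
Definition wderiv (D : set R) (u : R -> R) : R -> R :=
  xget (fun=> 0) [set g | weak_deriv1 D u g].

Definition normH1_1 (D : set R) (u : R -> R) : R :=
  Num.sqrt (sqnormL2 leb1 D u + sqnormL2 leb1 D (wderiv D u)).

(* H^1_0(D) is the closure of C_c^oo(D) in H^1(D). *)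
Definition inH10_1 (D : set R) (u : R -> R) : Prop :=
  inH1_1 D u /\
  exists phi : nat -> R -> R,
    (forall n, test_function (V := R^o) D (phi n)) /\
    (normH1_1 D (phi n \- u) @[n --> \oo] --> 0).

Definition axis (k : 'I_2) : R * R := if k == 0 then (1, 0) else (0, 1).

Definition weak_deriv2 (D : set (R * R)) (k : 'I_2) (u g : R * R -> R) : Prop :=
  L2 leb2 D g /\
  forall phi : R * R -> R, test_function D phi ->
    Rintegral leb2 D (fun z => u z * 'D_(axis k) phi z) =
    - Rintegral leb2 D (fun z => g z * phi z).

Definition inH1_2 (D : set (R * R)) (u : R * R -> R) : Prop :=
  L2 leb2 D u /\ forall k, exists g, weak_deriv2 D k u g.

Definition wpartial (D : set (R * R)) (k : 'I_2) (u : R * R -> R)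
    : R * R -> R :=
  xget (fun=> 0) [set g | weak_deriv2 D k u g].

Definition normH1_2 (D : set (R * R)) (u : R * R -> R) : R :=
  Num.sqrt (sqnormL2 leb2 D u + \sum_(k < 2) sqnormL2 leb2 D (wpartial D k u)).

(* The open rectangle ]xmin, xmax[ x ]ymin, ymax[. *)
Record rectangle := Rectangle { xmin : R; xmax : R; ymin : R; ymax : R }.

Definition rect_set (Q : rectangle) : set (R * R) :=
  `]xmin Q, xmax Q[%classic `*` `]ymin Q, ymax Q[%classic.

Definition bdry {T : topologicalType} (A : set T) : set T :=
  closure A `\` interior A.

(* The four sides are indexed by bool * bool: the first component tells vertical
   sides from horizontal ones, the second one tells right/top from left/bottom.
   Each is parametrized by arc length; the corners are negligible. *)
Definition side_dom (Q : rectangle) (s : bool * bool) : set R :=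
  if s.1 then `]ymin Q, ymax Q[%classic else `]xmin Q, xmax Q[%classic.

Definition side_pt (Q : rectangle) (s : bool * bool) (t : R) : R * R :=
  if s.1 then (if s.2 then xmax Q else xmin Q, t)
  else (t, if s.2 then ymax Q else ymin Q).

Definition L2_bdry (Q : rectangle) (g : R * R -> R) : Prop :=
  forall s, L2 leb1 (side_dom Q s) (g \o side_pt Q s).

Definition normL2_bdry (Q : rectangle) (g : R * R -> R) : R :=
  Num.sqrt (\sum_(s : bool * bool)
              sqnormL2 leb1 (side_dom Q s) (g \o side_pt Q s)).

(* The trace operator is the extension by continuity, from H^1(Q) to L^2 of the
   boundary, of the restriction of functions smooth up to the boundary. *)
Definition is_trace (Q : rectangle) (v g : R * R -> R) : Prop :=
  L2_bdry Q g /\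
  exists phi : nat -> R * R -> R,
    [/\ forall n, smooth (phi n),
        normH1_2 (rect_set Q) (phi n \- v) @[n --> \oo] --> 0 &
        normL2_bdry Q (phi n \- g) @[n --> \oo] --> 0].

Definition trace (Q : rectangle) (v : R * R -> R) : R * R -> R :=
  xget (fun=> 0) [set g | is_trace Q v g].

Definition zero_on (Q : rectangle) (G : set (R * R)) (g : R * R -> R) : Prop :=
  forall s, {ae leb1, forall t,
    side_dom Q s t -> G (side_pt Q s t) -> g (side_pt Q s t) = 0}.

Definition inH1_0 (Q : rectangle) (G : set (R * R)) (v : R * R -> R) : Prop :=
  inH1_2 (rect_set Q) v /\ exists2 g, is_trace Q v g & zero_on Q G g.

End Sobolev.

Arguments rectangle R : clear implicits.

Section Problem.
Context {R : realType}.
Variables (L l : R).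

Definition Omega : set (R * R) :=
  `]0, L[%classic `*` `](- (l / 2)), (l / 2)[%classic.

(* Omega_1 is OmegaQ 0 and Omega_2 is OmegaQ 1. *)
Definition OmegaQ (i : 'I_2) : rectangle R :=
  if i == 0 then Rectangle 0 L 0 (l / 2) else Rectangle 0 L (- (l / 2)) 0.

Definition Omegai (i : 'I_2) : set (R * R) := rect_set (OmegaQ i).

Definition gam : set R := `]0, L[%classic.
Definition gam2 : set (R * R) := [set (x, 0) | x in gam].

Definition Gammai (G : set (R * R)) (i : 'I_2) : set (R * R) :=
  bdry (Omegai i) `&` G.

Definition admissible_bdry (GD GN : set (R * R)) : Prop :=
  [/\ bdry Omega = GD `|` GN,
      GD `&` GN = set0,
      GD (0, 0) /\ GD (L, 0) &
      forall i, closure (Gammai GN i) `&` closure gam2 = set0].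

(* The spaces H^{1/2}_00 and its dual, with their norms, carry the index i of the
   subdomain used to define them; both indices give the same space. *)
Definition inW (i : 'I_2) (v : R * R -> R) : Prop :=
  inH1_0 (OmegaQ i) (bdry (Omegai i) `\` gam2) v.

Definition trace_gam (i : 'I_2) (v : R * R -> R) : R -> R :=
  fun x => trace (OmegaQ i) v (x, 0).

Definition inH00 (i : 'I_2) (sigma : R -> R) : Prop :=
  exists2 v, inW i v & ae_eq leb1 gam (trace_gam i v) sigma.

Definition normH00 (i : 'I_2) (sigma : R -> R) : R :=
  inf [set normH1_2 (Omegai i) v |
        v in [set v | inW i v /\ ae_eq leb1 gam (trace_gam i v) sigma]].

(* The dual of H^{1/2}_00. Boundedness makes lam insensitive to changes of its
   argument on null subsets of gam. *)
Definition inH00' (i : 'I_2) (lam : (R -> R) -> R) : Prop :=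
  (forall (c : R) (sigma tau : R -> R), inH00 i sigma -> inH00 i tau ->
     lam (fun x => c * sigma x + tau x) = c * lam sigma + lam tau) /\
  (exists C : R, forall sigma, inH00 i sigma ->
     `|lam sigma| <= C * normH00 i sigma).

Definition eqH00' (i : 'I_2) (lam mu : (R -> R) -> R) : Prop :=
  forall sigma, inH00 i sigma -> lam sigma = mu sigma.

Definition normH00' (i : 'I_2) (lam : (R -> R) -> R) : R :=
  sup [set lam (trace_gam i v) / normH1_2 (Omegai i) v |
        v in [set v | inW i v /\ ~ ae_eq leb2 (Omegai i) v (fun=> 0)]].

Record Velt := MkV { bulk : 'I_2 -> R * R -> R; intf : R -> R }.

Definition zeroV : Velt := MkV (fun _ _ => 0) (fun=> 0).

Definition eqV (u v : Velt) : Prop :=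
  (forall i, ae_eq leb2 (Omegai i) (bulk u i) (bulk v i)) /\
  ae_eq leb1 gam (intf u) (intf v).

Definition inV (GD : set (R * R)) (u : Velt) : Prop :=
  (forall i, inH1_0 (OmegaQ i) (Gammai GD i) (bulk u i)) /\
  inH10_1 gam (intf u).

Definition normV (u : Velt) : R :=
  Num.sqrt (\sum_(i < 2) normH1_2 (Omegai i) (bulk u i) ^+ 2
            + normH1_1 gam (intf u) ^+ 2).

Definition Lelt := 'I_2 -> (R -> R) -> R.

Definition zeroL : Lelt := fun _ _ => 0.

Definition inL (lam : Lelt) : Prop := forall i, inH00' i (lam i).

Definition eqL (lam mu : Lelt) : Prop := forall i, eqH00' i (lam i) (mu i).

Definition normL (lam : Lelt) : R :=
  Num.sqrt (\sum_(i < 2) normH00' i (lam i) ^+ 2).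

Definition form_a (d eox ech : R) (u v : Velt) : R :=
  \sum_(i < 2) Rintegral leb2 (Omegai i)
     (fun z => eox * \sum_(k < 2) wpartial (Omegai i) k (bulk u i) z
                                  * wpartial (Omegai i) k (bulk v i) z)
  + d * Rintegral leb1 gam
          (fun x => ech * wderiv gam (intf u) x * wderiv gam (intf v) x).

Definition form_b (mu : Lelt) (u : Velt) : R :=
  \sum_(i < 2) mu i (fun x => trace_gam i (bulk u i) x - intf u x).

Definition continuity_constant (GD : set (R * R)) (d eox ech alpha1 : R)
    : Prop :=
  forall u v, inV GD u -> inV GD v ->
    form_a d eox ech u v <= alpha1 * normV u * normV v.

Definition coercivity_constant (GD : set (R * R)) (d eox ech alpha2 : R)
    : Prop :=
  forall u, inV GD u -> form_a d eox ech u u >= alpha2 * normV u ^+ 2.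

Definition infsup_constant (GD : set (R * R)) (beta : R) : Prop :=
  (beta%:E <=
   ereal_inf [set ereal_sup [set (form_b lam v / (normL lam * normV v))%:E |
                              v in [set v | inV GD v /\ ~ eqV v zeroV]] |
               lam in [set lam | inL lam /\ ~ eqL lam zeroL]])%E.

Definition solution (GD : set (R * R)) (d eox ech : R) (rho : R -> R)
    (u : Velt) (lam : Lelt) : Prop :=
  [/\ inV GD u, inL lam,
      forall v, inV GD v ->
        form_a d eox ech u v - form_b lam v
        = Rintegral leb1 gam (fun x => rho x * intf v x) &
      forall mu, inL mu -> form_b mu u = 0].

End Problem.

(* Main.v *)
(* Let K be the space of those u in V whose traces on the interface agree with
   u_gamma; it is the kernel of b. The form a is symmetric and coercive and K is
   complete, so the Riesz theorem yields u in K with a(u, v) = int rho v_gamma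
   for v in K. The residual v |-> a(u, v) - int rho v_gamma vanishes on K, hence
   depends on v only through the jumps v_i|gamma - v_gamma. A cutoff in y, equal
   to 1 on the interface and vanishing where the vertical sides may leave
   Gamma_D, shows that these jumps lie in H^(1/2)_00; conversely every pair in
   H^(1/2)_00 x H^(1/2)_00 is the jump of an element of V with v_gamma = 0. So
   the residual is b(lambda, .) for a bounded lambda. Uniqueness and the bounds
   follow by testing with u and from the inf-sup condition.

   Completeness of K rests on the continuity of traces, which comes from the
   fundamental theorem of calculus across the rectangle, and on the uniqueness of
   weak derivatives, i.e. on the density of test functions in L^2. *)

Require Import Defs.
From HB Require Import structures.
From mathcomp Require Import all_boot all_order all_algebra.
From mathcomp Require Import all_classical all_reals all_analysis.
From mathcomp Require Import measurable_realfun ring lra.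

Set Implicit Arguments.
Unset Strict Implicit.
Unset Printing Implicit Defensive.

Import Order.TTheory GRing.Theory Num.Theory.
Import numFieldNormedType.Exports.

Local Open Scope classical_set_scope.
Local Open Scope ring_scope.

(** * Square-integrable functions *)

(** Elements of the spaces are bare functions compared almost everywhere, and weak derivatives and
    traces are picked by choice. Linearity therefore holds only up to null sets, and limit arguments
    are carried out by hand on squared norms. Completeness is stated for sequences whose squared
    differences are at most [C / 8 ^+ n]: the rate 8 leaves room for a weight [4 ^+ n] with a
    convergent sum, so that such sequences converge almost everywhere without extraction and zero
    boundary values survive the limit. Near-minimisers of a quadratic functional, taken within
    [1 / 8 ^+ n] of the infimum, have this rate. A trace exists only once approximants smooth up to
    the boundary are exhibited. This dictates the constructions: multiplication by a smooth cutoff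
    preserves approximants, and an interface function [u] is extended as [u(x) chi(y)], approximated
    by [phi(x) chi(y)] with test functions [phi]. *)

Lemma quadratic_discriminant {R : realFieldType} (a p b : R) : 0 <= a -> 0 <= b ->
  (forall c, 0 <= c ^+ 2 * a + c *+ 2 * p + b) -> p ^+ 2 <= a * b.
Proof.
move=> a0 b0 q; have [a_eq0|a_neq0] := eqVneq a 0; last first.
  have a_gt0 : 0 < a by rewrite lt_def a_neq0.
  (* The minimiser of the quadratic; [a] times the value there is [a * b - p ^+ 2]. *)
  have := q (- p / a); rewrite -(pmulr_rge0 _ a_gt0).
  suff -> : a * ((- p / a) ^+ 2 * a + (- p / a) *+ 2 * p + b) = a * b - p ^+ 2.
    by rewrite subr_ge0.
  by field.
have [->|p0] := eqVneq p 0; first by rewrite expr0n mulr_ge0.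
(* When [a = 0] and [p != 0], this point gives the affine function the value -1, a contradiction. *)
have := q (- (b + 1) / (p *+ 2)).
rewrite a_eq0 mulr0 add0r.
have -> : - (b + 1) / (p *+ 2) *+ 2 * p = - (b + 1) by field.
by lra.
Qed.

Section L2Theory.
Context {d : measure_display} {T : measurableType d} {R : realType}.
Variables (mu : {measure set T -> \bar R}) (D : set T).
Hypothesis mD : measurable D.
Implicit Types f g h : T -> R.

Definition dotL2 f g : R := Rintegral mu D (fun x => f x * g x).

Lemma sqnormL2E f : sqnormL2 mu D f = dotL2 f f.
Proof. by apply: eq_Rintegral => x _; rewrite expr2. Qed.

Lemma eq_dotL2 f g f' g' : (forall x, D x -> f x * g x = f' x * g' x) ->
  dotL2 f g = dotL2 f' g'.
Proof. by move=> e; apply: eq_Rintegral => x /set_mem /e. Qed.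

Lemma eq_sqnormL2 f g : (forall x, D x -> f x = g x) ->
  sqnormL2 mu D f = sqnormL2 mu D g.
Proof. by move=> e; apply: eq_Rintegral => x /set_mem /e ->. Qed.

Lemma dotL20l g : dotL2 (fun=> 0) g = 0.
Proof.
by rewrite /dotL2 /Rintegral; under eq_integral do rewrite mul0r; rewrite integral0.
Qed.

Lemma sqnormL2_ge0 f : 0 <= sqnormL2 mu D f.
Proof. by apply: Rintegral_ge0 => x _; exact: sqr_ge0. Qed.

Lemma L2_mul f g : L2 mu D f -> L2 mu D g ->
  mu.-integrable D (fun x => (f x * g x)%:E).
Proof.
move=> [mf If] [mg Ig].
apply: (@le_integrable _ _ _ _ _ mD _ (fun x => (f x ^+ 2 + g x ^+ 2)%:E)).
- by apply/measurable_EFinP; exact: measurable_funM.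
- move=> x _ /=; rewrite lee_fin [leRHS]ger0_norm ?addr_ge0 ?sqr_ge0//.
  by rewrite ler_norml; apply/andP; split; nra.
- have := integrableD mD If Ig; apply: eq_integrable => // x _.
Qed.

Lemma L2_lin (c : R) f g : L2 mu D f -> L2 mu D g ->
  L2 mu D (fun x => c * f x + g x).
Proof.
move=> L2f L2g; have I12 := L2_mul L2f L2g; case: L2f L2g => mf If [mg Ig].
split; first by apply: measurable_funD => //; exact: measurable_funM.
have := integrableD mD (integrableZl mD (c ^+ 2) If)
  (integrableD mD (integrableZl mD (c *+ 2) I12) Ig).
apply: eq_integrable => // x _ /=.
by rewrite -!EFinM -!EFinD; congr EFin; ring.
Qed.

Lemma L2_0 : L2 mu D (fun=> 0).
Proof.
split; first exact: measurable_cst.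
by under eq_fun do rewrite expr0n; exact: integrable0.
Qed.

Lemma L2Z (c : R) f : L2 mu D f -> L2 mu D (fun x => c * f x).
Proof.
move=> /L2_lin /(_ L2_0) => /(_ c).
by congr L2; apply/funext => x; rewrite addr0.
Qed.

Lemma L2B f g : L2 mu D f -> L2 mu D g -> L2 mu D (fun x => f x - g x).
Proof.
move=> Lf Lg; have := L2_lin (-1) Lg Lf.
by congr L2; apply/funext => x; rewrite mulN1r addrC.
Qed.

Lemma dotL2C f g : dotL2 f g = dotL2 g f.
Proof. by apply: eq_Rintegral => x _; rewrite mulrC. Qed.

Lemma dotL2_linl (c : R) f g h : L2 mu D f -> L2 mu D g -> L2 mu D h ->
  dotL2 (fun x => c * f x + g x) h = c * dotL2 f h + dotL2 g h.
Proof.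
move=> Lf Lg Lh; rewrite /dotL2 -RintegralZl//; last exact: L2_mul.
rewrite -RintegralD//; last 2 first.
- by apply: eq_integrable (L2_mul (L2Z c Lf) Lh) => // x _; rewrite /= mulrA.
- exact: L2_mul.
- by apply: eq_Rintegral => x _; rewrite mulrDl mulrA.
Qed.

Lemma dotL2_linr (c : R) f g h : L2 mu D f -> L2 mu D g -> L2 mu D h ->
  dotL2 h (fun x => c * f x + g x) = c * dotL2 h f + dotL2 h g.
Proof. by move=> Lf Lg Lh; rewrite !(dotL2C h) dotL2_linl. Qed.

Lemma sqnormL2_lin (c : R) f g : L2 mu D f -> L2 mu D g ->
  sqnormL2 mu D (fun x => c * f x + g x) =
  c ^+ 2 * sqnormL2 mu D f + c *+ 2 * dotL2 f g + sqnormL2 mu D g.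
Proof.
move=> Lf Lg; rewrite !sqnormL2E dotL2_linl//; last exact: L2_lin.
by rewrite !dotL2_linr// (dotL2C g f); ring.
Qed.

Lemma dotL2_cauchy_schwarz f g : L2 mu D f -> L2 mu D g ->
  dotL2 f g ^+ 2 <= sqnormL2 mu D f * sqnormL2 mu D g.
Proof.
move=> Lf Lg.
have f0 := sqnormL2_ge0 f; have g0 := sqnormL2_ge0 g.
have q c : 0 <= c ^+ 2 * sqnormL2 mu D f + c *+ 2 * dotL2 f g + sqnormL2 mu D g.
  by rewrite -sqnormL2_lin// sqnormL2_ge0.
by apply: quadratic_discriminant.
Qed.

Lemma normL2_sqr f : normL2 mu D f ^+ 2 = sqnormL2 mu D f.
Proof. by rewrite sqr_sqrtr ?sqnormL2_ge0. Qed.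

Lemma dotL2_le f g : L2 mu D f -> L2 mu D g ->
  `|dotL2 f g| <= normL2 mu D f * normL2 mu D g.
Proof.
move=> Lf Lg; rewrite -(@ler_pXn2r _ 2)// ?nnegrE ?mulr_ge0 ?sqrtr_ge0//.
by rewrite real_normK ?num_real// exprMn !normL2_sqr dotL2_cauchy_schwarz.
Qed.

(** The two sides differ by the squared norm of [g - f]. This replaces the triangle inequality, so
    that estimates stay with squared norms. *)
Lemma sqnormL2D_le f g : L2 mu D f -> L2 mu D g ->
  sqnormL2 mu D (fun x => f x + g x) <=
  2 * sqnormL2 mu D f + 2 * sqnormL2 mu D g.
Proof.
move=> Lf Lg; have := sqnormL2_ge0 (fun x => (-1) * f x + g x).
have -> : (fun x => f x + g x) = (fun x => 1 * f x + g x).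
  by apply/funext => x; rewrite mul1r.
rewrite !sqnormL2_lin//; lra.
Qed.

Lemma sqnormL2Z (c : R) f : L2 mu D f ->
  sqnormL2 mu D (fun x => c * f x) = c ^+ 2 * sqnormL2 mu D f.
Proof.
move=> [mf If]; rewrite /sqnormL2 -RintegralZl//.
by apply: eq_Rintegral => x _; rewrite exprMn.
Qed.

Lemma sqnormL2_subC f g :
  sqnormL2 mu D (fun x => f x - g x) = sqnormL2 mu D (fun x => g x - f x).
Proof. by apply: eq_Rintegral => x _; rewrite -sqrrN opprB. Qed.

Lemma ae_eq_Rintegral f g : measurable_fun D f -> measurable_fun D g ->
  ae_eq mu D f g -> Rintegral mu D f = Rintegral mu D g.
Proof.
move=> mf mg fg; congr fine; apply: ae_eq_integral => //.
- exact/measurable_EFinP.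
- exact/measurable_EFinP.
- by apply: filterS fg => x /= h Dx; rewrite h.
Qed.

Lemma ae_eq_dotL2 f g h : measurable_fun D f -> measurable_fun D g ->
  measurable_fun D h -> ae_eq mu D f g -> dotL2 f h = dotL2 g h.
Proof.
move=> mf mg mh fg; apply: ae_eq_Rintegral; try exact: measurable_funM.
by apply: filterS fg => x /= e Dx; rewrite e.
Qed.

Lemma ae_eq_sqnormL2 f g : measurable_fun D f -> measurable_fun D g ->
  ae_eq mu D f g -> sqnormL2 mu D f = sqnormL2 mu D g.
Proof.
move=> mf mg fg; apply: ae_eq_Rintegral; try exact: measurable_funX.
by apply: filterS fg => x /= e Dx; rewrite e.
Qed.

Lemma ae_eq_L2 f g : measurable_fun D g -> ae_eq mu D f g ->
  L2 mu D f -> L2 mu D g.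
Proof.
move=> mg fg [mf /integrableP[mf2 If]]; split => //; apply/integrableP; split.
  by apply/measurable_EFinP; exact: measurable_funX.
rewrite (le_lt_trans _ If)// le_eqVlt; apply/orP; left; apply/eqP.
apply: ae_eq_integral => //.
- by apply/measurableT_comp/measurable_EFinP => //; exact: measurable_funX.
- exact: measurableT_comp.
- by apply: filterS fg => x /= e Dx; rewrite e.
Qed.

Lemma sqnormL2_eq0 f : L2 mu D f -> sqnormL2 mu D f = 0 ->
  ae_eq mu D f (fun=> 0).
Proof.
move=> [mf If] f0.
have mf2 : measurable_fun D (fun x => (f x ^+ 2)%:E).
  by apply/measurable_EFinP; exact: measurable_funX.
have /(ae_eq_integral_abs mu mD mf2) : (\int[mu]_(x in D) `|(f x ^+ 2)%:E|)%E = 0%E.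
  rewrite (eq_integral (fun x => (f x ^+ 2)%:E)); last first.
    by move=> x _ /=; rewrite ger0_norm// sqr_ge0.
  by rewrite -[LHS]fineK ?integrable_fin_num//; congr EFin.
apply: filterS => x /= h /h [] /eqP; rewrite sqrf_eq0 => /eqP; exact.
Qed.

Lemma L2_bounded_mul (M : R) f g : measurable_fun D g ->
  (forall x, D x -> `|g x| <= M) -> L2 mu D f -> L2 mu D (fun x => g x * f x).
Proof.
move=> mg gM [mf If]; split; first exact: measurable_funM.
apply: (le_integrable mD _ _ (integrableZl mD (M ^+ 2) If)).
  by apply/measurable_EFinP/measurable_funX/measurable_funM.
move=> x Dx; rewrite -EFinM.
change ((`|(g x * f x) ^+ 2| <= `|M ^+ 2 * f x ^+ 2|)%R).
rewrite [leLHS]ger0_norm ?sqr_ge0// [leRHS]ger0_norm; last first.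
  by rewrite mulr_ge0 ?sqr_ge0.
rewrite exprMn ler_wpM2r ?sqr_ge0// -(real_normK (num_real (g x))).
by rewrite ler_pXn2r ?nnegrE ?gM// (le_trans _ (gM _ Dx)).
Qed.

Lemma sqnormL2_bounded_mul (M : R) f g : measurable_fun D g ->
  (forall x, D x -> `|g x| <= M) -> L2 mu D f ->
  sqnormL2 mu D (fun x => g x * f x) <= M ^+ 2 * sqnormL2 mu D f.
Proof.
move=> mg gM Lf; have [_ Igf] := L2_bounded_mul mg gM Lf; have [mf If] := Lf.
rewrite /sqnormL2 -RintegralZl//; apply: le_Rintegral => //.
  by apply: eq_integrable (integrableZl mD (M ^+ 2) If) => // x _; rewrite /= EFinM.
move=> x Dx; rewrite exprMn ler_wpM2r ?sqr_ge0//.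
rewrite -(real_normK (num_real (g x))).
by rewrite ler_pXn2r ?nnegrE ?gM// (le_trans _ (gM _ Dx)).
Qed.

End L2Theory.

(** * Completeness of L^2 along fast Cauchy sequences *)

Section L2Complete.
Context {d : measure_display} {T : measurableType d} {R : realType}.
Variables (mu : {measure set T -> \bar R}) (D : set T).
Hypothesis mD : measurable D.

(** The increments are at most [Num.sqrt M / 2 ^ n] in absolute value, so the telescoping series
    converges absolutely. *)
Lemma geometric_increments_cvg (u : R ^nat) (M : R) :
  (forall n, 4 ^+ n * (u n - u n.+1) ^+ 2 <= M) -> cvgn u.
Proof.
move=> uM.
have M0 : 0 <= M by have := uM 0; rewrite expr0 mul1r; exact/le_trans/sqr_ge0.
have -> : u = (fun n => u 0 + series (telescope u) n).
  by apply/funext => n; rewrite -eq_sum_telescope.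
apply: is_cvgD; first exact: is_cvg_cst.
apply: normed_cvg; rewrite /normed_series_of.
apply: (@series_le_cvg _ _ (geometric (Num.sqrt M) 2^-1)).
- by move=> n /=.
- by move=> n; rewrite /geometric /= mulr_ge0 ?sqrtr_ge0 ?exprn_ge0 ?invr_ge0.
- move=> n; rewrite /geometric /= /telescope /=.
  rewrite -(@ler_pXn2r _ 2)// ?nnegrE ?mulr_ge0 ?sqrtr_ge0 ?exprn_ge0 ?invr_ge0//.
  rewrite real_normK ?num_real// exprMn sqr_sqrtr// -sqrrN opprB.
  have := uM n; rewrite -ler_pdivlMl ?exprn_gt0// => /le_trans; apply.
  rewrite mulrC ler_wpM2l// -exprM mulnC exprM.
  by have -> : (2^-1 : R) ^+ 2 = 4^-1; [field|rewrite exprVn].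
- apply: is_cvg_geometric_series; rewrite ger0_norm ?invr_ge0//.
  by rewrite invf_lt1// ltr1n.
Qed.

(* Weighting the increments by [4 ^ n] makes their sum integrable, which gives
   almost everywhere geometric convergence without passing to a subsequence. *)
Lemma L2_fast_cauchy_ae (f : nat -> T -> R) (C : R) :
  (forall n, L2 mu D (f n)) ->
  (forall n m, (n <= m)%N ->
    sqnormL2 mu D (fun x => f n x - f m x) <= C / 8 ^+ n) ->
  {ae mu, forall x, D x -> cvgn (f ^~ x)}.
Proof.
move=> Lf fC.
have C0 : 0 <= C.
  by have := fC 0 0%N (leqnn _); rewrite expr0 divr1; exact/le_trans/sqnormL2_ge0.
pose h n x : \bar R := (4 ^+ n * (f n x - f n.+1 x) ^+ 2)%:E.
have Ih n : mu.-integrable D (h n).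
  have [_ I] := L2B mD (Lf n) (Lf n.+1).
  by apply: eq_integrable (integrableZl mD (4 ^+ n) I) => // x _; rewrite /h EFinM.
have mh n : measurable_fun D (h n) by exact: measurable_int (Ih n).
have h0 n x : D x -> (0 <= h n x)%E.
  by move=> _; rewrite lee_fin mulr_ge0 ?sqr_ge0 ?exprn_ge0.
pose H x : \bar R := (\sum_(n <oo) h n x)%E.
have H0 x : D x -> (0 <= H x)%E by move=> Dx; apply: nneseries_ge0 => n _ _; exact: h0.
have mH : measurable_fun D H.
  by apply: ge0_emeasurable_sum => [k x Dx _|k _]; [exact: h0|exact: mh].
have iH : (\int[mu]_(x in D) H x < +oo)%E.
  rewrite integral_nneseries//.
  (* The integral of [h n] is at most [4 ^+ n * (C / 8 ^+ n) = C / 2 ^ n], written with [2 ^ n.+1]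
     to fit [epsilon_trick0]. *)
  apply: (@le_lt_trans _ _ (\sum_(n <oo) (C *+ 2 / (2 ^ n.+1)%:R)%:E)%E); last first.
    apply: (le_lt_trans (epsilon_trick0 xpredT _)); first by rewrite mulrn_wge0.
    exact: ltry.
  apply: lee_nneseries => [n _ _|n _]; first by apply: integral_ge0 => x; exact: h0.
  rewrite -(fineK (integrable_fin_num mD (Ih n))) lee_fin.
  have -> : fine (\int[mu]_(x in D) h n x)%E =
      4 ^+ n * sqnormL2 mu D (fun x => f n x - f n.+1 x).
    by rewrite /sqnormL2 -RintegralZl//; have [] := L2B mD (Lf n) (Lf n.+1).
  have -> : C *+ 2 / (2 ^ n.+1)%:R = 4 ^+ n * (C / 8 ^+ n).
    rewrite natrX exprS (_ : 8 = 4 * 2)//; last by rewrite -natrM.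
    by rewrite exprMn; field; rewrite !expf_neq0.
  by rewrite ler_wpM2l ?exprn_ge0// fC.
have IH : mu.-integrable D H.
  apply/integrableP; split => //.
  by under eq_integral => x /set_mem Dx do rewrite gee0_abs ?H0//.
apply: filterS (integrable_ae mD IH) => x Hx Dx.
apply: (@geometric_increments_cvg _ (fine (H x))) => n.
rewrite -lee_fin fineK ?Hx//.
apply: le_trans (@nneseries_lim_ge _ (h ^~ x) xpredT 0%N n.+1 _).
  rewrite big_nat_recr//= leeDr// sume_ge0// => i _; exact: h0.
by move=> i _ _; exact: h0.
Qed.

Lemma L2_fast_complete (f : nat -> T -> R) (C : R) :
  (forall n, L2 mu D (f n)) ->
  (forall n m, (n <= m)%N ->
    sqnormL2 mu D (fun x => f n x - f m x) <= C / 8 ^+ n) ->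
  exists g, [/\ L2 mu D g,
    forall n, sqnormL2 mu D (fun x => f n x - g x) <= C / 8 ^+ n &
    {ae mu, forall x, D x -> f ^~ x @ \oo --> g x}].
Proof.
move=> Lf fC; have aecv := L2_fast_cauchy_ae Lf fC.
(* The upper limit is measurable without knowing where the sequence converges, and equals the limit
   wherever there is one. *)
pose g x := fine (limn_esup (fun n => (f n x)%:E)).
have mf n : measurable_fun D (f n) by case: (Lf n).
have mg : measurable_fun D g.
  apply: (@measurableT_comp _ _ _ _ _ _ (fine : \bar R -> R)).
    exact: fine_measurable.
  by apply: measurable_fun_limn_esup => n; exact/measurable_EFinP.
have fg : {ae mu, forall x, D x -> f ^~ x @ \oo --> g x}.
  apply: filterS aecv => x cv Dx; have {}cv := cv Dx.
  suff -> : g x = limn (f ^~ x) by [].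
  have cvE : (fun n => (f n x)%:E) @ \oo --> (limn (f ^~ x))%:E.
    by apply/fine_cvgP; split; [exact: nearW|exact: cv].
  by rewrite /g is_cvg_limn_esupE; [rewrite (cvg_lim _ cvE)|apply/cvg_ex;
    exists (limn (f ^~ x))%:E].
(* Fatou's lemma in [m] for the squares of [f n - f m]: almost everywhere they tend to the square of
   [f n - g]. *)
have key n : (\int[mu]_(x in D) ((f n x - g x) ^+ 2)%:E <= (C / 8 ^+ n)%:E)%E.
  pose u m x : \bar R := ((f n x - f m x) ^+ 2)%:E.
  have mu_ m : measurable_fun D (u m).
    by apply/measurable_EFinP/measurable_funX/measurable_funB.
  have -> : (\int[mu]_(x in D) ((f n x - g x) ^+ 2)%:E =
             \int[mu]_(x in D) limn_einf (u ^~ x))%E.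
    apply: ae_eq_integral => //.
    - by apply/measurable_EFinP/measurable_funX/measurable_funB.
    - apply: (eq_measurable_fun (fun x => - limn_esup (fun m => - u m x))%E) => //.
      apply: measurableT_comp => //; apply: measurable_fun_limn_esup => m.
      exact: measurableT_comp.
    - apply: filterS fg => x cv Dx; have {}cv := cv Dx.
      have cvE : u ^~ x @ \oo --> ((f n x - g x) ^+ 2)%:E.
        apply/fine_cvgP; split; first exact: nearW.
        apply: (@cvg_comp _ _ _ (fun m => f n x - f m x) (fun t => t ^+ 2)).
          by apply: cvgB cv; exact: cvg_cst.
        exact: exprn_continuous.
      by rewrite is_cvg_limn_einfE; [rewrite (cvg_lim _ cvE)|apply/cvg_ex; eexists; exact: cvE].
  apply: (le_trans (fatou mu mD mu_ _)).
    by move=> m x _; rewrite lee_fin sqr_ge0.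
  rewrite limn_einf_lim; apply: lime_le; first exact: is_cvg_einfs.
  exists n => // m nm; rewrite /einfs /=.
  have [_ I] := L2B mD (Lf n) (Lf m).
  apply: (@le_trans _ _ (\int[mu]_(x in D) u m x)%E).
    by apply: ereal_inf_lbound; exists m => /=.
  by rewrite -(fineK (integrable_fin_num mD I)) lee_fin; exact: fC.
have Lfg n : L2 mu D (fun x => f n x - g x).
  split; first exact: measurable_funB.
  apply/integrableP; split.
    by apply/measurable_EFinP/measurable_funX/measurable_funB.
  under eq_integral do rewrite gee0_abs ?lee_fin ?sqr_ge0//.
  by rewrite (le_lt_trans (key n))// ltry.
exists g; split => //.
- have := L2B mD (Lf 0) (Lfg 0).
  by congr L2; apply/funext => x; rewrite opprB addrC subrK.
- by move=> n; rewrite -lee_fin fineK ?integrable_fin_num//; case: (Lfg n).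
Qed.

End L2Complete.

(* Otherwise unification unfolds these down to the Lebesgue integral. *)
#[global] Opaque dotL2 sqnormL2.

(** * Weak derivatives for an abstract class of test functions *)

Lemma cvg_pow8 {R : realType} (C : R) : (fun m => C / 8 ^+ m) @ \oo --> (0 : R).
Proof.
have -> : (fun m => C / 8 ^+ m) = (fun m => C * 8^-1 ^+ m).
  by apply/funext => m; rewrite exprVn.
rewrite -[X in _ --> X](mulr0 C); apply: cvgM; first exact: cvg_cst.
by apply: cvg_expr; rewrite ger0_norm ?invr_ge0// invf_lt1// ltr1n.
Qed.

Lemma pow8_small {R : realType} (C e : R) : 0 < e -> exists m, C / 8 ^+ m <= e.
Proof.
move=> e0; have /cvgrPdist_le /(_ _ e0)[m _ /(_ m (leqnn _))] := cvg_pow8 C.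
by rewrite /= sub0r normrN => h; exists m; exact: le_trans (ler_norm _) h.
Qed.

(** What the Sobolev calculus uses of a domain and its test functions, so that the interval
    ([n = 1]) and the rectangle ([n = 2]) are treated at once. The last field is density in L^2,
    expressed by the triviality of the orthogonal complement. *)
Record test_space {d : measure_display} {T : measurableType d} {R : realType}
    (mu : {measure set T -> \bar R}) (D : set T) (test : set (T -> R)) (n : nat)
    (dd : 'I_n -> (T -> R) -> T -> R) : Prop := TestSpace {
  test_space_measurable : measurable D;
  test_space_L2 : forall phi, test phi -> L2 mu D phi;
  test_space_deriv_L2 : forall k phi, test phi -> L2 mu D (dd k phi);
  test_space_separates : forall f, L2 mu D f ->
    (forall phi, test phi -> dotL2 mu D f phi = 0) -> ae_eq mu D f (fun=> 0) }.

Section WeakDerivative.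
Context {d : measure_display} {T : measurableType d} {R : realType}.
Variables (mu : {measure set T -> \bar R}) (D : set T).
Variables (test : set (T -> R)) (n : nat) (dd : 'I_n -> (T -> R) -> T -> R).
Hypothesis TS : test_space mu D test dd.
Let mD : measurable D := test_space_measurable TS.
Let test_L2 := test_space_L2 TS.
Let dd_test_L2 := test_space_deriv_L2 TS.
Let test_dense := test_space_separates TS.
Implicit Types (u v g h : T -> R) (k : 'I_n).

Local Notation L2 := (L2 mu D).
Local Notation dotL2 := (dotL2 mu D).
Local Notation sqnormL2 := (sqnormL2 mu D).

Definition weak_deriv k u g : Prop :=
  L2 g /\ forall phi, test phi -> dotL2 u (dd k phi) = - dotL2 g phi.

Definition inH1 u : Prop := L2 u /\ forall k, exists g, weak_deriv k u g.

(** Chosen by the same [xget] as [wpartial] and [wderiv], so that both are instances of it by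
    conversion. *)
Definition wgrad k u : T -> R := xget (fun=> 0) [set g | weak_deriv k u g].

Definition dotH1 u v : R := dotL2 u v + \sum_k dotL2 (wgrad k u) (wgrad k v).

Definition sqnormH1 u : R := sqnormL2 u + \sum_k sqnormL2 (wgrad k u).

Lemma weak_deriv_unique k u g h :
  weak_deriv k u g -> weak_deriv k u h -> ae_eq mu D g h.
Proof.
move=> [Lg ug] [Lh uh]; have := test_dense (L2_lin mD (-1) Lh Lg).
move=> /(_ _)/wrap[phi tphi|].
  rewrite dotL2_linl//; last exact: test_L2.
  by have := ug _ tphi; rewrite uh// => /oppr_inj ->; rewrite mulN1r addNr.
by apply: filterS => x /= e Dx; apply/eqP; rewrite -subr_eq0 addrC -mulN1r e.
Qed.

Lemma weak_deriv_wgrad k u : inH1 u -> weak_deriv k u (wgrad k u).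
Proof. by move=> [_ /(_ k)[g ug]]; apply: (xgetI (fun=> 0) ug). Qed.

Lemma L2_wgrad k u : inH1 u -> L2 (wgrad k u).
Proof. by move=> /(weak_deriv_wgrad k)[]. Qed.

Lemma weak_deriv_ae k u g : weak_deriv k u g -> ae_eq mu D (wgrad k u) g.
Proof.
by move=> ug; apply: (weak_deriv_unique _ ug); apply: (xgetI (fun=> 0) ug).
Qed.

#[local] Opaque wgrad.

Lemma weak_deriv_lin k (c : R) u v g h : L2 u -> L2 v ->
  weak_deriv k u g -> weak_deriv k v h ->
  weak_deriv k (fun x => c * u x + v x) (fun x => c * g x + h x).
Proof.
move=> Lu Lv [Lg ug] [Lh vh]; split; first exact: L2_lin.
move=> phi tphi; rewrite !dotL2_linl//; [|exact: test_L2|exact: dd_test_L2].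
by rewrite ug// vh// opprD mulrN.
Qed.

Lemma inH1_lin (c : R) u v : inH1 u -> inH1 v -> inH1 (fun x => c * u x + v x).
Proof.
move=> Hu Hv; have [[Lu _] [Lv _]] := (Hu, Hv); split; first exact: L2_lin.
move=> k; eexists.
by apply: weak_deriv_lin => //; exact: weak_deriv_wgrad.
Qed.

Lemma inH1B u v : inH1 u -> inH1 v -> inH1 (fun x => u x - v x).
Proof.
move=> Hu Hv; have := inH1_lin (-1) Hv Hu.
suff -> : (fun x => (-1) * v x + u x) = (fun x => u x - v x) by [].
by apply/funext => x; rewrite mulN1r addrC.
Qed.

Lemma wgrad_lin k (c : R) u v : inH1 u -> inH1 v ->
  ae_eq mu D (wgrad k (fun x => c * u x + v x))
             (fun x => c * wgrad k u x + wgrad k v x).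
Proof.
move=> Hu Hv; have [[Lu _] [Lv _]] := (Hu, Hv); apply: weak_deriv_ae.
by apply: weak_deriv_lin => //; exact: weak_deriv_wgrad.
Qed.

Lemma weak_deriv0 k : weak_deriv k (fun=> 0) (fun=> 0).
Proof.
split; first exact: L2_0.
by move=> phi _; rewrite !dotL20l oppr0.
Qed.

Lemma inH1_0fun : inH1 (fun=> 0).
Proof. by split; [exact: L2_0|move=> k; eexists; exact: weak_deriv0]. Qed.

Lemma dotL2_wgrad_linl k (c : R) u v w : inH1 u -> inH1 v -> inH1 w ->
  dotL2 (wgrad k (fun x => c * u x + v x)) (wgrad k w) =
  c * dotL2 (wgrad k u) (wgrad k w) + dotL2 (wgrad k v) (wgrad k w).
Proof.
move=> Hu Hv Hw; rewrite -dotL2_linl//; try exact: L2_wgrad.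
have [mw _] := L2_wgrad k Hw.
apply: ae_eq_dotL2 => //; last exact: wgrad_lin.
- by have [] := L2_wgrad k (inH1_lin c Hu Hv).
- by have [] := L2_lin mD c (L2_wgrad k Hu) (L2_wgrad k Hv).
Qed.

Lemma dotH1C u v : dotH1 u v = dotH1 v u.
Proof.
rewrite /dotH1 (dotL2C _ _ u).
apply: (f_equal (+%R (dotL2 v u))).
apply: eq_bigr => k _.
exact: dotL2C.
Qed.

Lemma dotH1_linl (c : R) u v w : inH1 u -> inH1 v -> inH1 w ->
  dotH1 (fun x => c * u x + v x) w = c * dotH1 u w + dotH1 v w.
Proof.
move=> Hu Hv Hw; have [[Lu _] [[Lv _] [Lw _]]] := (Hu, (Hv, Hw)).
rewrite /dotH1 dotL2_linl// mulrDr addrACA; congr (_ + _).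
rewrite mulr_sumr -big_split; apply: eq_bigr => k _ /=.
exact: dotL2_wgrad_linl.
Qed.

Lemma sqnormH1E u : sqnormH1 u = dotH1 u u.
Proof.
rewrite /sqnormH1 /dotH1 (sqnormL2E _ _ u).
by under eq_bigr do rewrite sqnormL2E.
Qed.

Lemma sqnormH1_ge0 u : 0 <= sqnormH1 u.
Proof. by rewrite addr_ge0 ?sumr_ge0// => *; exact: sqnormL2_ge0. Qed.

Lemma sqnormL2_le_H1 u : sqnormL2 u <= sqnormH1 u.
Proof. by rewrite lerDl sumr_ge0// => *; exact: sqnormL2_ge0. Qed.

Lemma sqnormL2_wgrad_le_H1 k u : sqnormL2 (wgrad k u) <= sqnormH1 u.
Proof.
rewrite /sqnormH1 (bigD1 k)//= addrCA lerDl addr_ge0 ?sqnormL2_ge0//.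
by rewrite sumr_ge0// => *; exact: sqnormL2_ge0.
Qed.

(** Uniqueness of weak derivatives frees the norm from the choice made in [wgrad], so it can be
    computed with explicit derivatives. *)
Lemma sqnormH1_weak u (g : 'I_n -> T -> R) : inH1 u ->
  (forall k, weak_deriv k u (g k)) ->
  sqnormH1 u = sqnormL2 u + \sum_k sqnormL2 (g k).
Proof.
move=> Hu ug; congr (_ + _); apply: eq_bigr => k _.
apply: ae_eq_sqnormL2 => //; last exact: weak_deriv_ae.
  by have [] := L2_wgrad k Hu.
by have [[]] := ug k.
Qed.

#[local] Opaque dotH1 sqnormH1.

Lemma sqnormH1_lin (c : R) u v : inH1 u -> inH1 v ->
  sqnormH1 (fun x => c * u x + v x) =
  c ^+ 2 * sqnormH1 u + c *+ 2 * dotH1 u v + sqnormH1 v.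
Proof.
move=> Hu Hv; have Huv := inH1_lin c Hu Hv.
rewrite (sqnormH1E u) (sqnormH1E v) (sqnormH1E (fun x => c * u x + v x)).
rewrite (dotH1_linl c Hu Hv Huv) !(dotH1C _ (fun x => c * u x + v x)).
rewrite (dotH1_linl c Hu Hv Hu) (dotH1_linl c Hu Hv Hv) (dotH1C v u).
by move: (dotH1 u u) (dotH1 u v) (dotH1 v v) => p q r; ring.
Qed.

Lemma sqnormH1D_le u v : inH1 u -> inH1 v ->
  sqnormH1 (fun x => u x + v x) <= 2 * sqnormH1 u + 2 * sqnormH1 v.
Proof.
move=> Hu Hv; have := sqnormH1_ge0 (fun x => (-1) * u x + v x).
have -> : (fun x => u x + v x) = (fun x => 1 * u x + v x).
  by apply/funext => x; rewrite mul1r.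
rewrite (sqnormH1_lin (-1) Hu Hv) (sqnormH1_lin 1 Hu Hv).
by move: (sqnormH1 u) (sqnormH1 v) (dotH1 u v) => p q r; lra.
Qed.

Lemma sqnormH1_sub_le u v w : inH1 u -> inH1 v -> inH1 w ->
  sqnormH1 (fun x => u x - w x) <=
  2 * sqnormH1 (fun x => u x - v x) + 2 * sqnormH1 (fun x => v x - w x).
Proof.
move=> Hu Hv Hw; have := sqnormH1D_le (inH1B Hu Hv) (inH1B Hv Hw).
suff -> : (fun x => u x - v x + (v x - w x)) = (fun x => u x - w x) by [].
by apply/funext => x; rewrite addrA subrK.
Qed.

Lemma sqnormH1_0 : sqnormH1 (fun=> 0) = 0.
Proof.
(* With [p] the squared norm of zero, the expansion for [c = -1] reads [p = p - 2 p + p]. *)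
have := sqnormH1_lin (-1) inH1_0fun inH1_0fun; rewrite !sqnormH1E.
rewrite (_ : (fun x => (-1) * 0 + 0) = (fun=> 0 : R)); last first.
  by apply/funext => x; rewrite mulr0 addr0.
by move: (dotH1 _ _) => p; lra.
Qed.

Lemma sqnormH1Z (c : R) u : inH1 u ->
  sqnormH1 (fun x => c * u x) = c ^+ 2 * sqnormH1 u.
Proof.
move=> Hu; have := sqnormH1_lin c Hu inH1_0fun.
rewrite (_ : (fun x => c * u x + 0) = (fun x => c * u x)); last first.
  by apply/funext => x; rewrite addr0.
rewrite sqnormH1_0 addr0 => ->.
have := dotH1_linl (-1) inH1_0fun inH1_0fun Hu.
rewrite (_ : (fun x => (-1) * 0 + 0) = (fun=> 0 : R)); last first.
  by apply/funext => x; rewrite mulr0 addr0.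
rewrite (dotH1C u).
by move: (dotH1 (fun=> 0) u) => p pE; have -> : p = 0; [lra|rewrite mulr0 addr0].
Qed.

Lemma sqnormH1_eq0 u : inH1 u -> sqnormH1 u = 0 -> ae_eq mu D u (fun=> 0).
Proof.
move=> [Lu _] u0; apply: sqnormL2_eq0 => //.
by apply/eqP; rewrite eq_le sqnormL2_ge0 andbT -u0 sqnormL2_le_H1.
Qed.

(** The defect [dotL2 u (dd k phi) + dotL2 g phi] vanishes for the pair [v], [h], so up to sign it
    equals the defect of the differences [v - u], [h - g], which is small by Cauchy-Schwarz. *)
Lemma weak_deriv_closed k u g : L2 u -> L2 g ->
  (forall e, 0 < e -> exists v h, [/\ L2 v, weak_deriv k v h,
    sqnormL2 (fun x => v x - u x) <= e & sqnormL2 (fun x => h x - g x) <= e]) ->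
  weak_deriv k u g.
Proof.
move=> Lu Lg app; split => // phi tphi.
have Lp := test_L2 tphi; have Ldp := dd_test_L2 k tphi.
apply/eqP; rewrite -addr_eq0 -sqrf_eq0; set s := (X in X ^+ 2).
rewrite eq_le sqr_ge0 andbT.
set A := sqnormL2 phi; set B := sqnormL2 (dd k phi).
have A0 : 0 <= A by exact: sqnormL2_ge0.
have B0 : 0 <= B by exact: sqnormL2_ge0.
apply/ler_addgt0Pr => e e0; rewrite add0r.
(* The squared defect is at most [2 * (A + B)] times the accuracy requested; adding 1 keeps the
   divisor positive. *)
have AB : 0 < 2 * (A + B + 1) by move: A B A0 B0 => A B; lra.
have [v [h [Lv [Lh vh] vu hg]]] := app _ (divr_gt0 e0 AB).
have -> : s = - (dotL2 (fun x => v x - u x) (dd k phi) +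
                 dotL2 (fun x => h x - g x) phi).
  have subE (a b : T -> R) : (fun x => a x - b x) = (fun x => (-1) * b x + a x).
    by apply/funext => x; rewrite mulN1r addrC.
  rewrite (subE v u) (subE h g) !dotL2_linl// vh// /s.
  by move: (dotL2 u _) (dotL2 g _) (dotL2 h _) => p q r; ring.
rewrite sqrrN.
have := dotL2_cauchy_schwarz mD (L2B mD Lv Lu) Ldp.
have := dotL2_cauchy_schwarz mD (L2B mD Lh Lg) Lp.
rewrite -/A -/B; move: vu hg.
move: A B A0 B0 AB {s} => A B A0 B0 AB.
move: (sqnormL2 (fun x => v x - u x)) (sqnormL2 (fun x => h x - g x)).
move: (dotL2 (fun x => v x - u x) _) (dotL2 (fun x => h x - g x) _).
move=> q p b a be ae pa qb.
have : 2 * (A + B) * (e / (2 * (A + B + 1))) <= e.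
  rewrite mulrA ler_pdivrMr; nra.
have : (q + p) ^+ 2 <= 2 * q ^+ 2 + 2 * p ^+ 2 by have := sqr_ge0 (q - p); nra.
nra.
Qed.

(** The functions and each of their [n] weak derivatives converge in L^2 with squared error at most
    [C / 8 ^+ m], whence the factor [n.+1]. Closedness of the weak derivative identifies the limits
    of the derivatives. *)
Lemma H1_fast_complete (u : nat -> T -> R) (C : R) : (forall m, inH1 (u m)) ->
  (forall m p, (m <= p)%N ->
    sqnormH1 (fun x => u m x - u p x) <= C / 8 ^+ m) ->
  exists v, [/\ inH1 v,
    forall m, sqnormH1 (fun x => u m x - v x) <= C *+ n.+1 / 8 ^+ m &
    {ae mu, forall x, D x -> u ^~ x @ \oo --> v x}].
Proof.
move=> Hu uC.
have C0 : 0 <= C.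
  by have := uC 0 0%N (leqnn _); rewrite expr0 divr1; exact/le_trans/sqnormH1_ge0.
have Lu m : L2 (u m) by have [] := Hu m.
have [v [Lv uv aev]] := L2_fast_complete mD Lu (fun m p mp =>
  le_trans (sqnormL2_le_H1 _) (uC m p mp)).
have /choice[g gP] k : exists g, L2 g /\
    forall m, sqnormL2 (fun x => wgrad k (u m) x - g x) <= C / 8 ^+ m.
  have [|m p mp|g [Lg ug _]] := @L2_fast_complete _ _ _ mu D mD
    (fun m => wgrad k (u m)) C.
  - by move=> m; exact: L2_wgrad.
  - apply: le_trans (uC m p mp).
    apply: le_trans (sqnormL2_wgrad_le_H1 k _).
    rewrite le_eqVlt; apply/orP; left; apply/eqP.
    transitivity (sqnormL2 (fun x => (-1) * wgrad k (u p) x + wgrad k (u m) x)).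
      by congr sqnormL2; apply/funext => x; rewrite mulN1r addrC.
    have -> : (fun x => u m x - u p x) = (fun x => (-1) * u p x + u m x).
      by apply/funext => x; rewrite mulN1r addrC.
    apply/esym/ae_eq_sqnormL2 => //; last exact: wgrad_lin.
      by have [] := L2_wgrad k (inH1_lin (-1) (Hu p) (Hu m)).
    by have [] := L2_lin mD (-1) (L2_wgrad k (Hu p)) (L2_wgrad k (Hu m)).
  - by exists g.
have vg k : weak_deriv k v (g k).
  have [Lg ug] := gP k; apply: weak_deriv_closed => // e e0.
  have [m me] := pow8_small C e0.
  exists (u m), (wgrad k (u m)); split => //.
  - exact: weak_deriv_wgrad.
  - exact: le_trans me.
  - exact: le_trans me.
have Hv : inH1 v by split => // k; exists (g k).
exists v; split => // m.
rewrite (@sqnormH1_weak _ (fun k x => wgrad k (u m) x - g k x)); last 2 first.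
- exact: inH1B.
- move=> k.
  have -> : (fun x => u m x - v x) = (fun x => (-1) * v x + u m x).
    by apply/funext => x; rewrite mulN1r addrC.
  have -> : (fun x => wgrad k (u m) x - g k x) =
      (fun x => (-1) * g k x + wgrad k (u m) x).
    by apply/funext => x; rewrite mulN1r addrC.
  by apply: weak_deriv_lin => //; exact: weak_deriv_wgrad.
rewrite mulrS mulrDl lerD//.
apply: (@le_trans _ _ (\sum_(k < n) C / 8 ^+ m)).
  by apply: ler_sum => k _; have [_] := gP k; exact.
by rewrite sumr_const card_ord mulrnAl.
Qed.

(** Testing the weak derivative of [u] with [chi * phi] and using the Leibniz rule on test functions
    moves [chi] onto [u]. The factor [1] gives the sum the shape [c * f + g] handled by the
    linearity lemmas. *)
Lemma weak_derivM k (chi dchi u g : T -> R) (M : R) : L2 u ->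
  measurable_fun D chi -> (forall x, D x -> `|chi x| <= M) ->
  measurable_fun D dchi -> (forall x, D x -> `|dchi x| <= M) ->
  (forall phi, test phi -> test (fun x => chi x * phi x) /\
    forall x, D x -> dd k (fun x => chi x * phi x) x =
      dchi x * phi x + chi x * dd k phi x) ->
  weak_deriv k u g ->
  weak_deriv k (fun x => chi x * u x) (fun x => 1 * (dchi x * u x) + chi x * g x).
Proof.
move=> Lu mc cM mdc dcM leib [Lg ug].
have Lcu := L2_bounded_mul mD mc cM Lu.
have Ldcu := L2_bounded_mul mD mdc dcM Lu.
have Lcg := L2_bounded_mul mD mc cM Lg.
split; first exact: L2_lin.
move=> phi tphi; have [tcp dcp] := leib _ tphi.
have Lp := test_L2 tphi; have Ldp := dd_test_L2 k tphi.
have Lcdp := L2_bounded_mul mD mc cM Ldp.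
have Ldcp := L2_bounded_mul mD mdc dcM Lp.
rewrite dotL2_linl// mul1r.
have := ug _ tcp.
have -> : dotL2 u (dd k (fun x => chi x * phi x)) =
    dotL2 u (fun x => 1 * (dchi x * phi x) + chi x * dd k phi x).
  by apply: eq_dotL2 => x Dx; rewrite dcp// mul1r.
rewrite dotL2_linr// mul1r => e.
have -> : dotL2 (fun x => chi x * u x) (dd k phi) =
    dotL2 u (fun x => chi x * dd k phi x).
  by apply: eq_dotL2 => x _; ring.
have -> : dotL2 (fun x => dchi x * u x) phi = dotL2 u (fun x => dchi x * phi x).
  by apply: eq_dotL2 => x _; ring.
have -> : dotL2 (fun x => chi x * g x) phi = dotL2 g (fun x => chi x * phi x).
  by apply: eq_dotL2 => x _; ring.
rewrite opprD -e.
by move: (dotL2 _ _) (dotL2 _ _) => p q; ring.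
Qed.

End WeakDerivative.

#[global] Opaque wgrad dotH1 sqnormH1.

(** * Smooth functions *)

Section SmoothCalculus.
Context {R : realType} {V : normedModType R}.
Implicit Types (f g : V -> R) (k : nat).

Lemma Ck_continuous k f : Ck k f -> continuous f.
Proof. by case: k => [|k] []. Qed.

Lemma CkS k f : Ck k.+1 f -> Ck k f.
Proof.
elim: k f => [f []//|k IH f [cf df]]; split => // v.
by have [dv Cv] := df v; split => //; exact: IH.
Qed.

Lemma Ck_cst k (c : R) : Ck k (fun=> c : R) (V := V).
Proof.
elim: k c => [c|k IH c]; split => //; try by move=> x; exact: cvg_cst.
move=> v; split; first by move=> x; exact: derivable_cst.
suff -> : (fun x => 'D_v (fun=> c : R) x) = (fun=> 0 : R) by exact: IH.
by apply/funext => x; exact: derive_cst.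
Qed.

Lemma CkD k f g : Ck k f -> Ck k g -> Ck k (fun x => f x + g x).
Proof.
elim: k f g => [|k IH] f g [cf Cf] [cg Cg]; split => //;
  try by move=> x; apply: cvgD; [exact: cf|exact: cg].
move=> v; have [df Cdf] := Cf v; have [dg Cdg] := Cg v; split.
  by move=> x; apply: derivableD.
suff -> : (fun x => 'D_v (fun x => f x + g x) x) = (fun x => 'D_v f x + 'D_v g x).
  exact: IH.
by apply/funext => x; exact: deriveD.
Qed.

Lemma CkM k f g : Ck k f -> Ck k g -> Ck k (fun x => f x * g x).
Proof.
elim: k f g => [|k IH] f g Cf Cg; split => //;
  try by move=> x; apply: cvgM; [exact: (Ck_continuous Cf)|exact: (Ck_continuous Cg)].
move=> v; have [_ /(_ v)[df Cdf]] := Cf; have [_ /(_ v)[dg Cdg]] := Cg; split.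
  by move=> x; apply: derivableM.
suff -> : (fun x => 'D_v (fun x => f x * g x) x) =
    (fun x => f x * 'D_v g x + g x * 'D_v f x).
  by apply: CkD; apply: IH => //; exact: CkS.
by apply/funext => x; exact: deriveM.
Qed.

Lemma CkV k f : (forall x, f x != 0) -> Ck k f -> Ck k (fun x => (f x)^-1).
Proof.
move=> f0; elim: k => [|k IH] Cf; split => //;
  try by move=> x; apply: cvgV => //; exact: (Ck_continuous Cf).
move=> v; have [_ /(_ v)[df Cdf]] := Cf; split.
  by move=> x; apply: derivableV.
suff -> : (fun x => 'D_v (fun x => (f x)^-1) x) =
    (fun x => (-1) * ((f x)^-1 * (f x)^-1) * 'D_v f x).
  by apply: CkM => //; apply: CkM; [exact: Ck_cst|apply: CkM; apply: IH; exact: CkS].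
apply/funext => x; rewrite (deriveV (f0 x) (df x)).
by rewrite -[LHS]/(_ * _) -exprVn expr2 mulN1r.
Qed.

Lemma smooth_continuous f : smooth f -> continuous f.
Proof. by move=> /(_ 0%N)/Ck_continuous. Qed.

Lemma smooth_derivable f x v : smooth f -> derivable f x v.
Proof. by move=> /(_ 1%N)[_ /(_ v)[]]. Qed.

Lemma smooth_derive f v : smooth f -> smooth (fun x => 'D_v f x).
Proof. by move=> Sf k; have [_ /(_ v)[]] := Sf k.+1. Qed.

Lemma smooth_cst (c : R) : smooth (fun=> c : R) (V := V).
Proof. by move=> k; exact: Ck_cst. Qed.

Lemma smoothD f g : smooth f -> smooth g -> smooth (fun x => f x + g x).
Proof. by move=> Sf Sg k; exact: CkD. Qed.

Lemma smoothM f g : smooth f -> smooth g -> smooth (fun x => f x * g x).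
Proof. by move=> Sf Sg k; exact: CkM. Qed.

Lemma smoothV f : (forall x, f x != 0) -> smooth f -> smooth (fun x => (f x)^-1).
Proof. by move=> f0 Sf k; exact: CkV. Qed.

Lemma smoothZ (c : R) f : smooth f -> smooth (fun x => c * f x).
Proof. by move=> Sf; apply: smoothM => //; exact: smooth_cst. Qed.

End SmoothCalculus.

(** * Functions of one coordinate and slices of functions on the plane *)

Section SmoothPlane.
Context {R : realType}.
Implicit Types (f : R -> R) (phi : R * R -> R).

(** The difference quotients are convertible: the first coordinate of [h *: v + p] is
    [h *: v.1 + p.1]. *)
Lemma derive_fst f (p v : R * R) : derivable (f : R^o -> R) p.1 v.1 ->
  is_derive p v (fun z => f z.1) ('D_(v.1) (f : R^o -> R) p.1).
Proof. by move=> df; split. Qed.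

Lemma derive_snd f (p v : R * R) : derivable (f : R^o -> R) p.2 v.2 ->
  is_derive p v (fun z => f z.2) ('D_(v.2) (f : R^o -> R) p.2).
Proof. by move=> df; split. Qed.

Lemma smooth_fst f : smooth (V := R^o) f -> smooth (fun z : R * R => f z.1).
Proof.
move=> Sf k; elim: k f {Sf}(Sf k) => [|k IH] f [cf Cf]; split => //;
  try by move=> z; apply: (@cvg_comp _ _ _ fst f); [exact: cvg_fst|exact: cf].
move=> v; have [df Cdf] := Cf v.1.
split; first by move=> x; have [] := derive_fst (df x.1).
suff -> : (fun x => 'D_v (fun z : R * R => f z.1) x) =
    (fun x => 'D_(v.1) (f : R^o -> R) x.1).
  exact: (IH (fun t => 'D_(v.1) (f : R^o -> R) t) Cdf).
by apply/funext => x; have [] := derive_fst (df x.1).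
Qed.

Lemma smooth_snd f : smooth (V := R^o) f -> smooth (fun z : R * R => f z.2).
Proof.
move=> Sf k; elim: k f {Sf}(Sf k) => [|k IH] f [cf Cf]; split => //;
  try by move=> z; apply: (@cvg_comp _ _ _ snd f); [exact: cvg_snd|exact: cf].
move=> v; have [df Cdf] := Cf v.2.
split; first by move=> x; have [] := derive_snd (df x.2).
suff -> : (fun x => 'D_v (fun z : R * R => f z.2) x) =
    (fun x => 'D_(v.2) (f : R^o -> R) x.2).
  exact: (IH (fun t => 'D_(v.2) (f : R^o -> R) t) Cdf).
by apply/funext => x; have [] := derive_snd (df x.2).
Qed.

Lemma is_derive_slice1 phi (x y : R) : derivable phi (x, y) (axis 0) ->
  is_derive (x : R^o) 1 (fun t : R^o => phi (t, y)) ('D_(axis 0) phi (x, y)).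
Proof.
move=> dphi.
have E : (fun h : R => h^-1 *: (((fun t : R^o => phi (t, y)) \o shift (x : R^o)) (h *: 1)
            - phi (x, y))) =
         (fun h => h^-1 *: ((phi \o shift (x, y)) (h *: axis 0) - phi (x, y))).
  apply/funext => h /=; congr (_ *: (phi _ - _)).
  rewrite /axis eqxx; congr (_, _).
  by change (y = h * 0 + y); rewrite mulr0 add0r.
by split; rewrite /derivable /derive E.
Qed.

Lemma is_derive_slice2 phi (x y : R) : derivable phi (x, y) (axis 1) ->
  is_derive (y : R^o) 1 (fun t : R^o => phi (x, t)) ('D_(axis 1) phi (x, y)).
Proof.
move=> dphi.
have E : (fun h : R => h^-1 *: (((fun t : R^o => phi (x, t)) \o shift (y : R^o)) (h *: 1)
            - phi (x, y))) =
         (fun h => h^-1 *: ((phi \o shift (x, y)) (h *: axis 1) - phi (x, y))).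
  apply/funext => h /=; congr (_ *: (phi _ - _)).
  rewrite /axis; congr (_, _).
  by change (x = h * 0 + x); rewrite mulr0 add0r.
by split; rewrite /derivable /derive E.
Qed.

End SmoothPlane.

(** * Flat functions, bumps, plateaus and cutoffs *)

Section Bump.
Context {R : realType}.

Lemma is_derive_scale (f : R^o -> R) (x v : R) (df : R) :
  is_derive (x : R^o) (1 : R^o) f df -> is_derive (x : R^o) (v : R^o) f (v * df).
Proof.
move=> [d1 e1]; have /derivable1_diffP df1 := d1.
have dv : derivable f x v by exact: diff_derivable.
split => //; rewrite deriveE// -[X in 'd f x X](mulr1 v).
have -> : 'd f x (v * 1) = v *: 'd f x 1 by exact: linearZ.
by rewrite -deriveE// e1.
Qed.

(** [Ck] quantifies over all directions, but on the line the derivative in direction [v] is [v]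
    times the one in direction 1. *)
Lemma Ck_line k (f g : R -> R) :
  (forall x, is_derive (x : R^o) (1 : R^o) (f : R^o -> R) (g x)) ->
  Ck (V := R^o) k g -> Ck (V := R^o) k.+1 f.
Proof.
move=> fg Cg; split.
  move=> x; apply: differentiable_continuous; apply/derivable1_diffP.
  by have [] := fg x.
move=> v; have fgv x := is_derive_scale v (fg x).
split; first by move=> x; have [] := fgv x.
suff -> : (fun x : R^o => 'D_v (f : R^o -> R) x) = (fun x => v * g x).
  by apply: CkM => //; exact: Ck_cst.
by apply/funext => x; have [] := fgv x.
Qed.

(* The functions [x^-m exp (-1/x)] are stable under differentiation up to
   linear combinations, which gives smoothness at the origin. *)
Definition flat (m : nat) (x : R) : R :=
  if 0 < x then x ^- m * expR (- x^-1) else 0.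

Lemma flat_ge0 m x : 0 <= flat m x.
Proof.
rewrite /flat; case: ifPn => // x0.
by rewrite mulr_ge0 ?expR_ge0// invr_ge0 exprn_ge0// ltW.
Qed.

Lemma flat0_gt0 x : 0 < x -> 0 < flat 0 x.
Proof. by move=> x0; rewrite /flat x0 expr0 invr1 mul1r expR_gt0. Qed.

Lemma flat_le0 m x : x <= 0 -> flat m x = 0.
Proof. by move=> x0; rewrite /flat ltNge x0. Qed.

(** The bound [1 + t <= expR t] at [t = x^-1 / m.+1], raised to the power [m.+1]. It serves at the
    origin, where the difference quotient of [flat m] is [flat m.+1]. *)
Lemma flat_le m x : 0 < x -> flat m x <= m.+1%:R ^+ m.+1 * x.
Proof.
move=> x0; rewrite /flat x0 expRN -ler_pdivrMr//.
have -> : x ^- m / expR x^-1 / x = x^-1 ^+ m.+1 / expR x^-1.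
  by rewrite exprS exprVn mulrAC [x^-1 * _]mulrC.
rewrite ler_pdivrMr ?expR_gt0//.
have -> : expR x^-1 = expR (x^-1 / m.+1%:R) ^+ m.+1.
  by rewrite -expRM_natr divfK.
rewrite -exprMn ler_pXn2r ?nnegrE ?invr_ge0 ?mulr_ge0 ?expR_ge0 ?(ltW x0)//.
rewrite -ler_pdivrMl ?ltr0n// mulrC.
by apply: le_trans (expR_ge1Dx _); rewrite lerDr.
Qed.

Lemma is_derive_flat m (x : R) : is_derive (x : R^o) (1 : R^o)
  (flat m : R^o -> R) (- m%:R * flat m.+1 x + flat m.+2 x).
Proof.
have [x0|x0|->] := ltgtP x 0.
- rewrite !(flat_le0 _ (ltW x0)) mulr0 addr0.
  apply: (@near_eq_is_derive _ _ _ (cst 0)) => //.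
  near=> y; rewrite flat_le0//; near: y.
  exact: (lt_le_nbhsl x0).
- rewrite /flat x0.
  pose F := (fun y : R^o => y^-1 ^+ m * expR (- y^-1) : R^o).
  apply: (@near_eq_is_derive _ _ _ F).
    near=> y; have y0 : 0 < y by near: y; exact: (lt_nbhsr x0).
    by rewrite y0 /F exprVn.
  have xn0 : x != 0 by rewrite gt_eqF.
  have dV : is_derive (x : R^o) (1 : R^o) (fun y : R^o => y^-1 : R^o) (- x ^- 2).
    split; first by apply: derivableV.
    by rewrite deriveV// derive_id /GRing.scale /= mulr1.
  have dE : is_derive (x : R^o) (1 : R^o) (fun y : R^o => expR (- y^-1) : R^o)
      (x ^- 2 * expR (- x^-1)).
    have dN := is_deriveN dV.
    have := @is_derive1_comp R expR (fun y : R => - y^-1) x _ _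
      (is_derive_expR _) dN.
    by move=> h; apply: is_derive_eq h _; rewrite opprK mulrC.
  have dX := is_deriveX m dV.
  have -> : F = ((fun y : R^o => y^-1 : R^o) ^+ m) * (fun y : R^o => expR (- y^-1) : R^o).
    by apply/funext => y; rewrite /F exprfctE.
  apply: is_derive_eq (is_deriveM dX dE) _.
  rewrite exprfctE -![_ *: _]/(_ * _) -!exprVn.
  move: (expR _) => E; case: m {dX F} => [|m]; first by rewrite !expr0; ring.
  by rewrite /= !exprS; ring.
- have f0 : flat m 0 = 0 by rewrite flat_le0.
  have lim0 : (fun h : R => h^-1 *: ((flat m : R^o -> R^o) (h *: 1 + 0) - flat m 0))
      @ 0^' --> (0 : R).
    apply/cvgrPdist_le => e e0.
    have K0 : 0 < m.+2%:R ^+ m.+2 :> R by rewrite exprn_gt0.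
    near=> h.
    rewrite sub0r normrN f0 subr0 addr0 [h%:A]mulr1.
    have [h0|h0] := ltP 0 h; last by rewrite flat_le0// scaler0 normr0 ltW.
    have -> : h^-1 *: flat m h = flat m.+1 h.
      by rewrite /flat h0 -[LHS]/(_ * _) mulrA -!exprVn -exprS.
    rewrite ger0_norm ?flat_ge0//; apply: le_trans (flat_le _ h0) _.
    rewrite -ler_pdivlMl//; apply: le_trans (ler_norm _) _.
    near: h; apply: (dnbhs0_le (e := _)).
    by rewrite mulr_gt0 ?invr_gt0.
  split; first by apply/cvg_ex; exists 0.
  by rewrite !flat_le0// mulr0 addr0; exact: cvg_lim lim0.
Unshelve. all: by end_near. Qed.

Lemma smooth_flat m : smooth (V := R^o) (flat m).
Proof.
move=> k; elim: k m => [|k IH] m.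
  split => // x; apply: differentiable_continuous; apply/derivable1_diffP.
  by have [] := is_derive_flat m x.
apply: Ck_line (is_derive_flat m) _.
by apply: CkD => //; apply: CkM => //; exact: Ck_cst.
Qed.

Lemma smooth_affine (c e : R) (f : R -> R) : smooth (V := R^o) f ->
  smooth (V := R^o) (fun x => f (c * x + e)).
Proof.
move=> Sf k; elim: k f {Sf}(Sf k) => [|k IH] f Cf.
  split => //= x; apply: (@continuous_comp R R R (fun x => c * x + e) f).
    by apply: cvgD; [apply: cvgM; [exact: cvg_cst|exact: cvg_id]|exact: cvg_cst].
  exact: (Ck_continuous Cf).
have [_ /(_ 1)[df Cdf]] := Cf.
apply: (@Ck_line _ _ (fun x => c * 'D_1 (f : R^o -> R^o) (c * x + e))).
  move=> x.
  have dfx : is_derive ((c * x + e : R) : R^o) (1 : R^o) (f : R^o -> R^o)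
    ('D_1 (f : R^o -> R^o) (c * x + e)).
    by split.
  have dx : is_derive (x : R^o) (1 : R^o) (fun x : R^o => c * x + e : R^o) c.
    have d1 : is_derive (x : R^o) (1 : R^o) (fun x : R^o => c *: x : R^o) (c *: 1).
      exact: is_deriveZ.
    have := is_deriveD d1 (is_derive_cst (e : R^o) (x : R^o) (1 : R^o)).
    by move=> h; apply: is_derive_eq h _; rewrite addr0 -[LHS]/(_ * _) mulr1.
  have := @is_derive1_comp R (f : R -> R) (fun x : R => c * x + e) x _ _ dfx dx.
  by move=> h; apply: is_derive_eq h _; rewrite mulrC.
apply: CkM; first exact: Ck_cst.
exact: (IH (fun t => 'D_1 (f : R^o -> R^o) t)).
Qed.

Lemma flat0_le x y : x <= y -> flat 0 x <= flat 0 y.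
Proof.
move=> xy; have [x0|x0] := ltP 0 x; last by rewrite flat_le0// flat_ge0.
have y0 := lt_le_trans x0 xy.
by rewrite /flat x0 y0 !expr0 invr1 !mul1r ler_expR lerN2 lef_pV2.
Qed.

Definition hat (a b x : R) : R := flat 0 (x - a) * flat 0 (b - x).

Lemma smooth_hat a b : smooth (V := R^o) (hat a b).
Proof.
apply: smoothM.
  have := smooth_affine 1 (- a) (smooth_flat 0).
  suff -> : (fun x => flat 0 (1 * x + - a)) = (fun x => flat 0 (x - a)) by [].
  by apply/funext => x; rewrite mul1r.
have := smooth_affine (-1) b (smooth_flat 0).
suff -> : (fun x => flat 0 ((-1) * x + b)) = (fun x => flat 0 (b - x)) by [].
by apply/funext => x; rewrite mulN1r addrC.
Qed.

Lemma hat_ge0 a b x : 0 <= hat a b x.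
Proof. by rewrite mulr_ge0 ?flat_ge0. Qed.

Lemma hat_out a b x : x \notin `]a, b[ -> hat a b x = 0.
Proof.
rewrite in_itv /= negb_and -!leNgt /hat => /orP[xa|bx].
  by rewrite flat_le0 ?subr_le0// mul0r.
by rewrite (@flat_le0 _ (b - x)) ?subr_le0// mulr0.
Qed.

(** The map [g |-> g / (1 + g)] sends nonnegative numbers into [0, 1[ and tends to 1 at infinity.
    The factor [n] drives the bump to 1 inside ]a, b[, while pulling both ends in by [1 / n.+1]
    keeps the support compact in the open interval. *)
Definition plateau (a b : R) (n : nat) (x : R) : R :=
  let g := n%:R * hat (a + n.+1%:R^-1) (b - n.+1%:R^-1) x in g * (1 + g)^-1.

Let ge0_n (n : nat) a b x : 0 <= n%:R * hat a b x :> R.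
Proof. by rewrite mulr_ge0 ?hat_ge0. Qed.

Lemma plateau_bounds a b n x : 0 <= plateau a b n x <= 1.
Proof.
rewrite /plateau; move: (ge0_n n (a + n.+1%:R^-1) (b - n.+1%:R^-1) x).
move: (_ * hat _ _ _) => g g0.
rewrite mulr_ge0 ?invr_ge0 ?addr_ge0//= ler_pdivrMr ?mul1r ?lerDr//.
by rewrite ltr_wpDr.
Qed.

Lemma plateau_out a b n x : x \notin `]a, b[ -> plateau a b n x = 0.
Proof.
move=> x_out; rewrite /plateau hat_out ?mulr0 ?mul0r//.
have n0 : 0 < n.+1%:R^-1 :> R by rewrite invr_gt0.
move: x_out; apply: contra; rewrite !in_itv /= => /andP[h1 h2].
by apply/andP; move: (n.+1%:R^-1) n0 h1 h2 => t; split; lra.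
Qed.

Lemma plateau_test a b n : test_function (V := R^o) `]a, b[%classic (plateau a b n).
Proof.
have n0 : 0 < n.+1%:R^-1 :> R by rewrite invr_gt0.
split.
  have Sg := smoothZ n%:R (smooth_hat (a + n.+1%:R^-1) (b - n.+1%:R^-1)).
  apply: smoothM => //; apply: smoothV.
    by move=> x; rewrite gt_eqF// ltr_wpDr.
  by apply: smoothD => //; exact: smooth_cst.
exists `[a + n.+1%:R^-1, b - n.+1%:R^-1]%classic; split.
- exact: segment_compact.
- move=> x /=; rewrite !in_itv /= => /andP[h1 h2].
  by apply/andP; move: (n.+1%:R^-1) n0 h1 h2 => t; split; lra.
- move=> x /= /negP; rewrite in_itv /= => h.
  rewrite /plateau hat_out ?mulr0 ?mul0r//; apply: contra h.
  by rewrite in_itv /= => /andP[/ltW -> /ltW ->].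
Qed.

Lemma plateau_cvg a b x : plateau a b n x @[n --> \oo] --> (\1_(`]a, b[%classic) x : R).
Proof.
rewrite indicE; have [xab|xab] := boolP (x \in `]a, b[); last first.
  rewrite memNset ?(negbTE xab)//; last by apply/negP.
  by under eq_fun do rewrite plateau_out//; exact: cvg_cst.
rewrite mem_set//.
move: xab; rewrite in_itv /= => /andP[ax xb].
(* A lower bound for the bumps at [x] once [1 / n.+1] is less than half the distance from [x] to
   each end. *)
pose G := flat 0 ((x - a) / 2) * flat 0 ((b - x) / 2).
have G0 : 0 < G by rewrite mulr_gt0// flat0_gt0 ?divr_gt0 ?subr_gt0.
have gG : \forall n \near \oo, G <= hat (a + n.+1%:R^-1) (b - n.+1%:R^-1) x.
  have d0 : 0 < Num.min ((x - a) / 2) ((b - x) / 2).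
    by rewrite lt_min !divr_gt0 ?subr_gt0.
  near=> n.
  have : n.+1%:R^-1 < Num.min ((x - a) / 2) ((b - x) / 2).
    by near: n; exact: near_infty_natSinv_lt (PosNum d0).
  rewrite lt_min => /andP[h1 h2].
  by rewrite /G /hat ler_pM ?flat_ge0// flat0_le//;
    move: (n.+1%:R^-1) h1 h2 => t; lra.
apply/cvgrPdist_le => e e0; near=> n.
have hG : G <= hat (a + n.+1%:R^-1) (b - n.+1%:R^-1) x by near: n.
(* The error is [1 / (1 + g)], and [g >= n * G >= 1 / e] for such [n]. *)
have ge : (e * G)^-1 <= n%:R by near: n; exact: nbhs_infty_ger.
have gn0 := ge0_n n (a + n.+1%:R^-1) (b - n.+1%:R^-1) x.
rewrite /plateau; set g := n%:R * _ in gn0 *.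
have g1 : 0 < 1 + g by rewrite ltr_wpDr.
have -> : 1 - g * (1 + g)^-1 = (1 + g)^-1 by field; rewrite gt_eqF.
rewrite ger0_norm ?invr_ge0 ?(ltW g1)// -[leRHS]invrK lef_pV2 ?posrE ?invr_gt0//.
apply: (@le_trans _ _ g); last by rewrite lerDr.
apply: (@le_trans _ _ (n%:R * G)); last by rewrite ler_wpM2l.
by rewrite -ler_pdivrMr// -invfM.
Unshelve. all: by end_near. Qed.

(** [hat (- r) r] equals [flat 0 r ^+ 2] at the origin, the height of the interface; the factor
    normalises this value to 1. *)
Definition cutoff (r x : R) : R := (flat 0 r ^+ 2)^-1 * hat (- r) r x.

Lemma smooth_cutoff r : smooth (V := R^o) (cutoff r).
Proof. exact: smoothZ (smooth_hat _ _). Qed.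

Lemma cutoff0 r : 0 < r -> cutoff r 0 = 1.
Proof.
move=> r0; rewrite /cutoff /hat opprK add0r subr0 -expr2 mulVf//.
by rewrite sqrf_eq0 gt_eqF ?flat0_gt0.
Qed.

Lemma cutoff_out r x : r <= `|x| -> cutoff r x = 0.
Proof.
move=> rx; rewrite /cutoff hat_out ?mulr0//.
by rewrite in_itv /= -ltr_norml -leNgt.
Qed.

End Bump.

(** * Integration on intervals and rectangles *)

Section FunctionVanishing.
Context {d d' : measure_display} {T : measurableType d} {U : measurableType d'}.
Context {R : realType} (mu : {measure set T -> \bar R}).

(** The sets over whose preimage the integral vanishes form a Dynkin system, closed under
    complements because the integral over [C] is zero. With [p] a coordinate projection and [C] a
    strip, one factor of a product is upgraded from intervals to Borel sets. *)
Lemma integral_eq0_pi_system (f : T -> R) (p : T -> U) (C : set T)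
    (G : set (set U)) :
  mu.-integrable setT (EFin \o f) -> measurable_fun setT p -> measurable C ->
  (@measurable _ U) = <<s G >> -> setI_closed G ->
  (\int[mu]_(x in C) (f x)%:E = 0)%E ->
  (forall A, G A -> (\int[mu]_(x in p @^-1` A `&` C) (f x)%:E = 0)%E) ->
  forall A, measurable A -> (\int[mu]_(x in p @^-1` A `&` C) (f x)%:E = 0)%E.
Proof.
move=> If mp mC UG GI C0 G0.
have mpA A : measurable A -> measurable (p @^-1` A `&` C).
  by move=> mA; apply: measurableI => //; rewrite -[X in measurable X]setTI; exact: mp.
have IE E : measurable E -> mu.-integrable E (EFin \o f).
  by move=> mE; exact: integrableS If.
suff sG A : <<s G >> A -> (\int[mu]_(x in p @^-1` A `&` C) (f x)%:E = 0)%E.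
  by move=> A mA; apply: sG; rewrite -UG.
move: A; apply: (dynkin_induction
  (P := fun A => (\int[mu]_(x in p @^-1` A `&` C) (f x)%:E = 0)%E) UG GI).
- by rewrite preimage_setT setTI.
- exact: G0.
- move=> A mA A0; rewrite preimage_setC.
  have := @integral_setU_EFin _ _ _ mu _ _ f (mpA _ mA) (mpA _ (measurableC mA)).
  rewrite -setIUl -preimage_setU setUCr preimage_setT setTI C0 A0 add0e => -> //.
    by apply/measurable_EFinP; have /integrableP[] := IE _ mC.
  by apply/disj_set2P/seteqP; split => x // [[h _] [h' _]].
- move=> F mF tF F0; rewrite preimage_bigcup setI_bigcupl.
  rewrite integral_bigcup//.
  + by rewrite eseries0// => i _ _; exact: F0.
  + move=> i j _ _ [x [[xi _] [xj _]]]; apply: tF => //.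
    by exists (p x).
  + by move=> k; exact: mpA.
  + by apply: IE; apply: bigcup_measurable => k _; exact: mpA.
Qed.

End FunctionVanishing.

(** * Measurability and boundedness of continuous functions on the plane *)

Section Plane.
Context {R : realType}.
Local Notation TR := (measurableTypeR R).

(** The measurable structure is the product one, so an open set is exhibited as a countable union of
    squares with rational centres and half-sides [1 / n.+1]. *)
Lemma open_measurable_plane (A : set (R * R)) :
  open A -> measurable (A : set (TR * TR)).
Proof.
move=> oA.
pose B (q : rat * rat * nat) : set (R * R) :=
  `]ratr q.1.1 - q.2.+1%:R^-1, ratr q.1.1 + q.2.+1%:R^-1[%classic `*`
  `]ratr q.1.2 - q.2.+1%:R^-1, ratr q.1.2 + q.2.+1%:R^-1[%classic.
have -> : A = \bigcup_(q : rat * rat * nat) (if `[< B q `<=` A >] then B q else set0).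
  apply/seteqP; split => [[x y] Axy|z [q _]]; last by case: asboolP => [BA /BA|].
  have /nbhs_ballP[e /= e0 eA] : nbhs (x, y) A by exact: open_nbhs_nbhs.
  have e20 : 0 < e / 2 by rewrite divr_gt0.
  (* The centre will be within [1 / n.+1] of the point in each coordinate, so the square stays
     within twice that, hence within [e]. *)
  have [n ne] : exists n, n.+1%:R^-1 < e / 2.
    by have [n _ /(_ n (leqnn _))] := near_infty_natSinv_lt (PosNum e20); exists n.
  have n0 : 0 < n.+1%:R^-1 :> R by rewrite invr_gt0.
  have rat_near (t : R) : exists q : rat, t - n.+1%:R^-1 < ratr q < t + n.+1%:R^-1.
    have [q] : exists q, ratr q \in `]t - n.+1%:R^-1, t + n.+1%:R^-1[.
      by apply: rat_in_itvoo; rewrite ltrD2l gtrN.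
    by rewrite in_itv /=; exists q.
  have [p xp] := rat_near x; have [q yq] := rat_near y.
  have [t tE] : exists t : R, t = n.+1%:R^-1 by exists n.+1%:R^-1.
  move: n0 ne xp yq {rat_near}; rewrite -tE => t0 te.
  move=> /andP[xp1 xp2] /andP[yq1 yq2].
  exists (p, q, n) => //; case: asboolP => [_|[]].
    by split; rewrite /= in_itv /= -tE; apply/andP; split; lra.
  rewrite /B /= -tE => -[u v] [] /=; rewrite !in_itv /= => /andP[u1 u2] /andP[v1 v2].
  by apply: eA; split; rewrite /ball /= ltr_norml; apply/andP; split; lra.
apply: countable_bigcupT_measurable; first exact: countableP.
move=> q; case: ifP => _ //.
by apply: measurableX; exact: measurable_itv.
Qed.

Lemma continuous_measurable_plane (f : R * R -> R) :
  continuous f -> measurable_fun setT (f : TR * TR -> TR).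
Proof.
move=> cf; apply: (measurability _ (RGenOpens.measurableE R)).
move=> _ [_ [a [b ->] <-]]; rewrite setTI; apply: open_measurable_plane.
by apply: open_comp => [x _|]; [exact: cf|exact: interval_open].
Qed.

Lemma continuous_bounded_itv (f : R -> R) (a b : R) : continuous f ->
  exists M, forall x, a <= x <= b -> `|f x| <= M.
Proof.
move=> cf.
have /compact_bounded[M [Mr MP]] : compact (f @` `[a, b]%classic).
  apply: continuous_compact; last exact: segment_compact.
  exact: continuous_subspaceT.
exists (M + 1) => x axb; apply: (MP (M + 1)); first by rewrite ltrDl.
by exists x => //=; rewrite in_itv.
Qed.

Lemma continuous_bounded_rect (f : R * R -> R) (a b c e : R) : continuous f ->
  exists M, forall x y, a <= x <= b -> c <= y <= e -> `|f (x, y)| <= M.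
Proof.
move=> cf.
have /compact_bounded[M [Mr MP]] :
    compact (f @` (`[a, b]%classic `*` `[c, e]%classic)).
  apply: continuous_compact; last by apply: compact_setX; exact: segment_compact.
  exact: continuous_subspaceT.
exists (M + 1) => x y axb cye; apply: (MP (M + 1)); first by rewrite ltrDl.
by exists (x, y) => //; split; rewrite /= in_itv.
Qed.

End Plane.

(** * Square integrability and iterated integrals on rectangles *)

Section RectangleIntegrals.
Context {R : realType}.
Local Notation TR := (measurableTypeR R).

Lemma bounded_L2 d (T : measurableType d) (mu : {measure set T -> \bar R})
    (D : set T) (f : T -> R) (M : R) :
  measurable D -> (mu D < +oo)%E -> measurable_fun D f ->
  (forall x, D x -> `|f x| <= M) -> L2 mu D f.
Proof.
move=> mD Dfin mf fM; split => //.
apply: measurable_bounded_integrable => //; first exact: measurable_funX.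
exists (M ^+ 2); split; first exact: num_real.
move=> t Mt x Dx /=; rewrite (le_trans _ (ltW Mt))// normrX.
by rewrite ler_pXn2r ?nnegrE ?fM// (le_trans _ (fM _ Dx)).
Qed.

Lemma L2_integrable d (T : measurableType d) (mu : {measure set T -> \bar R})
    (D : set T) (f : T -> R) :
  measurable D -> (mu D < +oo)%E -> L2 mu D f -> mu.-integrable D (EFin \o f).
Proof.
move=> mD Dfin Lf.
have L1 : L2 mu D (fun=> 1).
  by apply: (@bounded_L2 _ _ _ _ _ 1) => // x _; rewrite normr1.
by apply: eq_integrable (L2_mul mD Lf L1) => // x _ /=; rewrite mulr1.
Qed.

Lemma leb1_itv_lty (a b : R) : (leb1 `]a, b[%classic < +oo :> \bar R)%E.
Proof.
have -> : (leb1 `]a, b[%classic : \bar R) = lebesgue_measure (`]a, b[%classic : set R).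
  by [].
by rewrite lebesgue_measure_itv /=; case: ifP => _; rewrite -?EFinB ltry.
Qed.

Lemma measurable_rect (a b c e : R) :
  measurable (`]a, b[%classic `*` `]c, e[%classic : set (TR * TR)).
Proof. by apply: measurableX; exact: measurable_itv. Qed.

Lemma measurable_itvoo (a b : R) : measurable (`]a, b[%classic : set TR).
Proof. exact: measurable_itv. Qed.

Lemma leb2_rect_lty (a b c e : R) :
  (leb2 (`]a, b[%classic `*` `]c, e[%classic) < +oo :> \bar R)%E.
Proof.
have -> : (leb2 (`]a, b[%classic `*` `]c, e[%classic) : \bar R) =
    (leb1 `]a, b[%classic * leb1 `]c, e[%classic)%E.
  by apply: (@product_measure1E _ _ TR TR R lebesgue_measure lebesgue_measure);
    exact: measurable_itv.
by rewrite lte_mul_pinfty// ?ge0_fin_numE//; exact: leb1_itv_lty.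
Qed.

Lemma continuous_L2_itv (f : R -> R) (a b : R) : continuous f ->
  L2 leb1 `]a, b[%classic f.
Proof.
move=> cf; have [M fM] := continuous_bounded_itv a b cf.
apply: (@bounded_L2 _ _ _ _ _ M); first exact: measurable_itvoo.
- exact: leb1_itv_lty.
- by apply: measurable_funTS; exact: continuous_measurable_fun.
- by move=> x /=; rewrite in_itv /= => /andP[/ltW ? /ltW ?]; apply: fM; apply/andP.
Qed.

Lemma continuous_L2_rect (f : R * R -> R) (a b c e : R) : continuous f ->
  L2 leb2 (`]a, b[%classic `*` `]c, e[%classic) f.
Proof.
move=> cf; have [M fM] := continuous_bounded_rect a b c e cf.
apply: (@bounded_L2 _ _ _ _ _ M); first exact: measurable_rect.
- exact: leb2_rect_lty.
- by apply: measurable_funTS; exact: continuous_measurable_plane.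
- move=> [x y] [] /=; rewrite !in_itv /= => /andP[/ltW ? /ltW ?] /andP[/ltW ? /ltW ?].
  by apply: fM; apply/andP.
Qed.

Lemma continuous_slice1 (f : R * R -> R) y : continuous f ->
  continuous (fun x => f (x, y)).
Proof.
move=> cf x; apply: (@continuous_comp R (R * R)%type R (fun x => (x, y)) f); last exact: cf.
exact: (@cvg_pair R R R (nbhs x) (nbhs x) (nbhs y) _ _ _ id (fun=> y) cvg_id (cvg_cst y)).
Qed.

Lemma continuous_slice2 (f : R * R -> R) x : continuous f ->
  continuous (fun y => f (x, y)).
Proof.
move=> cf y; apply: (@continuous_comp R (R * R)%type R (fun y => (x, y)) f); last exact: cf.
exact: (@cvg_pair R R R (nbhs y) (nbhs x) (nbhs y) _ _ _ (fun=> x) id (cvg_cst x) cvg_id).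
Qed.

Lemma Rintegral_EFin d (T : measurableType d) (mu : {measure set T -> \bar R})
    (D : set T) (f : T -> R) : measurable D -> mu.-integrable D (EFin \o f) ->
  (Rintegral mu D f)%:E = (\int[mu]_(x in D) (f x)%:E)%E.
Proof. by move=> mD If; rewrite fineK//; exact: integrable_fin_num. Qed.

Lemma Rintegral_rect (f : R * R -> R) (a b c e : R) : continuous f ->
  Rintegral leb2 (`]a, b[%classic `*` `]c, e[%classic) f =
  Rintegral leb1 `]a, b[%classic (fun x =>
    Rintegral leb1 `]c, e[%classic (fun y => f (x, y))).
Proof.
move=> cf; set A := `]a, b[%classic; set B := `]c, e[%classic.
have If : leb2.-integrable (A `*` B) (EFin \o f).
  apply: L2_integrable; [exact: measurable_rect|exact: leb2_rect_lty|].
  exact: continuous_L2_rect.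
have Ify x : leb1.-integrable B (fun y => (f (x, y))%:E).
  apply: L2_integrable; [exact: measurable_itvoo|exact: leb1_itv_lty|].
  by apply: continuous_L2_itv; exact: continuous_slice2.
rewrite [in RHS]/Rintegral [in LHS]/Rintegral; congr fine.
rewrite integral_mkcond -[LHS]integral12_prod_meas1; last first.
  have If' := (@integrable_mkcond _ _ _ leb2 (A `*` B) (EFin \o f) (measurable_rect a b c e)).1 If.
exact: If'.
rewrite [RHS]integral_mkcond; apply: eq_integral => x _.
rewrite /fubini_F !patchE; case: ifPn => xA.
  rewrite -[X in _ = X]/(Rintegral leb1 B (fun y => f (x, y)))%:E.
  rewrite (Rintegral_EFin (measurable_itvoo c e) (Ify x)).
  rewrite [RHS]integral_mkcond; apply: eq_integral => y _.
  by rewrite !patchE in_setX xA.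
rewrite integral0_eq// => y _.
by rewrite patchE in_setX (negbTE xA).
Qed.

Lemma Rintegral_rect_swap (f : R * R -> R) (a b c e : R) : continuous f ->
  Rintegral leb2 (`]a, b[%classic `*` `]c, e[%classic) f =
  Rintegral leb1 `]c, e[%classic (fun y =>
    Rintegral leb1 `]a, b[%classic (fun x => f (x, y))).
Proof.
move=> cf; set A := `]a, b[%classic; set B := `]c, e[%classic.
have If : leb2.-integrable (A `*` B) (EFin \o f).
  apply: L2_integrable; [exact: measurable_rect|exact: leb2_rect_lty|].
  exact: continuous_L2_rect.
have Ifx y : leb1.-integrable A (fun x => (f (x, y))%:E).
  apply: L2_integrable; [exact: measurable_itvoo|exact: leb1_itv_lty|].
  by apply: continuous_L2_itv; exact: continuous_slice1.
rewrite [in RHS]/Rintegral [in LHS]/Rintegral; congr fine.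
rewrite integral_mkcond -[LHS]integral21_prod_meas1; last first.
  have If' := (@integrable_mkcond _ _ _ leb2 (A `*` B) (EFin \o f) (measurable_rect a b c e)).1 If.
exact: If'.
rewrite [RHS]integral_mkcond; apply: eq_integral => y _.
rewrite /fubini_G !patchE; case: ifPn => yB.
  rewrite -[X in _ = X]/(Rintegral leb1 A (fun x => f (x, y)))%:E.
  rewrite (Rintegral_EFin (measurable_itvoo a b) (Ifx y)).
  rewrite [RHS]integral_mkcond; apply: eq_integral => x _.
  by rewrite !patchE in_setX yB andbT.
rewrite integral0_eq// => x _.
by rewrite patchE in_setX (negbTE yB) andbF.
Qed.

(** Tonelli's theorem evaluates the integral of the square before it is known to be finite;
    integrability is then read off the value. *)
Lemma tensor_L2_rect (f g : R -> R) (a b c e : R) :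
  L2 leb1 `]a, b[%classic f -> L2 leb1 `]c, e[%classic g ->
  L2 leb2 (`]a, b[%classic `*` `]c, e[%classic) (fun z => f z.1 * g z.2) /\
  sqnormL2 leb2 (`]a, b[%classic `*` `]c, e[%classic) (fun z => f z.1 * g z.2) =
  sqnormL2 leb1 `]a, b[%classic f * sqnormL2 leb1 `]c, e[%classic g.
Proof.
set A := `]a, b[%classic; set B := `]c, e[%classic => Lf Lg.
have [mf If] := Lf; have [mg Ig] := Lg.
have mA : measurable (A : set TR) by exact: measurable_itvoo.
have mB : measurable (B : set TR) by exact: measurable_itvoo.
have mAB : measurable (A `*` B : set (TR * TR)) by exact: measurable_rect.
have mfg : measurable_fun (A `*` B : set (TR * TR)) (fun z => f z.1 * g z.2).
  apply: measurable_funM.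
    apply: (measurable_comp mA) => //; first by move=> _ [z [zA _] <-].
    exact: measurable_funTS.
  apply: (measurable_comp mB) => //; first by move=> _ [z [_ zB] <-].
  exact: measurable_funTS.
have E : (\int[leb2]_(z in A `*` B) ((f z.1 * g z.2) ^+ 2)%:E =
    (sqnormL2 leb1 A f * sqnormL2 leb1 B g)%:E)%E.
  pose h : TR * TR -> \bar R :=
    (fun z : TR * TR => ((f z.1 * g z.2) ^+ 2)%:E) \_ (A `*` B).
  have mh : measurable_fun setT h.
    apply: (measurable_restrictT _ mAB).1.
    by apply/measurable_EFinP; exact: measurable_funX.
  have h0 z : (0 <= h z)%E.
    by rewrite /h patchE; case: ifP => // _; rewrite lee_fin sqr_ge0.
  rewrite integral_mkcond -/h.
  rewrite (@fubini_tonelli1 _ _ TR TR R lebesgue_measure lebesgue_measure h)//.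
  transitivity (\int[leb1]_(x in A) ((sqnormL2 leb1 B g)%:E * (f x ^+ 2)%:E))%E.
    rewrite [RHS]integral_mkcond; apply: eq_integral => x _.
    rewrite /fubini_F !patchE; case: ifPn => xA; last first.
      rewrite integral0_eq// => y _.
      by rewrite /h patchE in_setX (negbTE xA).
    rewrite muleC -[X in (_ * X)%E]/(Rintegral leb1 B (fun x => g x ^+ 2))%:E.
    rewrite Rintegral_EFin// -integralZl//.
    rewrite [RHS]integral_mkcond; apply: eq_integral => y _.
    by rewrite /h !patchE in_setX xA /=; case: ifP => // _; rewrite -EFinM exprMn.
  rewrite integralZl// -Rintegral_EFin// -EFinM mulrC //.
split.
  split => //; apply/integrableP; split; first exact/measurable_EFinP/measurable_funX.
  under eq_integral do rewrite gee0_abs ?lee_fin ?sqr_ge0//.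
  by rewrite E ltry.
by rewrite -[LHS]/(fine _) E.
Qed.

End RectangleIntegrals.

(** * Test functions separate square-integrable functions *)

Section TestDense.
Context {R : realType}.
Local Notation TR := (measurableTypeR R).

(** Dominated convergence: the products [f * phi n] are dominated by [|f|], which is integrable
    since [D] has finite measure, and tend to [f] times the indicator of [E]. *)
Lemma integral_eq0_of_tests d (T : measurableType d)
    (mu : {measure set T -> \bar R}) (D E : set T) (f : T -> R)
    (phi : nat -> T -> R) :
  measurable D -> (mu D < +oo)%E -> measurable E -> L2 mu D f ->
  (forall n, measurable_fun D (phi n)) ->
  (forall n x, 0 <= phi n x <= 1) ->
  (forall x, phi n x @[n --> \oo] --> (\1_E x : R)) ->
  (forall n, dotL2 mu D f (phi n) = 0) ->
  (\int[mu]_(x in E) ((f \_ D) x)%:E = 0)%E.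
Proof.
move=> mD Dfin mE Lf mphi phi01 phiE f0.
have If := L2_integrable mD Dfin Lf.
have [mf _] := Lf.
have Lphi n : L2 mu D (phi n).
  apply: (@bounded_L2 _ _ _ _ _ _ 1) => // x _.
  by have /andP[p0 p1] := phi01 n x; rewrite ger0_norm.
have mfE : measurable_fun D (fun x => f x * \1_E x).
  by apply: measurable_funM => //; exact: measurable_indic.
have h1 : {ae mu, forall x, D x ->
    (f x * phi n x)%:E @[n --> \oo] --> (f x * \1_E x)%:E}.
  apply: aeW => x _; apply/fine_cvgP; split; first exact: nearW.
  by apply: cvgM; [exact: cvg_cst|exact: phiE].
have h2 : {ae mu, forall x n, D x -> `|(f x * phi n x)%:E| <= `|f x|%:E}%E.
  apply: aeW => x n _; rewrite lee_fin normrM ler_piMr//.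
  by have /andP[p0 p1] := phi01 n x; rewrite ger0_norm.
have [_ _] := @dominated_convergence _ _ _ mu D mD
  (fun n x => (f x * phi n x)%:E) (fun x => (f x * \1_E x)%:E)
  (fun x => `|f x|%:E)
  (fun n => (measurable_EFinP _ _).2 (measurable_funM mf (mphi n)))
  ((measurable_EFinP _ _).2 mfE) h1 (integrable_norm If) h2.
have -> : (fun n => \int[mu]_(x in D) (f x * phi n x)%:E)%E = (fun=> 0%E).
  apply/funext => n; rewrite -Rintegral_EFin//; last exact: L2_mul.
  by rewrite -[Rintegral _ _ _]/(dotL2 mu D f (phi n)) f0.
move=> /(cvg_unique _ (cvg_cst _)) fE0.
rewrite integral_mkcond.
transitivity (\int[mu]_(x in D) (f x * \1_E x)%:E)%E; last by rewrite -fE0.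
rewrite [RHS]integral_mkcond; apply: eq_integral => x _.
rewrite !patchE indicE.
by case: (x \in E); case: (x \in D); rewrite ?mulr1 ?mulr0.
Qed.

Lemma itvoo_setI (a b c e : R) :
  `]a, b[%classic `&` `]c, e[%classic = `]Num.max a c, Num.min b e[%classic.
Proof.
apply/seteqP; split => x /=; rewrite !in_itv /= gt_max lt_min.
  by move=> [/andP[-> ->] /andP[-> ->]].
by move=> /andP[/andP[-> ->] /andP[-> ->]].
Qed.

Lemma test_functionW (V : normedModType R) (A B : set V) f :
  A `<=` B -> test_function A f -> test_function B f.
Proof.
by move=> AB [sf [K [cK KA Kf]]]; split => //; exists K; split => // x /KA/AB.
Qed.

Lemma test_tensor (A B : set R) (f g : R -> R) :
  test_function (V := R^o) A f -> test_function (V := R^o) B g ->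
  test_function (A `*` B) (fun z => f z.1 * g z.2).
Proof.
move=> [sf [K [cK KA Kf]]] [sg [K' [cK' KB Kg]]]; split.
  by apply: smoothM; [exact: smooth_fst|exact: smooth_snd].
exists (K `*` K'); split.
- exact: compact_setX.
- by move=> z [/KA ? /KB].
- move=> z; rewrite /setX /= => /not_andP[/Kf ->|/Kg ->]; first by rewrite mul0r.
  by rewrite mulr0.
Qed.

Lemma setI_closed_itvoo : setI_closed (@RGenOpens.G R).
Proof.
move=> _ _ [a [b ->]] [c [e ->]]; rewrite itvoo_setI.
by exists (Num.max a c), (Num.min b e).
Qed.

Lemma integral_eq0_ae d (T : measurableType d) (mu : {measure set T -> \bar R})
    (D : set T) (f : T -> R) :
  measurable D -> mu.-integrable D (EFin \o f) ->
  (forall A, measurable A -> (\int[mu]_(x in A) ((f \_ D) x)%:E = 0)%E) ->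
  ae_eq mu D f (fun=> 0).
Proof.
move=> mD If f0.
have : ae_eq mu D (EFin \o f) (cst 0%E).
  apply: integral_ae_eq => // E ED mE; rewrite integral0 -(f0 _ mE).
  apply: eq_integral => x xE /=; rewrite patchE mem_set//.
  by apply: ED; exact: set_mem xE.
by apply: filterS => x /= h /h[].
Qed.

Lemma integrable_patch d (T : measurableType d) (mu : {measure set T -> \bar R})
    (D : set T) (f : T -> R) : measurable D -> mu.-integrable D (EFin \o f) ->
  mu.-integrable setT (EFin \o (f \_ D)).
Proof.
move=> mD /(integrable_mkcond (EFin \o f) mD).1.
by apply: eq_integrable => // x _; rewrite /= !patchE; case: ifP.
Qed.

(** Plateaus are test functions tending to the indicator of an open subinterval, so [f], extended by
    zero, integrates to zero over open intervals; these generate the Borel sets and form a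
    pi-system. *)
Lemma itv_test_dense (a b : R) (f : R -> R) : L2 leb1 `]a, b[%classic f ->
  (forall phi, test_function (V := R^o) `]a, b[%classic phi ->
    dotL2 leb1 `]a, b[%classic f phi = 0) ->
  ae_eq leb1 `]a, b[%classic f (fun=> 0).
Proof.
move=> Lf f0; set D := `]a, b[%classic in Lf f0 *.
have mD : measurable (D : set TR) by exact: measurable_itvoo.
have If := L2_integrable mD (leb1_itv_lty a b) Lf.
have IfD := integrable_patch mD If.
have f_oo c e : (\int[leb1]_(x in `]c, e[%classic) ((f \_ D) x)%:E = 0)%E.
  transitivity (\int[leb1]_(x in `]c, e[%classic `&` D) ((f \_ D) x)%:E)%E.
    rewrite [RHS]integral_mkcondr; apply: eq_integral => x _.
    by rewrite !patchE; case: ifP.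
  rewrite itvoo_setI; set c' := Num.max c a; set e' := Num.min e b.
  apply: (@integral_eq0_of_tests _ TR leb1 D _ f (plateau c' e')) => //.
  - exact: leb1_itv_lty.
  - move=> n; apply: measurable_funTS; apply: continuous_measurable_fun.
    by have [/smooth_continuous] := plateau_test c' e' n.
  - by move=> n x; exact: plateau_bounds.
  - by move=> x; exact: plateau_cvg.
  - move=> n; apply: f0; apply: test_functionW (plateau_test c' e' n).
    by rewrite -itvoo_setI => x [].
apply: integral_eq0_ae => // A mA.
have := @integral_eq0_pi_system _ _ TR TR R leb1 (f \_ D) id setT _ IfD _ _
  (RGenOpens.measurableE R) setI_closed_itvoo _ _ A mA.
rewrite setIT; apply => //.
  rewrite -[RHS](f_oo a b) [RHS]integral_mkcond; apply: eq_integral => x _.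
  by rewrite !patchE; case: ifP.
by move=> _ [c [e ->]]; rewrite setIT; exact: f_oo.
Qed.

(** Products of plateaus handle open rectangles. The pi-lambda argument is then run three times: on
    the first factor, on the second factor, and finally on the measurable rectangles, which generate
    the product sigma-algebra. *)
Lemma rect_test_dense (a b c e : R) (f : R * R -> R) :
  let D := `]a, b[%classic `*` `]c, e[%classic in L2 leb2 D f ->
  (forall phi, test_function D phi -> dotL2 leb2 D f phi = 0) ->
  ae_eq leb2 D f (fun=> 0).
Proof.
move=> D Lf f0.
have mD : measurable (D : set (TR * TR)) by exact: measurable_rect.
have If := L2_integrable mD (leb2_rect_lty a b c e) Lf.
have IfD := integrable_patch mD If.
have f_sub E : measurable (E : set (TR * TR)) ->
    (\int[leb2]_(x in E) ((f \_ D) x)%:E =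
     \int[leb2]_(x in E `&` D) ((f \_ D) x)%:E)%E.
  move=> mE; rewrite [RHS]integral_mkcondr; apply: eq_integral => x _.
  by rewrite !patchE; case: ifP.
have f_oo a' b' c' e' : (\int[leb2]_(x in (`]a', b'[%classic `*` `]c', e'[%classic))
    ((f \_ D) x)%:E = 0)%E.
  rewrite f_sub; last exact: measurable_rect.
  have -> : (`]a', b'[%classic `*` `]c', e'[%classic) `&` D =
      (`]a', b'[%classic `&` `]a, b[%classic) `*`
      (`]c', e'[%classic `&` `]c, e[%classic).
    by apply/seteqP; split => -[x y] [[? ?] [? ?]]; split; split.
  rewrite !itvoo_setI; set a1 := Num.max a' a; set b1 := Num.min b' b.
  set c1 := Num.max c' c; set e1 := Num.min e' e.
  apply: (@integral_eq0_of_tests _ (TR * TR)%type leb2 D _ f (fun n z =>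
     plateau a1 b1 n z.1 * plateau c1 e1 n z.2)) => //.
  - exact: leb2_rect_lty.
  - exact: measurable_rect.
  - move=> n; apply: measurable_funTS; apply: continuous_measurable_plane.
    have [+ _] := test_tensor (plateau_test a1 b1 n) (plateau_test c1 e1 n).
    exact: smooth_continuous.
  - move=> n x; have /andP[p0 p1] := plateau_bounds a1 b1 n x.1.
    have /andP[q0 q1] := plateau_bounds c1 e1 n x.2.
    by rewrite mulr_ge0//= mulr_ile1.
  - move=> x; rewrite (_ : \1_ _ x = \1_(`]a1, b1[%classic) x.1 * \1_(`]c1, e1[%classic) x.2).
      by apply: cvgM; exact: plateau_cvg.
    by rewrite !indicE in_setX; case: (_ \in _); case: (_ \in _); rewrite ?mulr1 ?mulr0.
  - move=> n; apply: f0.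
    apply: test_functionW (test_tensor (plateau_test a1 b1 n) (plateau_test c1 e1 n)).
    rewrite /a1 /b1 /c1 /e1 -!itvoo_setI => -[x y] [] [_ ?] [_ ?].
    by split.
have f_mo A c' e' : measurable (A : set TR) ->
    (\int[leb2]_(z in A `*` `]c', e'[%classic) ((f \_ D) z)%:E = 0)%E.
  move=> mA; pose C := @setT R `*` `]c', e'[%classic.
  have mC : measurable (C : set (TR * TR)).
    by apply: measurableX => //; exact: measurable_itvoo.
  have := @integral_eq0_pi_system _ _ (TR * TR)%type TR R leb2 (f \_ D) fst C _ IfD
    (@measurable_fst _ _ TR TR) mC (RGenOpens.measurableE R) setI_closed_itvoo _ _ A mA.
  have E (B : set R) : fst @^-1` B `&` C = B `*` `]c', e'[%classic.
    by apply/seteqP; split => -[x y]; [move=> [? [_ ?]]|move=> [? ?]]; split.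
  rewrite E; apply; last by move=> _ [a' [b' ->]]; rewrite E; exact: f_oo.
  rewrite f_sub// -[RHS](f_oo a b c' e') [RHS]f_sub; last exact: measurable_rect.
  congr (integral _ _ _).
  by apply/seteqP; split => -[x y] [[? ?] [? ?]]; split; split.
have f_mm A B : measurable (A : set TR) -> measurable (B : set TR) ->
    (\int[leb2]_(z in A `*` B) ((f \_ D) z)%:E = 0)%E.
  move=> mA mB; pose C := A `*` @setT R.
  have mC : measurable (C : set (TR * TR)) by apply: measurableX.
  have := @integral_eq0_pi_system _ _ (TR * TR)%type TR R leb2 (f \_ D) snd C _ IfD
    (@measurable_snd _ _ TR TR) mC (RGenOpens.measurableE R) setI_closed_itvoo _ _ B mB.
  have E (X : set R) : snd @^-1` X `&` C = A `*` X.
    by apply/seteqP; split => -[x y]; [move=> [? [? _]]|move=> [? ?]]; split.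
  rewrite E; apply; last by move=> _ [a' [b' ->]]; rewrite E; exact: f_mo.
  rewrite f_sub// -[RHS](f_mo A c e mA) [RHS]f_sub; last first.
    by apply: measurableX => //; exact: measurable_itvoo.
  congr (integral _ _ _).
  by apply/seteqP; split => -[x y] [[? ?] [? ?]]; split; split.
apply: integral_eq0_ae => // E mE.
have := @integral_eq0_pi_system _ _ (TR * TR)%type (TR * TR)%type R leb2 (f \_ D) id
  setT _ IfD _ _ (@measurable_prod_measurableType _ _ TR TR) _ _ _ E mE.
rewrite setIT; apply => //.
- move=> _ _ [A mA [B mB <-]] [A' mA' [B' mB' <-]].
  exists (A `&` A'); first exact: measurableI.
  exists (B `&` B'); first exact: measurableI.
  by rewrite setXI.
- by rewrite -setXTT; apply: f_mm.
- by move=> _ [A mA [B mB <-]]; rewrite setIT; exact: f_mm.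
Qed.

End TestDense.

(** * The trace inequality for smooth functions *)

Section TraceInequality.
Context {R : realType}.
Local Notation TR := (measurableTypeR R).

Lemma Rintegral_derive (h h' : R -> R) (a b : R) : a < b ->
  (forall x, is_derive (x : R^o) (1 : R^o) (h : R^o -> R^o) (h' x)) ->
  continuous h' ->
  Rintegral leb1 `]a, b[%classic h' = h b - h a.
Proof.
move=> ab hh' ch'.
have ch : continuous h.
  move=> x; apply: differentiable_continuous; apply/derivable1_diffP.
  by have [] := hh' x.
have Icc : lebesgue_measure.-integrable `[a, b]%classic (EFin \o h').
  apply: continuous_compact_integrable; first exact: segment_compact.
  exact: continuous_subspaceT.
have -> : Rintegral leb1 `]a, b[%classic h' = Rintegral leb1 `[a, b]%classic h'.
  transitivity (Rintegral leb1 `]a, b]%classic h').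
    apply: Rintegral_itv_bndo_bndc; apply: integrableS Icc => //.
    by apply: subset_itv; rewrite bnd_simp.
  apply: Rintegral_itv_obnd_cbnd; apply: integrableS Icc => //.
  by apply: subset_itv; rewrite bnd_simp.
rewrite /Rintegral (@continuous_FTC2 _ h' h)//.
- exact: continuous_subspaceT.
- split.
  + by move=> x _; have [] := hh' x.
  + by apply: cvg_at_right_filter; exact: ch.
  + by apply: cvg_at_left_filter; exact: ch.
- by move=> x _; rewrite derive1E; have [] := hh' x.
Qed.

(* Integrating the derivative of [w h^2] for an affine weight [w] that vanishes
   at one endpoint bounds the value of [h] at the other endpoint. *)
Lemma weighted_endpoint_bound (h h' : R -> R) (a b s t : R) : a < b ->
  `|s| <= 1 -> (forall x, a < x < b -> `|s * x + t| <= b - a) ->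
  (forall x, is_derive (x : R^o) (1 : R^o) (h : R^o -> R^o) (h' x)) ->
  continuous h' ->
  `|(s * b + t) * h b ^+ 2 - (s * a + t) * h a ^+ 2| <=
  (1 + (b - a)) * Rintegral leb1 `]a, b[%classic (fun x => h x ^+ 2 + h' x ^+ 2).
Proof.
move=> ab s1 wab hh' ch'.
have ch : continuous h.
  move=> x; apply: differentiable_continuous; apply/derivable1_diffP.
  by have [] := hh' x.
pose w x := s * x + t.
have dw (x : R) : is_derive (x : R^o) (1 : R^o) (w : R^o -> R^o) s.
  have d1 : is_derive (x : R^o) (1 : R^o) (fun x : R^o => s *: x : R^o) (s *: 1).
    exact: is_deriveZ.
  have := is_deriveD d1 (is_derive_cst (t : R^o) (x : R^o) (1 : R^o)).
  by move=> h1; apply: is_derive_eq h1 _; rewrite addr0 -[LHS]/(_ * _) mulr1.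
have cw : continuous w.
  move=> x; apply: differentiable_continuous; apply/derivable1_diffP.
  by have [] := dw x.
pose g x := s * h x ^+ 2 + w x * (2 * (h x * h' x)).
have dF (x : R) : is_derive (x : R^o) (1 : R^o)
    (fun x : R^o => w x * (h x * h x) : R^o) (g x).
  have h1 := is_deriveM (dw x) (is_deriveM (hh' x) (hh' x)).
  apply: is_derive_eq h1 _; rewrite /g -![_ *: _]/(_ * _) /=.
  rewrite -[(_ * _ : R^o -> R^o) x]/(h x * h x) expr2.
  by ring.
have ch2 : continuous (fun x => h x ^+ 2).
  by move=> x; apply: (@continuous_comp R R R h (fun y => y ^+ 2));
    [exact: ch|exact: exprn_continuous].
have ch'2 : continuous (fun x => h' x ^+ 2).
  by move=> x; apply: (@continuous_comp R R R h' (fun y => y ^+ 2));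
    [exact: ch'|exact: exprn_continuous].
have cg : continuous g.
  move=> x; apply: cvgD; first by apply: cvgM; [exact: cvg_cst|exact: ch2].
  apply: cvgM; first exact: cw.
  by apply: cvgM; [exact: cvg_cst|apply: cvgM; [exact: ch|exact: ch']].
have I1 (k : R -> R) : continuous k -> leb1.-integrable `]a, b[%classic (EFin \o k).
  move=> ck; apply: L2_integrable; [exact: measurable_itvoo|exact: leb1_itv_lty|].
  exact: continuous_L2_itv.
have cS : continuous (fun x => h x ^+ 2 + h' x ^+ 2).
  by move=> x; apply: cvgD; [exact: ch2|exact: ch'2].
rewrite -/(w a) -/(w b) !expr2.
rewrite -(Rintegral_derive ab dF cg).
rewrite -RintegralZl; [|exact: measurable_itvoo|exact: I1].
apply: (le_trans (le_normr_Rintegral (measurable_itvoo a b) (I1 _ cg))).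
have cng : continuous (fun x => `|g x|).
  by move=> x; apply: (@continuous_comp R R R g Num.norm); [exact: cg|exact: norm_continuous].
have cZ : continuous (fun x => (1 + (b - a)) * (h x ^+ 2 + h' x ^+ 2)).
  by move=> x; apply: cvgM; [exact: cvg_cst|exact: cS].
apply: le_Rintegral; [exact: measurable_itvoo|exact: I1|exact: I1|].
move=> x /=; rewrite in_itv /= => xab.
have {}wab : `|w x| <= b - a by exact: wab.
rewrite /g; move: (h x) (h' x) (w x) wab => p q r rab.
apply: (le_trans (ler_normD _ _)).
have e1 : `|s * p ^+ 2| <= p ^+ 2 + q ^+ 2.
  rewrite normrM [`|p ^+ 2|]ger0_norm ?sqr_ge0//.
  by rewrite (@le_trans _ _ (p ^+ 2)) ?ler_piMl ?sqr_ge0// lerDl sqr_ge0.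
have e2 : `|r * (2 * (p * q))| <= (b - a) * (p ^+ 2 + q ^+ 2).
  rewrite normrM ler_pM//.
  have := sqr_ge0 (p - q); have := sqr_ge0 (p + q); rewrite sqrrB sqrrD => h1 h2.
  by rewrite ler_norml; apply/andP; split; lra.
apply: (le_trans (lerD e1 e2)).
by rewrite [leRHS]mulrDl mul1r.
Qed.

Definition traceK (a b : R) : R := (b - a)^-1 * (1 + (b - a)).

Lemma traceK_ge0 a b : a < b -> 0 <= traceK a b.
Proof.
by move=> /ltW; rewrite -subr_ge0 /traceK; move: (b - a) => t t0;
  rewrite mulr_ge0 ?invr_ge0 ?addr_ge0.
Qed.

(** The weight is [x - a] for the right end and [x - b] for the left end. At the end that is kept
    its absolute value is [b - a], which is the divisor in [traceK]. *)
Lemma endpoint_bound (h h' : R -> R) (a b : R) (right : bool) : a < b ->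
  (forall x, is_derive (x : R^o) (1 : R^o) (h : R^o -> R^o) (h' x)) ->
  continuous h' ->
  h (if right then b else a) ^+ 2 <=
  traceK a b * Rintegral leb1 `]a, b[%classic (fun x => h x ^+ 2 + h' x ^+ 2).
Proof.
move=> ab hh' ch'; have ba : 0 < b - a by rewrite subr_gt0.
rewrite /traceK -mulrA ler_pdivlMl//.
have [s [t [s1 wab]]] : exists s t : R, `|s| <= 1 /\
    (forall x, a < x < b -> `|s * x + t| <= b - a) /\
    if right then s * b + t = b - a /\ s * a + t = 0
    else s * b + t = 0 /\ s * a + t = - (b - a).
  case: right.
    exists 1, (- a); rewrite normr1; split => //; split.
      by move=> x /andP[ax xb]; rewrite ger0_norm; lra.
    by split; ring.
  exists 1, (- b); rewrite normr1; split => //; split.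
    by move=> x /andP[ax xb]; rewrite ler0_norm; lra.
  by split; ring.
case: wab => wab ends.
have := weighted_endpoint_bound ab s1 wab hh' ch'.
apply: le_trans; case: right ends => -[-> ->].
  by rewrite mul0r subr0 normrM (gtr0_norm ba) ger0_norm ?sqr_ge0.
by rewrite mul0r sub0r mulNr opprK normrM (gtr0_norm ba) ger0_norm ?sqr_ge0.
Qed.

Lemma integrable_slices1 (f : R * R -> R) (a b c e : R) : continuous f ->
  leb1.-integrable `]a, b[%classic
    (fun x => (Rintegral leb1 `]c, e[%classic (fun y => f (x, y)))%:E).
Proof.
move=> cf; set A := `]a, b[%classic; set B := `]c, e[%classic.
have mAB := measurable_rect a b c e.
have If : leb2.-integrable (A `*` B) (EFin \o f).
  by apply: L2_integrable => //; [exact: leb2_rect_lty|exact: continuous_L2_rect].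
have If' := (@integrable_mkcond _ _ _ leb2 (A `*` B) (EFin \o f) mAB).1 If.
have := @integrable_fubini_F _ _ TR TR R lebesgue_measure lebesgue_measure _ If'.
have mA : measurable (A : set TR) by exact: measurable_itvoo.
move=> /(integrableS measurableT mA (@subsetT _ _)).
apply: eq_integrable => // x xA.
rewrite Rintegral_EFin; last 2 first.
- exact: measurable_itvoo.
- apply: L2_integrable; [exact: measurable_itvoo|exact: leb1_itv_lty|].
  by apply: continuous_L2_itv; exact: continuous_slice2.
rewrite /fubini_F [RHS]integral_mkcond; apply: eq_integral => y _.
by rewrite !patchE in_setX xA.
Qed.

Lemma integrable_slices2 (f : R * R -> R) (a b c e : R) : continuous f ->
  leb1.-integrable `]c, e[%classic
    (fun y => (Rintegral leb1 `]a, b[%classic (fun x => f (x, y)))%:E).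
Proof.
move=> cf; apply: (@integrable_slices1 (fun z => f (z.2, z.1))) => z.
apply: (@continuous_comp (R * R)%type (R * R)%type R (fun z => (z.2, z.1)) f);
  last exact: cf.
exact: (@cvg_pair (R * R)%type R R (nbhs z) (nbhs z.2) (nbhs z.1) _ _ _ snd fst
  cvg_snd cvg_fst).
Qed.

End TraceInequality.

(** * Boundary estimate and vanishing integrals of derivatives on a rectangle *)

Section SmoothOnRectangle.
Context {R : realType}.

Lemma sqnormL2_def d (T : measurableType d) (mu : {measure set T -> \bar R})
    (D : set T) (f : T -> R) :
  sqnormL2 mu D f = Rintegral mu D (fun x => f x ^+ 2).
Proof. by []. Qed.

Lemma dotL2_def d (T : measurableType d) (mu : {measure set T -> \bar R})
    (D : set T) (f g : T -> R) :
  dotL2 mu D f g = Rintegral mu D (fun x => f x * g x).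
Proof. by []. Qed.

Lemma continuous_sqr (V : normedModType R) (f : V -> R) : continuous f ->
  continuous (fun x => f x ^+ 2).
Proof.
move=> cf x; apply: (@continuous_comp V R R f (fun y => y ^+ 2)); first exact: cf.
exact: exprn_continuous.
Qed.

Lemma continuousMf (V : normedModType R) (f g : V -> R) :
  continuous f -> continuous g -> continuous (fun x => f x * g x).
Proof. by move=> cf cg x; apply: cvgM; [exact: cf|exact: cg]. Qed.

Lemma continuousDf (V : normedModType R) (f g : V -> R) :
  continuous f -> continuous g -> continuous (fun x => f x + g x).
Proof. by move=> cf cg x; apply: cvgD; [exact: cf|exact: cg]. Qed.

Lemma continuous_integrable_itv (f : R -> R) (a b : R) : continuous f ->
  leb1.-integrable `]a, b[%classic (EFin \o f).
Proof.
move=> cf; apply: L2_integrable; [exact: measurable_itvoo|exact: leb1_itv_lty|].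
exact: continuous_L2_itv.
Qed.

Lemma continuous_integrable_rect (f : R * R -> R) (a b c e : R) : continuous f ->
  leb2.-integrable (`]a, b[%classic `*` `]c, e[%classic) (EFin \o f).
Proof.
move=> cf; apply: L2_integrable; [exact: measurable_rect|exact: leb2_rect_lty|].
exact: continuous_L2_rect.
Qed.

Lemma ler_sum_term n (F : 'I_n -> R) : (forall k, 0 <= F k) ->
  forall k, F k <= \sum_(i < n) F i.
Proof. by move=> F0 k; rewrite (bigD1 k)//= lerDl sumr_ge0. Qed.

Variable Q : rectangle R.
Hypothesis xQ : xmin Q < xmax Q.
Hypothesis yQ : ymin Q < ymax Q.

Definition sideK (Q : rectangle R) : R :=
  traceK (xmin Q) (xmax Q) + traceK (ymin Q) (ymax Q).

Lemma sideK_ge0 : 0 <= sideK Q.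
Proof. by rewrite addr_ge0 ?traceK_ge0. Qed.

Let sumsq_rect (f g : R * R -> R) : continuous f -> continuous g ->
  Rintegral leb2 (rect_set Q) (fun z => f z ^+ 2 + g z ^+ 2) =
  sqnormL2 leb2 (rect_set Q) f + sqnormL2 leb2 (rect_set Q) g.
Proof.
move=> cf cg; rewrite !sqnormL2_def RintegralD//; first exact: measurable_rect.
  by apply: continuous_integrable_rect; exact: continuous_sqr.
by apply: continuous_integrable_rect; exact: continuous_sqr.
Qed.

(** Each slice perpendicular to the side obeys [endpoint_bound]; integration along the side and
    Fubini's theorem give the estimate, which involves only the derivative across the side. *)
Lemma smooth_side_bound (phi : R * R -> R) (s : bool * bool) : smooth phi ->
  sqnormL2 leb1 (side_dom Q s) (phi \o side_pt Q s) <=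
  sideK Q * (sqnormL2 leb2 (rect_set Q) phi +
    \sum_(k < 2) sqnormL2 leb2 (rect_set Q) (fun z => 'D_(axis k) phi z)).
Proof.
move=> Sp; have cp := smooth_continuous Sp.
have cd k : continuous (fun z => 'D_(axis k) phi z).
  by apply: smooth_continuous; exact: smooth_derive.
have Kx := traceK_ge0 xQ; have Ky := traceK_ge0 yQ.
have n0 (f : R * R -> R) : 0 <= sqnormL2 leb2 (rect_set Q) f by exact: sqnormL2_ge0.
have F0 k : 0 <= sqnormL2 leb2 (rect_set Q) (fun z => 'D_(axis k) phi z) by exact: n0.
have := ler_sum_term F0; move: (\sum_(k < 2) _) => S FS.
have cS k : continuous (fun z => phi z ^+ 2 + 'D_(axis k) phi z ^+ 2).
  by apply: continuousDf; exact: continuous_sqr.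
case: s => [[] r].
- pose x0 := if r then xmax Q else xmin Q.
  apply: (@le_trans _ _ (traceK (xmin Q) (xmax Q) *
    (sqnormL2 leb2 (rect_set Q) phi +
     sqnormL2 leb2 (rect_set Q) (fun z => 'D_(axis 0) phi z)))); last first.
    rewrite ler_pM ?addr_ge0 ?n0//; first by rewrite lerDl.
    by rewrite lerD2l.
  rewrite -sumsq_rect// Rintegral_rect_swap//.
  have Is := @integrable_slices2 _ _ (xmin Q) (xmax Q) (ymin Q) (ymax Q) (cS 0).
  rewrite -(RintegralZl (traceK (xmin Q) (xmax Q)) (measurable_itvoo _ _) Is).
  rewrite sqnormL2_def; apply: le_Rintegral.
  + exact: measurable_itvoo.
  + apply: continuous_integrable_itv; apply: continuous_sqr.
    exact: (@continuous_slice2 _ phi).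
  + have := integrableZl (measurable_itvoo _ _) (traceK (xmin Q) (xmax Q)) Is.
    by apply: eq_integrable => // y _; rewrite /= EFinM.
  + move=> y _.
    apply: (@endpoint_bound _ (fun t => phi (t, y))
      (fun t => 'D_(axis 0) phi (t, y)) _ _ r xQ).
      by move=> x; apply: is_derive_slice1; exact: smooth_derivable.
    exact: (@continuous_slice1 _ (fun z => 'D_(axis 0) phi z)).
- apply: (@le_trans _ _ (traceK (ymin Q) (ymax Q) *
    (sqnormL2 leb2 (rect_set Q) phi +
     sqnormL2 leb2 (rect_set Q) (fun z => 'D_(axis 1) phi z)))); last first.
    rewrite ler_pM ?addr_ge0 ?n0//; first by rewrite lerDr.
    by rewrite lerD2l.
  rewrite -sumsq_rect// Rintegral_rect//.
  have Is := @integrable_slices1 _ _ (xmin Q) (xmax Q) (ymin Q) (ymax Q) (cS 1).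
  rewrite -(RintegralZl (traceK (ymin Q) (ymax Q)) (measurable_itvoo _ _) Is).
  rewrite sqnormL2_def; apply: le_Rintegral.
  + exact: measurable_itvoo.
  + apply: continuous_integrable_itv; apply: continuous_sqr.
    exact: (@continuous_slice1 _ phi).
  + have := integrableZl (measurable_itvoo _ _) (traceK (ymin Q) (ymax Q)) Is.
    by apply: eq_integrable => // y _; rewrite /= EFinM.
  + move=> x _.
    apply: (@endpoint_bound _ (fun t => phi (x, t))
      (fun t => 'D_(axis 1) phi (x, t)) _ _ r yQ).
      by move=> y; apply: is_derive_slice2; exact: smooth_derivable.
    exact: (@continuous_slice2 _ (fun z => 'D_(axis 1) phi z)).
Qed.

(** The fundamental theorem of calculus on each slice, whose ends lie outside the open rectangle.
    For a product with a test function this is integration by parts. *)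
Lemma Rintegral_partial0 (phi : R * R -> R) (k : 'I_2) : smooth phi ->
  (forall z, ~ rect_set Q z -> phi z = 0) ->
  Rintegral leb2 (rect_set Q) (fun z => 'D_(axis k) phi z) = 0.
Proof.
move=> Sp p0.
have cd i : continuous (fun z => 'D_(axis i) phi z).
  by apply: smooth_continuous; exact: smooth_derive.
have [->|->] : k = 0 \/ k = 1.
  by case: k => -[|[|//]] i; [left|right]; exact: val_inj.
- rewrite Rintegral_rect_swap//.
  rewrite (_ : (fun y => _) = (fun=> 0)).
    by rewrite /Rintegral integral0.
  apply/funext => y.
  have dphi x : is_derive (x : R^o) (1 : R^o) (fun x : R^o => phi (x, y) : R^o)
      ('D_(axis 0) phi (x, y)).
    by apply: is_derive_slice1; exact: smooth_derivable.
  rewrite (Rintegral_derive xQ dphi).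
  + rewrite !p0 ?subrr// => -[] /=.
      by rewrite in_itv /= ltxx.
    by rewrite in_itv /= ltxx andbF.
  + exact: (@continuous_slice1 _ (fun z => 'D_(axis 0) phi z)).
- rewrite Rintegral_rect//.
  rewrite (_ : (fun x => _) = (fun=> 0)).
    by rewrite /Rintegral integral0.
  apply/funext => x.
  have dphi y : is_derive (y : R^o) (1 : R^o) (fun y : R^o => phi (x, y) : R^o)
      ('D_(axis 1) phi (x, y)).
    by apply: is_derive_slice2; exact: smooth_derivable.
  rewrite (Rintegral_derive yQ dphi).
  + rewrite !p0 ?subrr// => -[] /= _.
      by rewrite in_itv /= ltxx.
    by rewrite in_itv /= ltxx andbF.
  + exact: (@continuous_slice2 _ (fun z => 'D_(axis 1) phi z)).
Qed.

End SmoothOnRectangle.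

(** * Sobolev spaces and traces on a rectangle *)

Lemma sqrt_cvg0_near {R : realType} (x : R ^nat) (e : R) : (forall n, 0 <= x n) ->
  Num.sqrt (x n) @[n --> \oo] --> (0 : R) -> 0 < e -> \forall n \near \oo, x n <= e.
Proof.
move=> x0 + e0; have se0 : 0 < Num.sqrt e by rewrite sqrtr_gt0.
move=> /cvgrPdist_le/(_ _ se0); apply: filterS => n.
rewrite sub0r normrN ger0_norm ?sqrtr_ge0// => h.
by rewrite -(sqr_sqrtr (x0 n)) -(sqr_sqrtr (ltW e0)) ler_pXn2r ?nnegrE ?sqrtr_ge0.
Qed.

Lemma sqrt_cvg0 {R : realType} (x : R ^nat) :
  (forall n, 0 <= x n <= 1 / 8 ^+ n) -> Num.sqrt (x n) @[n --> \oo] --> (0 : R).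
Proof.
move=> xP; apply/cvgrPdist_le => e e0.
have e20 : 0 < e ^+ 2 by rewrite exprn_gt0.
have /cvgrPdist_le/(_ _ e20) := @cvg_pow8 R 1; apply: filterS => n.
rewrite !sub0r !normrN => h; have /andP[x0 x1] := xP n.
rewrite ger0_norm ?sqrtr_ge0// -(@ler_pXn2r _ 2)// ?nnegrE ?sqrtr_ge0 ?(ltW e0)//.
by rewrite sqr_sqrtr//; apply: le_trans x1 (le_trans (ler_norm _) h).
Qed.

Section RectangleSobolev.
Context {R : realType}.
Local Notation TR := (measurableTypeR R).

Definition partial (k : 'I_2) (phi : R * R -> R) : R * R -> R :=
  fun z => 'D_(axis k) phi z.

Definition sqnormH1_2 (D : set (R * R)) (u : R * R -> R) : R :=
  sqnormH1 leb2 D (test_function D) partial u.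

Transparent dotL2 sqnormL2 wgrad sqnormH1.

(** The abstract Sobolev notions are shaped so as to unfold to the concrete ones; they are
    transparent only during this identification. *)
Lemma wpartialE (D : set (R * R)) k u :
  wpartial D k u = wgrad leb2 D (test_function D) partial k u.
Proof. by []. Qed.

Lemma normH1_2E (D : set (R * R)) u : normH1_2 D u = Num.sqrt (sqnormH1_2 D u).
Proof. by []. Qed.

Opaque dotL2 sqnormL2 wgrad sqnormH1.

Lemma normH1_2_sqr (D : set (R * R)) u : normH1_2 D u ^+ 2 = sqnormH1_2 D u.
Proof. by rewrite normH1_2E sqr_sqrtr// sqnormH1_ge0. Qed.

Lemma smooth_partial k phi : smooth phi -> smooth (partial k phi).
Proof. exact: smooth_derive. Qed.

Lemma partialM k (phi psi : R * R -> R) : smooth phi -> smooth psi ->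
  partial k (fun z => phi z * psi z) =
  (fun z => partial k phi z * psi z + phi z * partial k psi z).
Proof.
move=> Sp Sq; apply/funext => z; rewrite /partial.
rewrite (deriveM (f := phi) (g := psi)); try exact: smooth_derivable.
by rewrite addrC -![_ *: _]/(_ * _) (mulrC (psi z)).
Qed.

Variable Q : rectangle R.
Local Notation D := (rect_set Q).

Lemma rect_test_space : test_space leb2 D (test_function D) partial.
Proof.
split.
- exact: measurable_rect.
- by move=> phi [Sp _]; apply: continuous_L2_rect; exact: smooth_continuous.
- move=> k phi [Sp _]; apply: continuous_L2_rect; apply: smooth_continuous.
  exact: smooth_partial.
- exact: rect_test_dense.
Qed.

Hypothesis xQ : xmin Q < xmax Q.
Hypothesis yQ : ymin Q < ymax Q.

Lemma smooth_L2 phi : smooth phi -> L2 leb2 D phi.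
Proof. by move=> Sp; apply: continuous_L2_rect; exact: smooth_continuous. Qed.

Lemma smooth_test (phi psi : R * R -> R) : smooth phi -> test_function D psi ->
  test_function D (fun z => phi z * psi z).
Proof.
move=> Sp [Sq [K [cK KD Kq]]]; split; first exact: smoothM.
by exists K; split => // z /Kq ->; rewrite mulr0.
Qed.

Lemma smooth_weak_deriv phi k : smooth phi ->
  weak_deriv leb2 D (test_function D) partial k phi (partial k phi).
Proof.
move=> Sp; split; first by apply: smooth_L2; exact: smooth_partial.
move=> psi tpsi; have [Sq [K [cK KD Kq]]] := tpsi.
have := @Rintegral_partial0 _ Q xQ yQ (fun z => phi z * psi z) k (smoothM Sp Sq).
move=> /(_ _)/wrap[z nDz|].
  by rewrite Kq ?mulr0// => /KD.
rewrite -[X in Rintegral _ _ X]/(partial k (fun z => phi z * psi z)) partialM//.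
have L1 := smooth_L2 (smooth_partial k Sp).
have L2 := smooth_L2 (smooth_partial k Sq).
have L3 := smooth_L2 Sp; have L4 := smooth_L2 Sq.
have mD := test_space_measurable rect_test_space.
rewrite RintegralD//; [|exact: L2_mul|exact: L2_mul].
rewrite -!dotL2_def => /eqP; rewrite addrC addr_eq0 => /eqP ->.
by [].
Qed.

Lemma smooth_inH1 phi : smooth phi -> inH1 leb2 D (test_function D) partial phi.
Proof.
move=> Sp; split; first exact: smooth_L2.
by move=> k; exists (partial k phi); exact: smooth_weak_deriv.
Qed.

Lemma smooth_sqnormH1 phi : smooth phi ->
  sqnormH1_2 D phi = sqnormL2 leb2 D phi + \sum_(k < 2) sqnormL2 leb2 D (partial k phi).
Proof.
move=> Sp; apply: (sqnormH1_weak rect_test_space); first exact: smooth_inH1.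
by move=> k; exact: smooth_weak_deriv.
Qed.

Definition sqnorm_bdry (g : R * R -> R) : R :=
  \sum_(s : bool * bool) sqnormL2 leb1 (side_dom Q s) (g \o side_pt Q s).

Lemma sqnorm_bdry_ge0 g : 0 <= sqnorm_bdry g.
Proof. by apply: sumr_ge0 => s _; exact: sqnormL2_ge0. Qed.

Lemma sqnorm_side_le g s :
  sqnormL2 leb1 (side_dom Q s) (g \o side_pt Q s) <= sqnorm_bdry g.
Proof.
rewrite /sqnorm_bdry (bigD1 s)//= lerDl sumr_ge0// => i _; exact: sqnormL2_ge0.
Qed.

Lemma measurable_side s : measurable (side_dom Q s : set TR).
Proof. by rewrite /side_dom; case: ifP => _; exact: measurable_itvoo. Qed.

Lemma continuous_side (phi : R * R -> R) s : continuous phi ->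
  continuous (phi \o side_pt Q s).
Proof.
by case: s => -[] r cp; [exact: (@continuous_slice2 _ phi)|exact: (@continuous_slice1 _ phi)].
Qed.

Lemma continuous_L2_bdry (phi : R * R -> R) : continuous phi -> L2_bdry Q phi.
Proof.
move=> cp s; have := @continuous_side phi s cp; rewrite /side_dom.
by case: ifP => _; exact: continuous_L2_itv.
Qed.

Lemma L2_bdry_lin (c : R) g h : L2_bdry Q g -> L2_bdry Q h ->
  L2_bdry Q (fun z => c * g z + h z).
Proof.
by move=> Lg Lh s; apply: (L2_lin (measurable_side s) c (Lg s) (Lh s)).
Qed.

Lemma L2_bdryB g h : L2_bdry Q g -> L2_bdry Q h ->
  L2_bdry Q (fun z => g z - h z).
Proof. by move=> Lg Lh s; exact: (L2B (measurable_side s) (Lg s) (Lh s)). Qed.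

Lemma sqnorm_bdryD_le g h : L2_bdry Q g -> L2_bdry Q h ->
  sqnorm_bdry (fun z => g z + h z) <= 2 * sqnorm_bdry g + 2 * sqnorm_bdry h.
Proof.
move=> Lg Lh; rewrite /sqnorm_bdry !mulr_sumr -big_split /=.
apply: ler_sum => s _.
exact: (sqnormL2D_le (measurable_side s) (Lg s) (Lh s)).
Qed.

Definition bdryK : R := 4 * sideK Q.

Lemma bdryK_ge0 : 0 <= bdryK.
Proof. by rewrite mulr_ge0// sideK_ge0. Qed.

Lemma smooth_bdry_bound phi : smooth phi ->
  sqnorm_bdry phi <= bdryK * sqnormH1_2 D phi.
Proof.
move=> Sp; rewrite /bdryK -mulrA smooth_sqnormH1//.
apply: (@le_trans _ _ (\sum_(s : bool * bool) sideK Q *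
  (sqnormL2 leb2 D phi + \sum_(k < 2) sqnormL2 leb2 D (partial k phi)))).
  by apply: ler_sum => s _; exact: smooth_side_bound.
by rewrite sumr_const card_prod card_bool mulr_natl.
Qed.

(** Replaces the sequence in [is_trace] by one approximant for each accuracy, measured in squared
    norms; the accuracies [1 / 8 ^+ n] give a sequence back. *)
Lemma is_traceP v g : inH1 leb2 D (test_function D) partial v ->
  is_trace Q v g <-> L2_bdry Q g /\ forall e, 0 < e -> exists phi,
    [/\ smooth phi, sqnormH1_2 D (fun z => phi z - v z) <= e &
        sqnorm_bdry (fun z => phi z - g z) <= e].
Proof.
move=> Hv; split => -[Lg].
  move=> [phi [Sp pv pg]]; split => // e e0.
  have h1 := @sqrt_cvg0_near _ (fun n => sqnormH1_2 D (fun z => phi n z - v z)) _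
    (fun n => sqnormH1_ge0 _ _ _ _ _) pv e0.
  have h2 := sqrt_cvg0_near (fun n => sqnorm_bdry_ge0 _) pg e0.
  have [n _ /(_ n (leqnn _))[/= n1 n2]] := filterI h1 h2.
  by exists (phi n).
move=> app; split => //.
have p8 (n : nat) : 0 < 1 / 8 ^+ n :> R by rewrite divr_gt0 ?exprn_gt0.
have [phi phiP] := choice (fun n : nat => app _ (p8 n)).
exists phi; split; first by move=> n; have [] := phiP n.
- apply: (@sqrt_cvg0 _ (fun n => sqnormH1_2 D (fun z => phi n z - v z))) => n.
  by have [_ -> _] := phiP n; rewrite andbT; exact: sqnormH1_ge0.
- apply: (@sqrt_cvg0 _ (fun n => sqnorm_bdry (fun z => phi n z - g z))) => n.
  by have [_ _ ->] := phiP n; rewrite andbT; exact: sqnorm_bdry_ge0.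
Qed.

Local Notation iH := (inH1 leb2 D (test_function D) partial).

Lemma smooth_trace phi : smooth phi -> is_trace Q phi phi.
Proof.
move=> Sp; apply/is_traceP; first exact: smooth_inH1.
split; first by apply: continuous_L2_bdry; exact: smooth_continuous.
move=> e e0; exists phi; split => //.
- rewrite (_ : (fun z => _) = (fun=> 0)); last by apply/funext => z; rewrite subrr.
  by rewrite /sqnormH1_2 (sqnormH1_0 rect_test_space) ltW.
- rewrite /sqnorm_bdry big1 ?(ltW e0)// => s _.
  by rewrite sqnormL2_def /Rintegral integral0_eq// => x _ /=; rewrite subrr expr0n.
Qed.

Lemma is_trace_L2 v g : is_trace Q v g -> L2_bdry Q g.
Proof. by case. Qed.

(** Passing from a smooth approximant to [v] costs two uses of [|p + q|^2 <= 2 |p|^2 + 2 |q|^2], one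
    on the boundary and one in the rectangle, whence the factor 4. *)
Lemma trace_bound v g : iH v -> is_trace Q v g ->
  sqnorm_bdry g <= bdryK *+ 4 * sqnormH1_2 D v.
Proof.
move=> Hv vg; have [Lg app] := (is_traceP g Hv).1 vg.
have K0 := bdryK_ge0; apply/ler_addgt0Pr => e e0.
have K1 : 0 < 2 + bdryK *+ 4 by rewrite ltr_wpDr ?mulrn_wge0.
have [phi [Sp pv pg]] := app _ (divr_gt0 e0 K1).
have Lp := continuous_L2_bdry (smooth_continuous Sp).
have Hp := smooth_inH1 Sp.
have h1 : sqnorm_bdry g <= 2 * sqnorm_bdry (fun z => phi z - g z) + 2 * sqnorm_bdry phi.
  have := sqnorm_bdryD_le (L2_bdryB Lg Lp) Lp.
  rewrite (_ : (fun z => g z - phi z + phi z) = g); last by apply/funext => z; rewrite subrK.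
  suff -> : sqnorm_bdry (fun z => g z - phi z) = sqnorm_bdry (fun z => phi z - g z) by [].
  by apply: eq_bigr => s _; exact: sqnormL2_subC.
have h2 := smooth_bdry_bound Sp.
have h3 : sqnormH1_2 D phi <= 2 * sqnormH1_2 D (fun z => phi z - v z) + 2 * sqnormH1_2 D v.
  have := sqnormH1D_le rect_test_space (inH1B rect_test_space Hp Hv) Hv.
  by rewrite (_ : (fun z => phi z - v z + v z) = phi)//; apply/funext => z; rewrite subrK.
have : (2 + bdryK *+ 4) * (e / (2 + bdryK *+ 4)) = e by rewrite mulrC divfK// gt_eqF.
move: pv pg h1 h2 h3 K0; move: (e / _) (sqnorm_bdry (fun z => phi z - g z)) => t a.
move: (sqnormH1_2 D (fun z => phi z - v z)) (sqnormH1_2 D v) (sqnormH1_2 D phi).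
move: (sqnorm_bdry g) (sqnorm_bdry phi) bdryK => p q K x y w xt at_ h1 h2 h3 K0 <-.
have : K * w <= K * (2 * x + 2 * y) by rewrite ler_wpM2l.
have : K * x <= K * t by rewrite ler_wpM2l.
clear -xt at_ h1 h2 h3 => h4 h5; lra.
Qed.

Lemma is_trace_lin (c : R) v w g h : iH v -> iH w ->
  is_trace Q v g -> is_trace Q w h ->
  is_trace Q (fun z => c * v z + w z) (fun z => c * g z + h z).
Proof.
move=> Hv Hw vg wh; have [Lg appv] := (is_traceP g Hv).1 vg.
have [Lh appw] := (is_traceP h Hw).1 wh.
apply/is_traceP; first exact: (inH1_lin rect_test_space).
split; first exact: L2_bdry_lin.
(* With accuracy [e / (2 * (c ^+ 2 + 1))] for both approximants, the bound [2 |c p|^2 + 2 |q|^2]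
   adds up to [e]. *)
move=> e e0; have c1 : 0 < 2 * (c ^+ 2 + 1) by rewrite mulr_gt0// ltr_wpDl ?sqr_ge0.
have e1 := divr_gt0 e0 c1.
have e1E : 2 * (c ^+ 2 * (e / (2 * (c ^+ 2 + 1)))) + 2 * (e / (2 * (c ^+ 2 + 1))) = e.
  by field; rewrite gt_eqF//; move: c1; rewrite pmulr_rgt0.
have [phi [Sp pv pg]] := appv _ e1; have [psi [Sq qw qh]] := appw _ e1.
have Hp := smooth_inH1 Sp; have Hq := smooth_inH1 Sq.
exists (fun z => c * phi z + psi z).
have subE (a b a' b' : R * R -> R) : (fun z => c * a z + b z - (c * a' z + b' z)) =
    (fun z => c * (a z - a' z) + (b z - b' z)).
  by apply/funext => z; ring.
have H1 := inH1B rect_test_space Hp Hv; have H2 := inH1B rect_test_space Hq Hw.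
have H0 : iH (fun=> 0) by exact: inH1_0fun.
split.
- by apply: smoothD => //; exact: smoothZ.
- rewrite subE -e1E.
  have HcZ : iH (fun z => c * (phi z - v z)).
    have := inH1_lin rect_test_space c H1 H0.
    by rewrite (_ : (fun z => _ + 0) = (fun z => c * (phi z - v z)))//; apply/funext => z;
      rewrite addr0.
  apply: le_trans (sqnormH1D_le rect_test_space HcZ H2) _.
  apply: lerD; apply: ler_wpM2l => //.
  rewrite (sqnormH1Z rect_test_space c H1).
  exact: (ler_wpM2l (sqr_ge0 c) pv).
- rewrite subE -e1E.
  have L1 := L2_bdryB (continuous_L2_bdry (smooth_continuous Sp)) Lg.
  have L2 := L2_bdryB (continuous_L2_bdry (smooth_continuous Sq)) Lh.
  have LZ : L2_bdry Q (fun z => c * (phi z - g z)).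
    by move=> s; exact: (L2Z (measurable_side s) c (L1 s)).
  apply: le_trans (sqnorm_bdryD_le LZ L2) _.
  apply: lerD; apply: ler_wpM2l => //.
  apply: le_trans (ler_wpM2l (sqr_ge0 c) pg).
  rewrite /sqnorm_bdry mulr_sumr; apply: ler_sum => s _.
  by rewrite -(sqnormL2Z (measurable_side s) c (L1 s)).
Qed.

Lemma is_trace_bound_sub v w g h : iH v -> iH w ->
  is_trace Q v g -> is_trace Q w h ->
  sqnorm_bdry (fun z => g z - h z) <= bdryK *+ 4 * sqnormH1_2 D (fun z => v z - w z).
Proof.
move=> Hv Hw vg wh.
have := trace_bound (inH1_lin rect_test_space (-1) Hw Hv) (is_trace_lin (-1) Hw Hv wh vg).
have subE (a b : R * R -> R) : (fun z => (-1) * b z + a z) = (fun z => a z - b z).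
  by apply/funext => z; rewrite mulN1r addrC.
by rewrite !subE.
Qed.

Lemma is_trace_unique v g h s : iH v -> is_trace Q v g -> is_trace Q v h ->
  ae_eq leb1 (side_dom Q s) (g \o side_pt Q s) (h \o side_pt Q s).
Proof.
move=> Hv vg vh; have := is_trace_bound_sub Hv Hv vg vh.
rewrite (_ : (fun z => v z - v z) = (fun=> 0)); last first.
  by apply/funext => z; rewrite subrr.
rewrite /sqnormH1_2 (sqnormH1_0 rect_test_space) mulr0 => le0.
have Lgh := L2_bdryB (is_trace_L2 vg) (is_trace_L2 vh) s.
have : sqnormL2 leb1 (side_dom Q s) ((fun z => g z - h z) \o side_pt Q s) = 0.
  apply/eqP; rewrite eq_le sqnormL2_ge0 andbT.
  exact: le_trans (sqnorm_side_le _ s) le0.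
move=> /(sqnormL2_eq0 (measurable_side s) Lgh).
by apply: filterS => t /= e /e /eqP; rewrite subr_eq0 => /eqP.
Qed.

Lemma trace_is_trace v g : is_trace Q v g -> is_trace Q v (trace Q v).
Proof. by move=> vg; exact: (xgetI (fun=> 0) vg). Qed.

End RectangleSobolev.

(* On [R], [filterS] and [filterS2] fail to find the filter instance, the carrier
   of [leb1] being only convertible to [R]. *)
Lemma aeS d (T : measurableType d) (R : realType) (mu : {measure set T -> \bar R})
    (A B : T -> Prop) :
  (forall x, A x -> B x) -> {ae mu, forall x, A x} -> {ae mu, forall x, B x}.
Proof. by move=> AB; apply: filterS. Qed.

Lemma aeS2 d (T : measurableType d) (R : realType) (mu : {measure set T -> \bar R})
    (A B C : T -> Prop) :
  (forall x, A x -> B x -> C x) -> {ae mu, forall x, A x} -> {ae mu, forall x, B x} ->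
  {ae mu, forall x, C x}.
Proof. by move=> ABC; apply: filterS2. Qed.

(** * Spaces with a zero trace condition: completeness and multiplication *)

Section TraceSpaces.
Context {R : realType}.
Local Notation TR := (measurableTypeR R).
Variable Q : rectangle R.
Hypothesis xQ : xmin Q < xmax Q.
Hypothesis yQ : ymin Q < ymax Q.
Local Notation D := (rect_set Q).
Local Notation iH := (inH1 leb2 D (test_function D) partial).
Local Notation TS := (rect_test_space Q).

Lemma inH1_0_lin G (c : R) v w : inH1_0 Q G v -> inH1_0 Q G w ->
  inH1_0 Q G (fun z => c * v z + w z).
Proof.
move=> [Hv [g vg g0]] [Hw [h wh h0]]; split; first exact: (inH1_lin TS).
exists (fun z => c * g z + h z); first exact: is_trace_lin.
move=> s; move: (g0 s) (h0 s); apply: aeS2 => t g1 h1 Dt Gt.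
by rewrite g1// h1// mulr0 addr0.
Qed.

Lemma inH1_0_zero G : inH1_0 Q G (fun=> 0).
Proof.
have S0 : smooth (fun=> 0 : R) (V := (R * R)%type) by exact: smooth_cst.
split; first exact: smooth_inH1.
by exists (fun=> 0); [exact: smooth_trace|move=> s; exact: aeW].
Qed.

(** The open sides are pairwise disjoint. This assembles a boundary function from limits obtained on
    each side separately. *)
Lemma side_glue (h : bool * bool -> R -> R) : exists g : R * R -> R,
  forall s t, side_dom Q s t -> g (side_pt Q s t) = h s t.
Proof.
exists (fun z => if z.2 == ymin Q then h (false, false) z.1
  else if z.2 == ymax Q then h (false, true) z.1
  else if z.1 == xmin Q then h (true, false) z.2 else h (true, true) z.2).
move=> [[] []] t; rewrite /side_dom /side_pt /= in_itv /= => /andP[t1 t2].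
- by rewrite (gt_eqF t1) (lt_eqF t2) (gt_eqF xQ).
- by rewrite (gt_eqF t1) (lt_eqF t2) eqxx.
- by rewrite (gt_eqF yQ) eqxx.
- by rewrite eqxx.
Qed.

(** By the trace bound the traces are fast Cauchy on each side, so they converge both in L^2, which
    gives the limit a trace, and almost everywhere, which carries the zero condition over to it. The
    factor 3 counts the function and its two derivatives. *)
Lemma inH1_0_complete G (v : nat -> R * R -> R) (C : R) :
  (forall n, inH1_0 Q G (v n)) ->
  (forall n m, (n <= m)%N ->
    sqnormH1_2 D (fun z => v n z - v m z) <= C / 8 ^+ n) ->
  exists w, inH1_0 Q G w /\
    forall n, sqnormH1_2 D (fun z => v n z - w z) <= C *+ 3 / 8 ^+ n.
Proof.
move=> Hv vC; have H n : iH (v n) by case: (Hv n).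
have [w [Hw vw _]] := H1_fast_complete TS H vC.
have /choice[g gP] n : exists g, is_trace Q (v n) g /\ zero_on Q G g.
  by have [_ [g]] := Hv n; exists g.
have /choice[h hP] s : exists h, [/\ L2 leb1 (side_dom Q s) h,
    forall n, sqnormL2 leb1 (side_dom Q s) (fun t => g n (side_pt Q s t) - h t) <=
      bdryK Q *+ 4 * C / 8 ^+ n &
    {ae leb1, forall t, side_dom Q s t -> g n (side_pt Q s t) @[n --> \oo] --> h t}].
  apply: (L2_fast_complete (measurable_side Q s) (f := fun n => g n \o side_pt Q s)).
    by move=> n; have [/is_trace_L2 + _] := gP n; exact.
  move=> n m nm; have [gn _] := gP n; have [gm _] := gP m.
  apply: le_trans (sqnorm_side_le Q (fun z => g n z - g m z) s) _.
  apply: le_trans (is_trace_bound_sub xQ yQ (H n) (H m) gn gm) _.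
  by rewrite -mulrA ler_wpM2l ?mulrn_wge0 ?bdryK_ge0// vC.
have [k kh] := side_glue h.
have kL2 : L2_bdry Q k.
  move=> s; have [Lh _ _] := hP s; have [mh _] := Lh.
  have mk : measurable_fun (side_dom Q s : set TR) (k \o side_pt Q s).
    by apply: (eq_measurable_fun (h s)) => // t /set_mem Dt; rewrite /= kh.
  apply: (ae_eq_L2 (measurable_side Q s) mk _ Lh).
  by apply: aeW => t Dt; rewrite /= kh.
(* Four sides, each with the constant [bdryK Q *+ 4]. *)
have gk n : sqnorm_bdry Q (fun z => g n z - k z) <= bdryK Q *+ 16 * C / 8 ^+ n.
  have -> : bdryK Q *+ 16 * C / 8 ^+ n = \sum_(s : bool * bool) bdryK Q *+ 4 * C / 8 ^+ n.
    rewrite sumr_const card_prod card_bool; move: (bdryK Q) (8 ^+ n)^-1 => K p.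
    by ring.
  apply: ler_sum => s _; have [_ hs _] := hP s; apply: le_trans (hs n).
  rewrite le_eqVlt; apply/orP; left; apply/eqP.
  by apply: eq_sqnormL2 => t Dt /=; rewrite kh.
exists w; split => //; split => //; exists k.
  apply/is_traceP => //; split => // e e0.
  pose A := C *+ 3; pose B := bdryK Q *+ 16 * C.
  (* Half of [e] is reserved for the distance from the [n]-th term to the limit and half for the
     smooth approximant of that term; absolute values are taken because the signs of [A] and [B] are
     not recorded. *)
  have [n Cn] := @pow8_small R (4 * (`|A| + `|B|)) e e0.
  have Ln : 0 < (8 ^+ n)^-1 :> R by rewrite invr_gt0 exprn_gt0.
  have nA : 2 * (A / 8 ^+ n) <= e / 2.
    apply: le_trans (_ : 2 * (`|A| + `|B|) / 8 ^+ n <= _); last by rewrite -mulrA; lra.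
    by rewrite mulrA ler_wpM2r ?(ltW Ln)// ler_wpM2l// (le_trans (ler_norm _))// lerDl.
  have nB : 2 * (B / 8 ^+ n) <= e / 2.
    apply: le_trans (_ : 2 * (`|A| + `|B|) / 8 ^+ n <= _); last by rewrite -mulrA; lra.
    by rewrite mulrA ler_wpM2r ?(ltW Ln)// ler_wpM2l// (le_trans (ler_norm _))// lerDr.
  have [gn _] := gP n.
  have e4 : 0 < e / 4 by rewrite divr_gt0.
  have [phi [Sp pv pg]] := ((is_traceP (g n) (H n)).1 gn).2 _ e4.
  have Hp := smooth_inH1 xQ yQ Sp.
  exists phi; split => //.
    apply: le_trans (sqnormH1_sub_le TS Hp (H n) Hw) _.
    have := vw n; rewrite -/A; move: pv nA.
    rewrite /sqnormH1_2.
    move: (sqnormH1 _ _ _ _ _) (sqnormH1 _ _ _ _ _) (A / _) => x y z h1 h2 h3.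
    clear -h1 h2 h3; lra.
  have Lp := continuous_L2_bdry Q (smooth_continuous Sp).
  have Lg := is_trace_L2 gn.
  have := sqnorm_bdryD_le (L2_bdryB Lp Lg) (L2_bdryB Lg kL2).
  rewrite (_ : (fun z => phi z - g n z + (g n z - k z)) = (fun z => phi z - k z)); last first.
    by apply/funext => z; rewrite addrA subrK.
  move=> /le_trans; apply; have := gk n; rewrite -/B; move: pg nB.
  move: (sqnorm_bdry _ _) (sqnorm_bdry _ _) (B / _) => x y z h1 h2 h3.
  clear -h1 h2 h3; lra.
move=> s; have [_ _ hs] := hP s.
have : {ae leb1, forall t, forall n, side_dom Q s t -> G (side_pt Q s t) ->
    g n (side_pt Q s t) = 0}.
  by apply: ae_foralln => n; have [_ /(_ s)] := gP n.
move: hs; apply: aeS2 => t gh g0 Dt Gt; rewrite kh//.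
have := gh Dt; rewrite (_ : (fun n => _) = (fun=> 0)); last first.
  by apply/funext => n; exact: g0.
by move=> /(cvg_unique _ (cvg_cst _)) <-.
Qed.

(** Multiplication by [chi] is bounded on H^1 and on L^2 of the boundary, so it sends approximants
    of [v] to approximants of the product. *)
Lemma is_trace_mul chi v g : smooth chi -> iH v -> is_trace Q v g ->
  iH (fun z => chi z * v z) /\
  is_trace Q (fun z => chi z * v z) (fun z => chi z * g z).
Proof.
move=> Sc Hv vg; have cc := smooth_continuous Sc.
have mD := test_space_measurable TS.
have [M0 M0P] := continuous_bounded_rect (xmin Q) (xmax Q) (ymin Q) (ymax Q) cc.
have /choice[M1 M1P] k := continuous_bounded_rect (xmin Q) (xmax Q) (ymin Q) (ymax Q)
  (smooth_continuous (smooth_partial k Sc)).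
(* A common bound for [chi] and its partial derivatives on the closed rectangle, so that it also
   applies on the sides. *)
pose M := Num.max (Num.max M0 0) (Num.max (M1 0) (M1 1)).
have M_ge0 : 0 <= M by rewrite !le_max lexx !orbT.
have cM x y : xmin Q <= x <= xmax Q -> ymin Q <= y <= ymax Q -> `|chi (x, y)| <= M.
  by move=> hx hy; rewrite !le_max M0P.
have dM k x y : xmin Q <= x <= xmax Q -> ymin Q <= y <= ymax Q ->
    `|partial k chi (x, y)| <= M.
  have [->|->] : k = 0 \/ k = 1.
    by case: k => -[|[|//]] i; [left|right]; exact: val_inj.
  - by move=> hx hy; rewrite !le_max M1P ?orbT.
  - by move=> hx hy; rewrite !le_max (M1P 1) ?orbT.
have inD z : D z -> xmin Q <= z.1 <= xmax Q /\ ymin Q <= z.2 <= ymax Q.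
  by move=> [] /=; rewrite !in_itv /= => /andP[/ltW-> /ltW->] /andP[/ltW-> /ltW->].
have cMD z : D z -> `|chi z| <= M.
  by move=> /inD[h1 h2]; case: z h1 h2 => x y; exact: cM.
have dMD k z : D z -> `|partial k chi z| <= M.
  by move=> /inD[h1 h2]; case: z h1 h2 => x y; exact: dM.
have mc : measurable_fun (D : set (TR * TR)) chi.
  by apply: measurable_funTS; exact: continuous_measurable_plane.
have mdc k : measurable_fun (D : set (TR * TR)) (partial k chi).
  apply: measurable_funTS; apply: continuous_measurable_plane.
  by apply: smooth_continuous; exact: smooth_partial.
have leib k phi : test_function D phi -> test_function D (fun z => chi z * phi z) /\
    forall z, D z -> partial k (fun z => chi z * phi z) z =
      partial k chi z * phi z + chi z * partial k phi z.
  move=> tphi; split; first exact: smooth_test.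
  by move=> z _; rewrite partialM//; case: tphi.
have wdM k u : iH u -> weak_deriv leb2 D (test_function D) partial k
    (fun z => chi z * u z)
    (fun z => 1 * (partial k chi z * u z) +
              chi z * wgrad leb2 D (test_function D) partial k u z).
  move=> Hu; have [Lu _] := Hu.
  apply: (weak_derivM TS Lu mc cMD (mdc k) (dMD k) (leib k)).
  exact: weak_deriv_wgrad.
have HM u : iH u -> iH (fun z => chi z * u z).
  move=> Hu; split; first by have [Lu _] := Hu; exact: (L2_bounded_mul mD mc cMD Lu).
  by move=> k; eexists; exact: wdM.
(* The function contributes 1 and each of the two derivatives [2 + 2], nine in all; 10 is a round
   upper bound. *)
have sqM u : iH u -> sqnormH1_2 D (fun z => chi z * u z) <=
    M ^+ 2 *+ 10 * sqnormH1_2 D u.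
  move=> Hu; have [Lu _] := Hu.
  rewrite /sqnormH1_2 (sqnormH1_weak TS (HM u Hu) (fun k => wdM k u Hu)).
  have h0 := sqnormL2_bounded_mul mD mc cMD Lu.
  have hu := sqnormL2_le_H1 leb2 D (test_function D) partial u.
  have M2 : 0 <= M ^+ 2 by exact: sqr_ge0.
  apply: le_trans (_ : M ^+ 2 * sqnormH1_2 D u +
      \sum_(k < 2) M ^+ 2 *+ 4 * sqnormH1_2 D u <= _).
    apply: lerD; first exact: le_trans h0 (ler_wpM2l M2 hu).
    apply: ler_sum => k _.
    have Lg := L2_wgrad k Hu.
    have L1 := L2_bounded_mul mD (mdc k) (dMD k) Lu.
    have L2 := L2_bounded_mul mD mc cMD Lg.
    have := sqnormL2D_le mD L1 L2.
    rewrite (_ : (fun z => partial k chi z * u z + _) = (fun z => 1 * (partial k chi z * u z) +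
       chi z * wgrad leb2 D (test_function D) partial k u z)); last first.
      by apply/funext => z; rewrite mul1r.
    move=> /le_trans; apply.
    have h1 := le_trans (sqnormL2_bounded_mul mD (mdc k) (dMD k) Lu) (ler_wpM2l M2 hu).
    have h2 := le_trans (sqnormL2_bounded_mul mD mc cMD Lg)
      (ler_wpM2l M2 (sqnormL2_wgrad_le_H1 leb2 D (test_function D) partial k u)).
    move: h1 h2; rewrite /sqnormH1_2; move: (sqnormL2 _ _ _) (sqnormL2 _ _ _) (sqnormH1 _ _ _ _ _).
    move: (M ^+ 2) => m x y z h1 h2; clear -h1 h2; lra.
  rewrite sumr_const card_ord.
  have := sqnormH1_ge0 leb2 D (test_function D) partial u; rewrite /sqnormH1_2.
  move: (sqnormH1 _ _ _ _ _) M2; move: (M ^+ 2) => m z m0 z0.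
  have := mulr_ge0 m0 z0; clear; lra.
split; first exact: HM.
have [Lg app] := (is_traceP g Hv).1 vg.
have cMs s t : side_dom Q s t -> `|(chi \o side_pt Q s) t| <= M.
  case: s => -[] r; rewrite /side_dom /= in_itv /= => /andP[/ltW t1 /ltW t2].
    by apply: cM; [case: r; rewrite lexx (ltW xQ)|rewrite t1 t2].
  by apply: cM; [rewrite t1 t2|case: r; rewrite lexx (ltW yQ)].
have mcs s : measurable_fun (side_dom Q s : set TR) (chi \o side_pt Q s).
  apply: measurable_funTS; apply: continuous_measurable_fun.
  exact: continuous_side.
apply/is_traceP => //; first exact: HM.
split; first by move=> s; exact: (L2_bounded_mul (measurable_side Q s) (mcs s) (cMs s) (Lg s)).
move=> e e0.
have K0 : 0 < M ^+ 2 *+ 10 + 1 by rewrite ltr_wpDl// mulrn_wge0 ?sqr_ge0.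
have [phi [Sp pv pg]] := app _ (divr_gt0 e0 K0).
have tE : (M ^+ 2 *+ 10 + 1) * (e / (M ^+ 2 *+ 10 + 1)) = e.
  by rewrite mulrC divfK// gt_eqF.
have t0 : 0 < e / (M ^+ 2 *+ 10 + 1) by rewrite divr_gt0.
have Hp := smooth_inH1 xQ yQ Sp.
have subE (a b : R * R -> R) : (fun z => chi z * a z - chi z * b z) =
    (fun z => chi z * (a z - b z)) by apply/funext => z; rewrite mulrBr.
have M2 : 0 <= M ^+ 2 by exact: sqr_ge0.
exists (fun z => chi z * phi z); split; first exact: smoothM.
  rewrite subE; apply: (le_trans (sqM _ (inH1B TS Hp Hv))).
  rewrite -[leRHS]tE ler_pM ?mulrn_wge0//; first exact: sqnormH1_ge0.
  by rewrite lerDl.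
rewrite subE -tE.
apply: le_trans (_ : M ^+ 2 * sqnorm_bdry Q (fun z => phi z - g z) <= _).
  rewrite /sqnorm_bdry mulr_sumr; apply: ler_sum => s _.
  apply: (sqnormL2_bounded_mul (measurable_side Q s) (mcs s) (cMs s)).
  exact: (L2_bdryB (continuous_L2_bdry Q (smooth_continuous Sp)) Lg).
rewrite ler_pM//; first exact: sqnorm_bdry_ge0.
by rewrite mulrS -addrA lerDl addr_ge0// mulrn_wge0.
Qed.

End TraceSpaces.

(** * Sobolev spaces on an interval *)

Section IntervalSobolev.
Context {R : realType}.

Definition partial1 (k : 'I_1) (phi : R -> R) : R -> R :=
  derive1 (V := R^o) phi.

Definition sqnormH1_1 (D : set R) (u : R -> R) : R :=
  sqnormH1 leb1 D (test_function (V := R^o) D) partial1 u.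

Transparent dotL2 sqnormL2 wgrad sqnormH1.

Lemma inH1_1E (D : set R) u :
  inH1_1 D u <-> inH1 leb1 D (test_function (V := R^o) D) partial1 u.
Proof.
split=> [[Lu [g ug]]|[Lu /(_ ord0)[g ug]]]; first by split => // k; exists g.
by split => //; exists g.
Qed.

Lemma wderivE (D : set R) k u :
  wderiv D u = wgrad leb1 D (test_function (V := R^o) D) partial1 k u.
Proof. by []. Qed.

Lemma normH1_1E (D : set R) u : normH1_1 D u = Num.sqrt (sqnormH1_1 D u).
Proof. by rewrite /sqnormH1_1 /sqnormH1 big_ord1. Qed.

Opaque dotL2 sqnormL2 wgrad sqnormH1.

Lemma normH1_1_sqr (D : set R) u : normH1_1 D u ^+ 2 = sqnormH1_1 D u.
Proof. by rewrite normH1_1E sqr_sqrtr// sqnormH1_ge0. Qed.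

Lemma derive1_smooth (phi : R -> R) : smooth (V := R^o) phi ->
  smooth (V := R^o) (derive1 (V := R^o) phi).
Proof.
move=> Sp; have := smooth_derive (1 : R^o) Sp.
suff -> : derive1 (V := R^o) phi = (fun x => 'D_1 (phi : R^o -> R) x) by [].
by apply/funext => x; rewrite derive1E.
Qed.

Lemma is_derive1_smooth (phi : R -> R) (x : R) : smooth (V := R^o) phi ->
  is_derive (x : R^o) (1 : R^o) (phi : R^o -> R^o) (derive1 (V := R^o) phi x).
Proof.
move=> Sp; have d := @smooth_derivable R R^o phi x 1 Sp.
by split; [exact: d|rewrite derive1E].
Qed.

Variables (a b : R).
Hypothesis ab : a < b.
Local Notation D := (`]a, b[%classic : set R).
Local Notation iH := (inH1 leb1 D (test_function (V := R^o) D) partial1).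

Lemma itv_test_space :
  test_space leb1 D (test_function (V := R^o) D) partial1.
Proof.
split.
- exact: measurable_itvoo.
- by move=> phi [/smooth_continuous cp _]; exact: continuous_L2_itv.
- move=> k phi [/derive1_smooth/smooth_continuous cp _].
  exact: continuous_L2_itv.
- exact: itv_test_dense.
Qed.

Lemma smooth_weak_deriv1 phi k : smooth (V := R^o) phi ->
  weak_deriv leb1 D (test_function (V := R^o) D) partial1 k phi (derive1 (V := R^o) phi).
Proof.
move=> Sp; have cp := smooth_continuous Sp.
have cdp := smooth_continuous (derive1_smooth Sp).
split; first exact: continuous_L2_itv.
move=> psi [Sq [K [cK KD Kq]]]; have cq := smooth_continuous Sq.
have cdq := smooth_continuous (derive1_smooth Sq).
pose g x := phi x * derive1 (V := R^o) psi x + psi x * derive1 (V := R^o) phi x.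
have dg x : is_derive (x : R^o) (1 : R^o) (fun x : R^o => phi x * psi x : R^o) (g x).
  exact: (is_deriveM (is_derive1_smooth x Sp) (is_derive1_smooth x Sq)).
have cg : continuous g.
  by apply: (@continuousDf _ R^o); apply: (@continuousMf _ R^o).
have := Rintegral_derive ab dg cg.
rewrite !Kq; last 2 first.
- by move=> /KD /=; rewrite in_itv /= ltxx.
- by move=> /KD /=; rewrite in_itv /= ltxx andbF.
rewrite !mulr0 subr0 RintegralD; last 3 first.
- exact: measurable_itvoo.
- by apply: continuous_integrable_itv; exact: (@continuousMf _ R^o).
- by apply: continuous_integrable_itv; exact: (@continuousMf _ R^o).
rewrite -!dotL2_def => /eqP; rewrite addr_eq0 => /eqP.
by rewrite (dotL2C _ _ psi).
Qed.

Lemma smooth_inH1_1 phi : smooth (V := R^o) phi -> iH phi.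
Proof.
move=> Sp; split; first by apply: continuous_L2_itv; exact: smooth_continuous Sp.
by move=> k; exists (derive1 (V := R^o) phi); exact: smooth_weak_deriv1.
Qed.

Lemma inH10_1P u : inH10_1 D u <-> iH u /\ forall e, 0 < e -> exists2 phi,
  test_function (V := R^o) D phi & sqnormH1_1 D (fun x => phi x - u x) <= e.
Proof.
split=> -[Hu].
  move=> [phi [tp pu]]; split; first exact/inH1_1E.
  move=> e e0.
  have := @sqrt_cvg0_near _ (fun n => sqnormH1_1 D (fun x => phi n x - u x)) _
    (fun n => sqnormH1_ge0 _ _ _ _ _) _ e0.
  case=> [|n _ /(_ n (leqnn _)) h]; last by exists (phi n).
  by under eq_fun do rewrite -normH1_1E.
move=> app; split; first exact/inH1_1E.
have p8 (n : nat) : 0 < 1 / 8 ^+ n :> R by rewrite divr_gt0 ?exprn_gt0.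
have /choice[phi phiP] : forall n : nat, exists phi, test_function (V := R^o) D phi /\
    sqnormH1_1 D (fun x => phi x - u x) <= 1 / 8 ^+ n.
  by move=> n; have [phi] := app _ (p8 n); exists phi.
exists phi; split; first by move=> n; have [] := phiP n.
under eq_fun do rewrite normH1_1E.
apply: (@sqrt_cvg0 _ (fun n => sqnormH1_1 D (fun z => phi n z - u z))) => n.
by have [_ ->] := phiP n; rewrite andbT; exact: sqnormH1_ge0.
Qed.

Lemma test_functionD (phi psi : R -> R) (c : R) :
  test_function (V := R^o) D phi -> test_function (V := R^o) D psi ->
  test_function (V := R^o) D (fun x => c * phi x + psi x).
Proof.
move=> [Sp [K [cK KD Kp]]] [Sq [K' [cK' KD' Kq]]]; split.
  by apply: smoothD => //; exact: smoothZ.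
exists (K `|` K'); split.
- exact: compactU.
- by move=> x [/KD|/KD'].
- by move=> x /not_orP[/Kp -> /Kq ->]; rewrite mulr0 addr0.
Qed.

Lemma inH10_1_lin (c : R) u v : inH10_1 D u -> inH10_1 D v ->
  inH10_1 D (fun x => c * u x + v x).
Proof.
move=> /inH10_1P[Hu appu] /inH10_1P[Hv appv]; apply/inH10_1P.
split; first exact: (inH1_lin itv_test_space).
move=> e e0; have c1 : 0 < 2 * (c ^+ 2 + 1) by rewrite mulr_gt0// ltr_wpDl ?sqr_ge0.
have e1 := divr_gt0 e0 c1.
have e1E : 2 * (c ^+ 2 * (e / (2 * (c ^+ 2 + 1)))) + 2 * (e / (2 * (c ^+ 2 + 1))) = e.
  by field; rewrite gt_eqF//; move: c1; rewrite pmulr_rgt0.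
have [phi tp pu] := appu _ e1; have [psi tq qv] := appv _ e1.
exists (fun x => c * phi x + psi x); first exact: test_functionD.
have Hp := smooth_inH1_1 tp.1; have Hq := smooth_inH1_1 tq.1.
have H1 := inH1B itv_test_space Hp Hu; have H2 := inH1B itv_test_space Hq Hv.
have HcZ : iH (fun x => c * (phi x - u x)).
  have H0 : iH (fun=> 0) by exact: inH1_0fun.
  have := inH1_lin itv_test_space c H1 H0.
  by rewrite (_ : (fun x => _ + 0) = (fun x => c * (phi x - u x)))//; apply/funext => x;
    rewrite addr0.
rewrite (_ : (fun x => _) = (fun x => c * (phi x - u x) + (psi x - v x))); last first.
  by apply/funext => x; ring.
apply: le_trans (sqnormH1D_le itv_test_space HcZ H2) _.
rewrite -e1E; apply: lerD; apply: ler_wpM2l => //.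
rewrite (sqnormH1Z itv_test_space c H1).
exact: (ler_wpM2l (sqr_ge0 c) pu).
Qed.

Lemma inH10_1_zero : inH10_1 D (fun=> 0).
Proof.
apply/inH10_1P; split; first exact: inH1_0fun.
move=> e e0; exists (fun=> 0).
  by split; [exact: smooth_cst|exists set0; split => //; exact: compact0].
rewrite (_ : (fun x => _) = (fun=> 0)); last by apply/funext => x; rewrite subrr.
by rewrite /sqnormH1_1 (sqnormH1_0 itv_test_space) ltW.
Qed.

Lemma inH10_1_complete (u : nat -> R -> R) (C : R) :
  (forall n, inH10_1 D (u n)) ->
  (forall n m, (n <= m)%N ->
    sqnormH1_1 D (fun z => u n z - u m z) <= C / 8 ^+ n) ->
  exists w, inH10_1 D w /\
    forall n, sqnormH1_1 D (fun z => u n z - w z) <= C *+ 2 / 8 ^+ n.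
Proof.
move=> Hu uC; have H n : iH (u n) by have /inH10_1P[] := Hu n.
have [w [Hw uw _]] := H1_fast_complete itv_test_space H uC.
exists w; split => //; apply/inH10_1P; split => // e e0.
have e4 : 0 < e / 4 by rewrite divr_gt0.
have [n Cn] := @pow8_small R (C *+ 2) _ e4.
have /inH10_1P[_ /(_ _ e4)[phi tp pu]] := Hu n; exists phi => //.
have Hp := smooth_inH1_1 tp.1.
apply: le_trans (sqnormH1_sub_le itv_test_space Hp (H n) Hw) _.
have := uw n; move: pu Cn; rewrite /sqnormH1_1.
move: (sqnormH1 _ _ _ _ _) (sqnormH1 _ _ _ _ _) (C *+ 2 / _) => x y z h1 h2 h3.
clear -h1 h2 h3; lra.
Qed.

End IntervalSobolev.

(** * Extension of interface functions to a rectangle *)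

Section Extension.
Context {R : realType}.
Local Notation TR := (measurableTypeR R).
Variable Q : rectangle R.
Hypothesis xQ : xmin Q < xmax Q.
Hypothesis yQ : ymin Q < ymax Q.
Local Notation D := (rect_set Q).
Local Notation I := (`]xmin Q, xmax Q[%classic : set R).
Local Notation J := (`]ymin Q, ymax Q[%classic : set R).
Local Notation iH := (inH1 leb2 D (test_function D) partial).
Local Notation TS := (rect_test_space Q).

Lemma smooth_tensor (phi psi : R -> R) : smooth (V := R^o) phi -> smooth (V := R^o) psi ->
  smooth (fun z : R * R => phi z.1 * psi z.2).
Proof. by move=> Sp Sq; apply: smoothM; [exact: smooth_fst|exact: smooth_snd]. Qed.

Lemma partial_tensor (phi psi : R -> R) k :
  smooth (V := R^o) phi -> smooth (V := R^o) psi ->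
  partial k (fun z : R * R => phi z.1 * psi z.2) =
  if k == 0 then (fun z => derive1 (V := R^o) phi z.1 * psi z.2)
  else (fun z => phi z.1 * derive1 (V := R^o) psi z.2).
Proof.
move=> Sp Sq.
rewrite (partialM k (smooth_fst Sp) (smooth_snd Sq)); apply/funext => z.
have d1 v := @derive_fst R phi z v (@smooth_derivable R R^o phi z.1 v.1 Sp).
have d2 v := @derive_snd R psi z v (@smooth_derivable R R^o psi z.2 v.2 Sq).
rewrite /partial; have [_ ->] := d1 (axis k); have [_ ->] := d2 (axis k).
rewrite /axis; case: ifP => _ /=.
  by rewrite derive0 mulr0 addr0 derive1E.
by rewrite derive0 mul0r add0r derive1E.
Qed.

(** Test functions [phi] close to [u] yield smooth approximants [phi(x) chi(y)]. The trace uses [u]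
    extended by zero: on the vertical sides it is evaluated at the ends of the interval, where [phi]
    vanishes but the representative [u] is arbitrary. *)
Lemma tensor_extension (u chi : R -> R) : inH10_1 I u -> smooth (V := R^o) chi ->
  iH (fun z => u z.1 * chi z.2) /\
  is_trace Q (fun z => u z.1 * chi z.2) (fun z => (u \_ I) z.1 * chi z.2).
Proof.
move=> /inH10_1P[Hu app] Sc.
have cc := smooth_continuous Sc; have cdc := smooth_continuous (derive1_smooth Sc).
have Lc : L2 leb1 J chi by exact: continuous_L2_itv.
have Ldc : L2 leb1 J (derive1 (V := R^o) chi) by exact: continuous_L2_itv.
have TI := itv_test_space (xmin Q) (xmax Q).
pose du := wgrad leb1 I (test_function (V := R^o) I) partial1 ord0 u.
have Lu : L2 leb1 I u by case: Hu.
have Ldu : L2 leb1 I du by exact: L2_wgrad.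
pose G (k : 'I_2) : R * R -> R := if k == 0 then (fun z => du z.1 * chi z.2)
  else (fun z => u z.1 * derive1 (V := R^o) chi z.2).
have LG k : L2 leb2 D (G k).
  by rewrite /G; case: ifP => _;
    [have [] := tensor_L2_rect Ldu Lc|have [] := tensor_L2_rect Lu Ldc].
have [Lv _] := tensor_L2_rect Lu Lc.
pose B := sqnormL2 leb1 J chi + sqnormL2 leb1 J (derive1 (V := R^o) chi).
have B1 : sqnormL2 leb1 J chi <= B by rewrite lerDl sqnormL2_ge0.
have B2 : sqnormL2 leb1 J (derive1 (V := R^o) chi) <= B by rewrite lerDr sqnormL2_ge0.
have B0 : 0 <= B by rewrite addr_ge0 ?sqnormL2_ge0.
have b1 phi : test_function (V := R^o) I phi ->
    sqnormL2 leb2 D (fun z => phi z.1 * chi z.2 - u z.1 * chi z.2) <=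
    B * sqnormH1_1 I (fun x => phi x - u x).
  move=> tp; have Hp := smooth_inH1_1 xQ tp.1.
  have [Lp _] := Hp; have Lpu := L2B (measurable_itvoo _ _) Lp Lu.
  rewrite (_ : (fun z => _) = (fun z : R * R => (phi z.1 - u z.1) * chi z.2)); last first.
    by apply/funext => z; rewrite mulrBl.
  have [_ ->] := tensor_L2_rect Lpu Lc.
  rewrite mulrC ler_pM ?sqnormL2_ge0//.
  exact: sqnormL2_le_H1.
have b2 k phi : test_function (V := R^o) I phi ->
    sqnormL2 leb2 D (fun z => partial k (fun z => phi z.1 * chi z.2) z - G k z) <=
    B * sqnormH1_1 I (fun x => phi x - u x).
  move=> tp; have Hp := smooth_inH1_1 xQ tp.1.
  have [Lp _] := Hp; have Lpu := L2B (measurable_itvoo _ _) Lp Lu.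
  rewrite (partial_tensor k tp.1 Sc) /G; case: ifP => _.
    have Ldp : L2 leb1 I (derive1 (V := R^o) phi).
      by apply: continuous_L2_itv; exact: (smooth_continuous (derive1_smooth tp.1)).
    have Ldpu := L2B (measurable_itvoo _ _) Ldp Ldu.
    rewrite (_ : (fun z => _) =
      (fun z : R * R => (derive1 (V := R^o) phi z.1 - du z.1) * chi z.2)); last first.
      by apply/funext => z; rewrite mulrBl.
    have [_ ->] := tensor_L2_rect Ldpu Lc.
    rewrite mulrC ler_pM ?sqnormL2_ge0//.
    have wpu : weak_deriv leb1 I (test_function (V := R^o) I) partial1 ord0
        (fun x => (-1) * u x + phi x) (fun x => (-1) * du x + derive1 (V := R^o) phi x).
      apply: (weak_deriv_lin TI) => //; first exact: weak_deriv_wgrad.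
      exact: (smooth_weak_deriv1 xQ ord0 tp.1).
    have subE (f g : R -> R) : (fun x => (-1) * f x + g x) = (fun x => g x - f x).
      by apply/funext => x; rewrite mulN1r addrC.
    rewrite !subE in wpu.
    rewrite -(ae_eq_sqnormL2 (measurable_itvoo _ _) _ _ (weak_deriv_ae TI wpu)).
    - exact: sqnormL2_wgrad_le_H1.
    - by have [] := L2_wgrad ord0 (inH1B TI Hp Hu).
    - by case: Ldpu.
  rewrite (_ : (fun z => _) =
    (fun z : R * R => (phi z.1 - u z.1) * derive1 (V := R^o) chi z.2)); last first.
    by apply/funext => z; rewrite mulrBl.
  have [_ ->] := tensor_L2_rect Lpu Ldc.
  rewrite mulrC ler_pM ?sqnormL2_ge0//.
  exact: sqnormL2_le_H1.
have wG k : weak_deriv leb2 D (test_function D) partial k (fun z => u z.1 * chi z.2) (G k).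
  apply: (weak_deriv_closed TS) => // e e0.
  have B1' : 0 < B + 1 by rewrite ltr_wpDl.
  have [phi tp pu] := app _ (divr_gt0 e0 B1').
  have Be : B * sqnormH1_1 I (fun x => phi x - u x) <= e.
    apply: le_trans (ler_wpM2l B0 pu) _.
    by rewrite mulrA ler_pdivrMr// mulrC ler_wpM2l ?(ltW e0)// lerDl.
  have Sp := smooth_tensor tp.1 Sc.
  exists (fun z => phi z.1 * chi z.2), (partial k (fun z => phi z.1 * chi z.2)); split.
  - exact: smooth_L2.
  - exact: smooth_weak_deriv.
  - exact: le_trans (b1 _ tp) Be.
  - exact: le_trans (b2 k _ tp) Be.
have Hv : iH (fun z => u z.1 * chi z.2) by split => // k; exists (G k).
split => //.
have b3 phi : test_function (V := R^o) I phi ->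
    sqnormH1_2 D (fun z => phi z.1 * chi z.2 - u z.1 * chi z.2) <=
    B *+ 3 * sqnormH1_1 I (fun x => phi x - u x).
  move=> tp; have Sp := smooth_tensor tp.1 Sc; have Hp := smooth_inH1 xQ yQ Sp.
  have subE (f g : R * R -> R) : (fun x => (-1) * f x + g x) = (fun x => g x - f x).
    by apply/funext => x; rewrite mulN1r addrC.
  have wk k : weak_deriv leb2 D (test_function D) partial k
      (fun z => phi z.1 * chi z.2 - u z.1 * chi z.2)
      (fun z => partial k (fun z => phi z.1 * chi z.2) z - G k z).
    rewrite -!subE; apply: (weak_deriv_lin TS) => //; first exact: smooth_L2.
    exact: smooth_weak_deriv.
  rewrite /sqnormH1_2 (sqnormH1_weak TS (inH1B TS Hp Hv) wk).
  apply: le_trans (_ : B * sqnormH1_1 I (fun x => phi x - u x) +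
      \sum_(k < 2) B * sqnormH1_1 I (fun x => phi x - u x) <= _).
    by apply: lerD; [exact: b1|apply: ler_sum => k _; exact: b2].
  rewrite sumr_const card_ord; move: (sqnormH1_1 _ _) => x.
  by rewrite -mulrS mulrnAl.
pose B' := chi (ymin Q) ^+ 2 + chi (ymax Q) ^+ 2.
have uI t : I t -> (u \_ I) t = u t by move=> It; rewrite patchE mem_set.
have b4 phi s : test_function (V := R^o) I phi ->
    sqnormL2 leb1 (side_dom Q s)
      ((fun z => phi z.1 * chi z.2 - (u \_ I) z.1 * chi z.2) \o side_pt Q s) <=
    B' * sqnormH1_1 I (fun x => phi x - u x).
  move=> [Sp [K [cK KI Kp]]]; have B'0 : 0 <= B' by rewrite addr_ge0 ?sqr_ge0.
  have H0 := sqnormH1_ge0 leb1 I (test_function (V := R^o) I) partial1 (fun x => phi x - u x).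
  case: s => -[] r; rewrite /side_dom /side_pt /=.
    rewrite (@eq_sqnormL2 _ _ _ _ _ _ (fun=> 0)); last first.
      move=> t _ /=; have out : ~ I (if r then xmax Q else xmin Q).
        by case: r; rewrite /= in_itv /= ltxx ?andbF.
      by rewrite Kp; [rewrite patchE memNset// !mul0r subrr|move=> /KI].
    rewrite sqnormL2_def /Rintegral integral0_eq; first exact: mulr_ge0.
    by move=> t _; rewrite expr0n.
  set c := if r then ymax Q else ymin Q.
  have Hp := smooth_inH1_1 xQ Sp; have [Lp _] := Hp.
  have Lpu := L2B (measurable_itvoo _ _) Lp Lu.
  rewrite (@eq_sqnormL2 _ TR R leb1 I _ (fun t => chi c * (phi t - u t))); last first.
    by move=> t It /=; rewrite uI//; ring.
  rewrite (sqnormL2Z (measurable_itvoo _ _) (chi c) Lpu).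
  rewrite ler_pM ?sqr_ge0 ?sqnormL2_ge0//; last exact: sqnormL2_le_H1.
  by rewrite /c /B'; case: (r); rewrite ?lerDl ?lerDr sqr_ge0.
apply/is_traceP => //; split.
  have mu_I : measurable_fun (I : set TR) (u \_ I).
    by case: Lu => mu_u _; apply: (eq_measurable_fun u) => // t /set_mem It; rewrite uI.
  have LuI : L2 leb1 I (u \_ I).
    by apply: (ae_eq_L2 (measurable_itvoo _ _) mu_I _ Lu); apply: aeW => t It; rewrite uI.
  move=> [[] r]; rewrite /side_dom /=.
    exact: (L2Z (measurable_itvoo _ _) ((u \_ I) (if r then xmax Q else xmin Q)) Lc).
  have := L2Z (measurable_itvoo _ _) (chi (if r then ymax Q else ymin Q)) LuI.
  suff -> : (fun x => chi (if r then ymax Q else ymin Q) * (u \_ I) x) =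
    ((fun z => (u \_ I) z.1 * chi z.2) \o side_pt Q (false, r)) by [].
  by apply/funext => t /=; rewrite mulrC.
(* The term [B *+ 3] serves the function and its two derivatives, [B' *+ 4] the four sides, and 1
   makes the sum positive. *)
move=> e e0; pose B3 := B *+ 3 + B' *+ 4 + 1.
have B'0 : 0 <= B' by rewrite addr_ge0 ?sqr_ge0.
have B30 : 0 < B3 by rewrite ltr_wpDl// addr_ge0// mulrn_wge0.
have [phi tp pu] := app _ (divr_gt0 e0 B30).
have H0 := sqnormH1_ge0 leb1 I (test_function (V := R^o) I) partial1 (fun x => phi x - u x).
have B3e : B3 * sqnormH1_1 I (fun x => phi x - u x) <= e.
  apply: le_trans (ler_wpM2l (ltW B30) pu) _.
  by rewrite mulrC divfK// gt_eqF.
exists (fun z => phi z.1 * chi z.2); split; first exact: smooth_tensor tp.1 Sc.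
  apply: le_trans (b3 _ tp) (le_trans _ B3e); apply: ler_wpM2r => //.
  by rewrite /B3 -addrA lerDl addr_ge0// mulrn_wge0.
apply: le_trans (_ : \sum_(s : bool * bool) B' * sqnormH1_1 I (fun x => phi x - u x) <= _).
  by apply: ler_sum => s _; exact: b4.
rewrite sumr_const card_prod card_bool -mulrnAl; apply: le_trans B3e; apply: ler_wpM2r => //.
by rewrite /B3 addrAC lerDr addr_ge0// mulrn_wge0.
Qed.

End Extension.

(** * The Riesz representation theorem for a semi-inner product *)

Section Riesz.
Context {R : realType} {E : Type}.
(* [lc c u v] stands for [c u + v]; there is no vector space structure on [E]
   because its laws hold only up to almost everywhere equality on [Velt]. *)
Variables (lc : R -> E -> E -> E) (K : set E) (a : E -> E -> R) (F : E -> R).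
Variable C : R.
Hypothesis K_neq0 : K !=set0.
Hypothesis K_lc : forall c u v, K u -> K v -> K (lc c u v).
Hypothesis aC : forall u v, a u v = a v u.
Hypothesis a_lin : forall c u v w, K u -> K v -> K w ->
  a (lc c u v) w = c * a u w + a v w.
Hypothesis a_ge0 : forall u, K u -> 0 <= a u u.
Hypothesis F_lin : forall c u v, K u -> K v -> F (lc c u v) = c * F u + F v.
Hypothesis C_gt0 : 0 < C.
Hypothesis F_bounded : forall u, K u -> F u ^+ 2 <= C * a u u.
Hypothesis K_complete : forall (x : nat -> E) (M : R), (forall n, K (x n)) ->
  (forall n m, (n <= m)%N ->
    a (lc (-1) (x m) (x n)) (lc (-1) (x m) (x n)) <= M / 8 ^+ n) ->
  exists u M', K u /\
    forall n, a (lc (-1) u (x n)) (lc (-1) u (x n)) <= M' / 8 ^+ n.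

Let sq_lc c u v : K u -> K v ->
  a (lc c u v) (lc c u v) = c ^+ 2 * a u u + c *+ 2 * a u v + a v v.
Proof.
move=> Ku Kv; have Kl := K_lc c Ku Kv.
rewrite a_lin// (aC u) (aC v) !a_lin// (aC v u); ring.
Qed.

Let cauchy_schwarz u v : K u -> K v -> a u v ^+ 2 <= a u u * a v v.
Proof.
move=> Ku Kv; apply: quadratic_discriminant; [exact: a_ge0|exact: a_ge0|].
by move=> c; rewrite -sq_lc//; apply: a_ge0; exact: K_lc.
Qed.

Let J u := a u u - 2 * F u.

(** Since [a u u >= F u ^+ 2 / C], it suffices to complete the square:
    [F^2 / C - 2 F = (F - C)^2 / C - C]. *)
Let J_ge u : K u -> - C <= J u.
Proof.
move=> Ku; have h1 := F_bounded Ku; rewrite /J.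
have : F u ^+ 2 / C <= a u u by rewrite ler_pdivrMr// mulrC.
have : 0 <= (F u - C) ^+ 2 / C by rewrite mulr_ge0 ?sqr_ge0 ?invr_ge0 ?ltW.
have -> : (F u - C) ^+ 2 / C = F u ^+ 2 / C - 2 * F u + C by field; rewrite gt_eqF.
by lra.
Qed.

Let J_lc t u v : K u -> K v ->
  J (lc t v u) = J u + (t ^+ 2 * a v v + t *+ 2 * (a v u - F v)).
Proof. by move=> Ku Kv; rewrite /J sq_lc// F_lin//; ring. Qed.

(** The representative minimises the energy [J]. Near-minimisers are fast Cauchy by the
    parallelogram identity, and a discriminant turns near-minimality into closeness of [a v (x n)]
    and [F v]. *)
Lemma riesz_representation : exists2 u, K u & forall v, K v -> a u v = F v.
Proof.
pose S := [set J u | u in K].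
have S0 : S !=set0 by have [z Kz] := K_neq0; exists (J z), z.
have Slb : has_lbound S by exists (- C) => _ [u Ku <-]; exact: J_ge.
have infS u : K u -> inf S <= J u by move=> Ku; apply: ge_inf => //; exists u.
have p8 (n : nat) : 0 < 1 / 8 ^+ n :> R by rewrite divr_gt0 ?exprn_gt0.
have /choice[x xP] (n : nat) : exists x, K x /\ J x <= inf S + 1 / 8 ^+ n.
  have [//|_ [u Ku <-] ul] := @inf_adherent _ S _ (p8 n); exists u; split => //.
  exact: ltW.
have Kx n : K (x n) by have [] := xP n.
have [|u [M' [Ku uM]]] := K_complete (M := 4) Kx.
  move=> n m nm; set d := lc _ _ _.
  have Kd : K d by exact: K_lc.
  (* As [d] is [x n - x m], this combination is the midpoint of [x n] and [x m]. *)
  have := infS _ (K_lc 2^-1 Kd (Kx m)).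
  have h1 := (xP n).2; have h2 := (xP m).2.
  have h3 : 1 / 8 ^+ m <= 1 / 8 ^+ n :> R.
    by rewrite !mul1r lef_pV2 ?posrE ?exprn_gt0// ler_eXn2l// ltr1n.
  (* The parallelogram identity; both energies are within [1 / 8 ^+ n] of the infimum and the
     midpoint is not below it, which gives the constant 4. *)
  have -> : a d d = 2 * (J (x n) + J (x m) - 2 * J (lc 2^-1 d (x m))).
    have Ed := sq_lc (-1) (Kx m) (Kx n); have Ef := F_lin (-1) (Kx m) (Kx n).
    have Em := a_lin (-1) (Kx m) (Kx n) (Kx m).
    rewrite (J_lc _ (Kx m) Kd) /J; rewrite -/d in Ed Ef Em.
    rewrite Em Ef Ed (aC (x n) (x m)).
    move: (a (x m) (x m)) (a (x m) (x n)) (a (x n) (x n)) (F (x m)) (F (x n)).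
    by move=> p q r s t; field.
  rewrite -[4]/(4%:R) (_ : 4 / 8 ^+ n = 4 * (1 / 8 ^+ n)); last by rewrite mul1r.
  move: (1 / 8 ^+ n) (1 / 8 ^+ m) (J _) (J _) (J _) (inf S) h1 h2 h3.
  by move=> p q r s t i; lra.
exists u => // v Kv; apply/eqP; rewrite -subr_eq0 -sqrf_eq0 eq_le sqr_ge0 andbT.
apply/ler_addgt0Pr => e e0; rewrite add0r.
have av := a_ge0 Kv.
have [n Cn] := @pow8_small R (2 * (a v v * 1 + M' * a v v)) e e0.
apply: le_trans Cn.
(* For every [t], moving from [x n] by [t v] lowers [J] by at most [1 / 8 ^+ n]; the discriminant of
   this quadratic in [t] is the claim. *)
have B : (a v (x n) - F v) ^+ 2 <= a v v * (1 / 8 ^+ n).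
  apply: (quadratic_discriminant av (ltW (p8 n))).
  move=> t; have := infS _ (K_lc t Kv (Kx n)); rewrite J_lc//.
  have := (xP n).2; lra.
have D : a (lc (-1) u (x n)) v ^+ 2 <= M' / 8 ^+ n * a v v.
  apply: le_trans (cauchy_schwarz (K_lc (-1) Ku (Kx n)) Kv) _.
  by rewrite ler_wpM2r.
rewrite a_lin// (aC (x n)) in D.
have -> : 2 * (a v v * 1 + M' * a v v) / 8 ^+ n =
    2 * (a v v * (1 / 8 ^+ n)) + 2 * (M' / 8 ^+ n * a v v).
  by move: (8 ^+ n)^-1 => t; ring.
move: B D; move: (a v v * _) (_ * a v v) (a v (x n)) (a u v) (F v).
move=> p q r s t h1 h2.
have -> : s - t = (r - t) - (-1 * s + r) by ring.
move: (r - t) (-1 * s + r) h1 h2 => A B0 h1 h2.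
have := sqr_ge0 (A + B0); rewrite sqrrD sqrrB.
by lra.
Qed.

End Riesz.

(** * Geometry of the domain and lifting of interface data *)

Section Geometry.
Context {R : realType}.

Lemma itv_approx (a b x e : R) : a < b -> a <= x <= b -> 0 < e ->
  exists y, a < y < b /\ `|x - y| < e.
Proof.
move=> ab /andP[ax xb] e0.
(* [x] is moved towards the midpoint by the fraction [t]: positivity of [t] makes the new point
   interior, and the displacement is less than [t * (b - a) <= e]. *)
pose t := Num.min (2^-1) (e / (b - a)).
have ba : 0 < b - a by rewrite subr_gt0.
have t0 : 0 < t by rewrite lt_min invr_gt0 ltr0n divr_gt0.
have t1 : t <= 2^-1 by rewrite ge_min lexx.
have te : t * (b - a) <= e by rewrite -ler_pdivlMr// ge_min lexx orbT.
exists (x + t * ((a + b) / 2 - x)); split.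
  have h1 : 0 <= (1 - t) * (x - a) by apply: mulr_ge0; lra.
  have h2 : 0 <= (1 - t) * (b - x) by apply: mulr_ge0; lra.
  have h3 : 0 < t * (b - a) by exact: mulr_gt0.
  by apply/andP; split; nra.
rewrite opprD addrA subrr add0r normrN normrM (gtr0_norm t0).
apply: lt_le_trans te; rewrite ltr_pM2l// ltr_norml; apply/andP; split; lra.
Qed.

Lemma closure_rect (a b c e : R) (z : R * R) : a < b -> c < e ->
  a <= z.1 <= b -> c <= z.2 <= e ->
  closure (`]a, b[%classic `*` `]c, e[%classic) z.
Proof.
case: z => x y /= ab ce xab yce B /nbhs_ballP[r /= r0 rB].
have [x' [x'ab xx']] := itv_approx ab xab r0.
have [y' [y'ce yy']] := itv_approx ce yce r0.
exists (x', y'); split; first by split; rewrite /= in_itv.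
by apply: rB; split.
Qed.

Lemma bdry_rect (a b c e : R) (z : R * R) : a < b -> c < e ->
  a <= z.1 <= b -> c <= z.2 <= e -> ~ (`]a, b[%classic `*` `]c, e[%classic) z ->
  bdry (`]a, b[%classic `*` `]c, e[%classic) z.
Proof.
move=> ab ce zx zy nz; split; first exact: closure_rect.
by move=> /interior_subset.
Qed.

Lemma interior_rect (a b c e : R) (z : R * R) :
  (`]a, b[%classic `*` `]c, e[%classic) z ->
  interior (`]a, b[%classic `*` `]c, e[%classic) z.
Proof.
case: z => x y [/= xab yce].
exists (`]a, b[%classic, `]c, e[%classic) => //=; split => /=.
  by apply: open_nbhs_nbhs; split => //; exact: interval_open.
by apply: open_nbhs_nbhs; split => //; exact: interval_open.
Qed.

Variables (L l : R).
Hypothesis L0 : 0 < L.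
Hypothesis l0 : 0 < l.
Implicit Type i : 'I_2.

Lemma OmegaQ_xmin i : xmin (OmegaQ L l i) = 0.
Proof. by rewrite /OmegaQ; case: ifP. Qed.

Lemma OmegaQ_xmax i : xmax (OmegaQ L l i) = L.
Proof. by rewrite /OmegaQ; case: ifP. Qed.

Lemma OmegaQ_x i : xmin (OmegaQ L l i) < xmax (OmegaQ L l i).
Proof. by rewrite OmegaQ_xmin OmegaQ_xmax. Qed.

Lemma OmegaQ_y i : ymin (OmegaQ L l i) < ymax (OmegaQ L l i).
Proof.
have l2 : 0 < l / 2 by rewrite divr_gt0.
by rewrite /OmegaQ; case: ifP => _ //=; rewrite oppr_lt0.
Qed.

Lemma OmegaQ_bounds i y : ymin (OmegaQ L l i) <= y <= ymax (OmegaQ L l i) ->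
  - (l / 2) <= y <= l / 2.
Proof.
have l2 : 0 < l / 2 by rewrite divr_gt0.
rewrite /OmegaQ; case: ifP => _ /= /andP[h1 h2]; apply/andP; split=> //.
  by apply: le_trans h1; rewrite oppr_le0 ltW.
exact: le_trans h2 (ltW l2).
Qed.

(* The interface is the bottom side of Omega_1 and the top side of Omega_2. *)
Definition gam_side i : bool * bool := (false, i != 0).

Lemma gam_side_pt i (t : R) : side_pt (OmegaQ L l i) (gam_side i) t = (t, 0).
Proof. by rewrite /side_pt /gam_side /OmegaQ /=; case: eqVneq. Qed.

Lemma gam_side_dom i : side_dom (OmegaQ L l i) (gam_side i) = gam L.
Proof. by rewrite /side_dom /gam_side /= OmegaQ_xmin OmegaQ_xmax. Qed.

Lemma opposite_side_y i (r : bool) : r != (i != 0) ->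
  `|if r then ymax (OmegaQ L l i) else ymin (OmegaQ L l i)| = l / 2.
Proof.
have l2 : `|l / 2| = l / 2 by rewrite ger0_norm// divr_ge0// ltW.
by rewrite /OmegaQ; case: (i == 0); case: r => //= _; rewrite ?normrN.
Qed.

Variables (GD GN : set (R * R)).
Hypothesis bdryP : admissible_bdry L l GD GN.

(** The ends of the interface belong to its closure, which misses the closure of the Neumann part,
    so near them the vertical sides can only be Dirichlet. The bound [r <= l / 2] makes a cutoff of
    radius [r] vanish on the horizontal side opposite to the interface. *)
Lemma vertical_in_GD i : exists r, [/\ 0 < r, r <= l / 2 & forall (right : bool) y,
  ymin (OmegaQ L l i) < y < ymax (OmegaQ L l i) -> `|y| < r ->
  Gammai L l GD i (if right then L else 0, y)].
Proof.
have [bE _ _ /(_ i) GNi] := bdryP.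
have corner (right : bool) : exists r, 0 < r /\ forall y, `|y| < r ->
    ~ Gammai L l GN i (if right then L else 0, y).
  pose p : R * R := (if right then L else 0, 0).
  have clp : closure (gam2 L) p.
    move=> B /nbhs_ballP[r /= r0 rB].
    have [|x [x0L xr]] := @itv_approx 0 L (if right then L else 0) r L0 _ r0.
      by case: right {p rB}; rewrite lexx (ltW L0).
    exists (x, 0); split; first by exists x => //; rewrite /gam /= in_itv.
    by apply: rB; split => //=; exact: ballxx.
  have : ~ closure (Gammai L l GN i) p.
    by move=> h; have : set0 p by rewrite -GNi.
  move=> /existsNP[B /not_implyP[/nbhs_ballP[r /= r0 rB] nB]].
  exists r; split => // y yr Gy; apply: nB; exists (if right then L else 0, y).
  split => //; apply: rB; split => /=; first exact: ballxx.
  by rewrite /ball /= sub0r normrN.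
have [r1 [r10 h1]] := corner true; have [r2 [r20 h2]] := corner false.
exists (Num.min (l / 2) (Num.min r1 r2)); split.
- by rewrite !lt_min r10 r20 divr_gt0.
- by rewrite ge_min lexx.
move=> right y yi; rewrite !lt_min => /and3P[_ yr1 yr2].
have [x0L nx] : (0 <= (if right then L else 0) <= L) /\
    ~ (`]0, L[%classic : set R) (if right then L else 0).
  by case: right => /=; rewrite in_itv /= !ltxx ?andbF lexx (ltW L0).
have yi' : ymin (OmegaQ L l i) <= y <= ymax (OmegaQ L l i).
  by case/andP: yi => /ltW -> /ltW ->.
have bi : bdry (Omegai L l i) (if right then L else 0, y).
  apply: bdry_rect => /=; [exact: OmegaQ_x|exact: OmegaQ_y| |by []|].
    by rewrite OmegaQ_xmin OmegaQ_xmax.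
  by move=> []; rewrite OmegaQ_xmin OmegaQ_xmax.
split => //.
have : bdry (Omega L l) (if right then L else 0, y).
  have l2 : 0 < l / 2 by rewrite divr_gt0.
  apply: bdry_rect => /=; [by []|lra|by []|exact: OmegaQ_bounds yi'|].
  by move=> [].
rewrite bE => -[//|Gy]; exfalso.
by case: right {x0L nx} bi Gy => bi Gy; [exact: (h1 y yr1)|exact: (h2 y yr2)].
Qed.

(** The open interface is interior to [Omega], while [GD] lies on its boundary. *)
Lemma Gammai_sub i : Gammai L l GD i `<=` bdry (Omegai L l i) `\` gam2 L.
Proof.
move=> z [bz Gz]; split => // -[x x0L xz].
have [bE _ _ _] := bdryP.
have : bdry (Omega L l) z by rewrite bE; left.
move=> [_]; apply; rewrite -xz; apply: interior_rect; split => //=.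
have l2 : 0 < l / 2 by rewrite divr_gt0.
by rewrite in_itv /= l2 oppr_lt0 l2.
Qed.

Lemma inW_inH1_0 i v : inW L l i v -> inH1_0 (OmegaQ L l i) (Gammai L l GD i) v.
Proof.
move=> [Hv [g vg g0]]; split => //; exists g => // s.
move: (g0 s); apply: aeS => t h Dt Gt; apply: h => //; exact: Gammai_sub.
Qed.

End Geometry.

(** * Traces on the interface and membership of the jumps *)

Section InterfaceTraces.
Context {R : realType}.
Local Notation TR := (measurableTypeR R).
Variables (L l : R).
Hypothesis L0 : 0 < L.
Hypothesis l0 : 0 < l.
Implicit Type i : 'I_2.

Lemma measurable_gam : measurable (gam L : set TR).
Proof. exact: measurable_itvoo. Qed.

Lemma inH1_0_is_trace Q G (v : R * R -> R) : inH1_0 Q G v -> is_trace Q v (trace Q v).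
Proof. by move=> [_ [g vg _]]; exact: trace_is_trace vg. Qed.

Lemma trace_gam_ae i v g : inH1 leb2 (rect_set (OmegaQ L l i))
    (test_function (rect_set (OmegaQ L l i))) partial v ->
  is_trace (OmegaQ L l i) v g ->
  ae_eq leb1 (gam L) (trace_gam L l i v) (fun x => g (x, 0)).
Proof.
move=> Hv vg; have vt := trace_is_trace vg.
have := is_trace_unique (OmegaQ_x l L0 i) (OmegaQ_y L l0 i) (gam_side i) Hv vt vg.
rewrite gam_side_dom; apply: aeS => x h Dx.
by have := h Dx; rewrite /= gam_side_pt.
Qed.

Lemma L2_trace_gam i G v : inH1_0 (OmegaQ L l i) G v ->
  L2 leb1 (gam L) (trace_gam L l i v).
Proof.
move=> /inH1_0_is_trace/is_trace_L2 /(_ (gam_side i)); rewrite gam_side_dom.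
suff -> : trace (OmegaQ L l i) v \o side_pt (OmegaQ L l i) (gam_side i) =
  trace_gam L l i v by [].
by apply/funext => x; rewrite /= gam_side_pt.
Qed.

Lemma trace_gam_lin i G (c : R) v w : inH1_0 (OmegaQ L l i) G v ->
  inH1_0 (OmegaQ L l i) G w ->
  ae_eq leb1 (gam L) (trace_gam L l i (fun z => c * v z + w z))
    (fun x => c * trace_gam L l i v x + trace_gam L l i w x).
Proof.
move=> Hv Hw; have [[Hv' _] [Hw' _]] := (Hv, Hw).
have T := is_trace_lin (OmegaQ_x l L0 i) (OmegaQ_y L l0 i) c Hv' Hw'
  (inH1_0_is_trace Hv) (inH1_0_is_trace Hw).
exact: (trace_gam_ae (inH1_lin (rect_test_space _) c Hv' Hw') T).
Qed.

Lemma trace_gam_bound_sub i G v w : inH1_0 (OmegaQ L l i) G v ->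
  inH1_0 (OmegaQ L l i) G w ->
  sqnormL2 leb1 (gam L) (fun x => trace_gam L l i v x - trace_gam L l i w x) <=
  bdryK (OmegaQ L l i) *+ 4 * sqnormH1_2 (Omegai L l i) (fun z => v z - w z).
Proof.
move=> Hv Hw; have [[Hv' _] [Hw' _]] := (Hv, Hw).
apply: le_trans (is_trace_bound_sub (OmegaQ_x l L0 i) (OmegaQ_y L l0 i) Hv' Hw'
  (inH1_0_is_trace Hv) (inH1_0_is_trace Hw)).
have := sqnorm_side_le (OmegaQ L l i)
  (fun z => trace (OmegaQ L l i) v z - trace (OmegaQ L l i) w z) (gam_side i).
rewrite gam_side_dom; apply: le_trans; rewrite le_eqVlt; apply/orP; left; apply/eqP.
by apply: eq_sqnormL2 => x _; rewrite /= gam_side_pt.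
Qed.

Lemma trace_gam0 i : ae_eq leb1 (gam L) (trace_gam L l i (fun=> 0)) (fun=> 0).
Proof.
have S0 : smooth (fun=> 0 : R) (V := (R * R)%type) by exact: smooth_cst.
exact: (trace_gam_ae (smooth_inH1 (OmegaQ_x l L0 i) (OmegaQ_y L l0 i) S0)
  (smooth_trace (OmegaQ_x l L0 i) (OmegaQ_y L l0 i) S0)).
Qed.

Lemma inW0 i : inW L l i (fun=> 0).
Proof. exact: (inH1_0_zero (OmegaQ_x l L0 i) (OmegaQ_y L l0 i)). Qed.

Lemma ae0_inH00 i sigma : ae_eq leb1 (gam L) sigma (fun=> 0) -> inH00 L l i sigma.
Proof.
move=> s0; exists (fun=> 0); first exact: inW0.
by move: (trace_gam0 i) s0; apply: aeS2 => x h1 h2 Dx; rewrite h1// h2.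
Qed.

Lemma trace_gam_inH00 i v : inW L l i v -> inH00 L l i (trace_gam L l i v).
Proof. by move=> Wv; exists v => //; exact: aeW. Qed.

Variables (GD GN : set (R * R)).
Hypothesis bdryP : admissible_bdry L l GD GN.

(* Multiplying by a cutoff in [y] makes both the bulk function and the extension
   of the interface function vanish on the boundary away from the interface. *)
Lemma jump_inH00 i u : inV L l GD u ->
  inH00 L l i (fun x => trace_gam L l i (bulk u i) x - intf u x).
Proof.
move=> [/(_ i) Hu Hg]; have [r [r0 rl rGD]] := vertical_in_GD L0 l0 bdryP i.
set Q := OmegaQ L l i in Hu *.
have xQ : xmin Q < xmax Q by exact: OmegaQ_x.
have yQ : ymin Q < ymax Q by exact: OmegaQ_y.
have Sc := smooth_cutoff r.
have [Hui [g ug g0]] := Hu.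
have [H1 T1] := is_trace_mul xQ yQ (smooth_snd Sc) Hui ug.
have Hg' : inH10_1 `]xmin Q, xmax Q[%classic (intf u).
  by rewrite OmegaQ_xmin OmegaQ_xmax.
have [H2 T2] := tensor_extension xQ yQ Hg' Sc.
have H3 := inH1_lin (rect_test_space Q) (-1) H2 H1.
have T3 := is_trace_lin xQ yQ (-1) H2 H1 T2 T1.
exists (fun z => (-1) * (intf u z.1 * cutoff r z.2) + cutoff r z.2 * bulk u i z).
  split => //; eexists; first exact: T3.
  move=> s; move: (g0 s); apply: aeS => t gt Dt [bt nt].
  (* On a vertical side the interface part is zero, being evaluated at an end of the interval, and
     the bulk part is zero by the cutoff if [r <= |t|] and by the Dirichlet condition otherwise. The
     interface itself is excluded, and on the opposite side the cutoff vanishes. *)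
  case: s Dt bt nt gt => -[] right.
    rewrite /side_dom /side_pt /= OmegaQ_xmin OmegaQ_xmax => Dt _ _ gt.
    have -> : (intf u \_ `]0, L[%classic) (if right then L else 0) = 0.
      by rewrite patchE memNset//; case: (right); rewrite /= in_itv /= ltxx ?andbF.
    rewrite mul0r mulr0 add0r; have [tr|tr] := leP r `|t|.
      by rewrite cutoff_out// mul0r.
    by rewrite gt ?mulr0//; exact: rGD.
  have [->|rt] := eqVneq right (i != 0).
    by rewrite -/(gam_side i) gam_side_dom gam_side_pt => Dt _ []; exists t.
  move=> Dt _ _ _; rewrite /side_pt /=.
  have := opposite_side_y L l0 rt; rewrite -/Q; set y := if _ then _ else _ => yl.
  by rewrite cutoff_out ?yl// mulr0 mulr0 mul0r addr0.
have := trace_gam_ae H3 T3; have := trace_gam_ae Hui ug.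
apply: aeS2 => x gx tx Dx; rewrite tx// gx//= cutoff0// mulr1 mul1r.
by rewrite OmegaQ_xmin OmegaQ_xmax patchE mem_set// mulN1r addrC.
Qed.

End InterfaceTraces.

(** * The product space and the bilinear forms *)

Section LinearCombinations.
Context {R : realType}.
Implicit Types u v w : Velt (R := R).

Definition lcV (c : R) u v : Velt :=
  MkV (fun i z => c * bulk u i z + bulk v i z) (fun x => c * intf u x + intf v x).

Lemma lcV0 : lcV (-1) zeroV zeroV = zeroV.
Proof.
rewrite /lcV /zeroV /=; congr MkV.
  by apply/funext => i; apply/funext => z; rewrite mulr0 addr0.
by apply/funext => x; rewrite mulr0 addr0.
Qed.

Lemma Rintegral_sum_dotL2 d (T : measurableType d) (mu : {measure set T -> \bar R})
    (D : set T) (c : R) n (f g : 'I_n -> T -> R) : measurable D ->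
  (forall k, L2 mu D (f k)) -> (forall k, L2 mu D (g k)) ->
  Rintegral mu D (fun z => c * \sum_k f k z * g k z) =
  c * \sum_k dotL2 mu D (f k) (g k).
Proof.
move=> mD Lf Lg.
have fgI k : mu.-integrable D (EFin \o (fun z => f k z * g k z)) by exact: L2_mul.
suff [I E] : mu.-integrable D (EFin \o (fun z => \sum_k f k z * g k z)) /\
    Rintegral mu D (fun z => \sum_k f k z * g k z) = \sum_k dotL2 mu D (f k) (g k).
  by rewrite RintegralZl// E.
elim: n f g {Lf Lg} fgI => [|n IH] f g fgI.
  split; last by rewrite big_ord0; under eq_Rintegral do rewrite big_ord0;
    rewrite Rintegral_cst// mul0r.
  apply: (eq_integrable mD (EFin \o (fun=> 0 : R))); last exact: integrable0.
  by move=> x _ /=; rewrite big_ord0.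
have [I E] := IH (fun k => f (widen_ord (leqnSn n) k))
  (fun k => g (widen_ord (leqnSn n) k)) (fun k => fgI _).
have SE z : \sum_(k < n.+1) f k z * g k z =
    \sum_(k < n) f (widen_ord (leqnSn n) k) z * g (widen_ord (leqnSn n) k) z +
    f ord_max z * g ord_max z by rewrite big_ord_recr.
split.
  apply: (eq_integrable mD _ _ _ (integrableD mD I (fgI ord_max))) => z _ /=.
  by rewrite SE EFinD.
by under eq_Rintegral do rewrite SE; rewrite RintegralD// E big_ord_recr dotL2_def.
Qed.

Lemma weighted_sum_lin n (c e p q h f g : R) (H F G : 'I_n -> R) :
  (forall i, H i = c * F i + G i) -> h = c * f + g ->
  \sum_i e * H i + p * (q * h) =
  c * (\sum_i e * F i + p * (q * f)) + (\sum_i e * G i + p * (q * g)).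
Proof.
move=> HE ->; under eq_bigr do rewrite HE mulrDr mulrCA.
by rewrite big_split /= -!mulr_sumr; ring.
Qed.

End LinearCombinations.

(** * The space V, its norm and the form a *)

Section ProductSpace.
Context {R : realType}.
Variables (L l : R) (GD : set (R * R)).
Hypothesis L0 : 0 < L.
Hypothesis l0 : 0 < l.
Implicit Types (i : 'I_2) (u v w : Velt (R := R)).
Local Notation inV := (inV L l GD).
Local Notation iH2 i := (inH1 leb2 (Omegai L l i) (test_function (Omegai L l i)) partial).
Local Notation iH1 := (inH1 leb1 (gam L) (test_function (V := R^o) (gam L)) partial1).
Let xQ i := OmegaQ_x l L0 i.
Let yQ i := OmegaQ_y L l0 i.

Lemma inV_bulk u : inV u -> forall i, iH2 i (bulk u i).
Proof. by move=> [h _] i; have [] := h i. Qed.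

Lemma inV_intf u : inV u -> iH1 (intf u).
Proof. by move=> [_ [/inH1_1E]]. Qed.

Lemma inV_lc c u v : inV u -> inV v -> inV (lcV c u v).
Proof.
move=> [u1 u2] [v1 v2]; split; last exact: (inH10_1_lin L0 c u2 v2).
by move=> i; exact: (inH1_0_lin (xQ i) (yQ i) c (u1 i) (v1 i)).
Qed.

Definition sqnormV u : R :=
  \sum_(i < 2) sqnormH1_2 (Omegai L l i) (bulk u i) + sqnormH1_1 (gam L) (intf u).

Lemma sqnormV_bulk_le u i : sqnormH1_2 (Omegai L l i) (bulk u i) <= sqnormV u.
Proof.
apply: le_trans (ler_sum_term (fun i => sqnormH1_ge0 _ _ _ _ _) i) _.
by rewrite lerDl sqnormH1_ge0.
Qed.

Lemma sqnormV_intf_le u : sqnormH1_1 (gam L) (intf u) <= sqnormV u.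
Proof. by rewrite lerDr sumr_ge0// => i _; exact: sqnormH1_ge0. Qed.

Lemma sqnormV_ge0 u : 0 <= sqnormV u.
Proof. by apply: le_trans (sqnormV_intf_le u); exact: sqnormH1_ge0. Qed.

Lemma normVE u : normV L l u = Num.sqrt (sqnormV u).
Proof.
rewrite /normV /sqnormV normH1_1_sqr; congr (Num.sqrt (_ + _)).
by apply: eq_bigr => i _; rewrite normH1_2_sqr.
Qed.

Lemma normV_sqr u : normV L l u ^+ 2 = sqnormV u.
Proof. by rewrite normVE sqr_sqrtr// sqnormV_ge0. Qed.

Lemma normV_ge0 u : 0 <= normV L l u.
Proof. exact: sqrtr_ge0. Qed.

Lemma normV_opp u : inV u -> normV L l (lcV (-1) u zeroV) = normV L l u.
Proof.
move=> Vu; rewrite !normVE /sqnormV.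
have B i : sqnormH1_2 (Omegai L l i) (bulk (lcV (-1) u zeroV) i) =
    sqnormH1_2 (Omegai L l i) (bulk u i).
  have -> : bulk (lcV (-1) u zeroV) i = (fun z => -1 * bulk u i z).
    by apply/funext => z /=; rewrite addr0.
  have := sqnormH1Z (rect_test_space _) (-1) (inV_bulk Vu i).
  by rewrite sqrrN expr1n mul1r.
have -> : sqnormH1_1 (gam L) (intf (lcV (-1) u zeroV)) = sqnormH1_1 (gam L) (intf u).
  have -> : intf (lcV (-1) u zeroV) = (fun x => -1 * intf u x).
    by apply/funext => x /=; rewrite addr0.
  have := sqnormH1Z (itv_test_space _ _) (-1) (inV_intf Vu).
  by rewrite sqrrN expr1n mul1r.
apply: (congr1 (fun s => Num.sqrt (s + sqnormH1_1 (gam L) (intf u)))).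
by apply: eq_bigr => i _; exact: B.
Qed.

Lemma inV_zero : inV zeroV.
Proof.
split=> [i|]; first exact: (inH1_0_zero (xQ i) (yQ i)).
exact: (inH10_1_zero 0 L).
Qed.

Lemma sqnormV_sub0 u v : inV u -> inV v -> sqnormV (lcV (-1) u v) = 0 -> eqV L l v u.
Proof.
move=> Vu Vv N0; have Vw := inV_lc (-1) Vu Vv; split=> [i|].
  have : sqnormH1_2 (Omegai L l i) (bulk (lcV (-1) u v) i) = 0.
    by apply/eqP; rewrite eq_le -{1}N0 sqnormV_bulk_le sqnormH1_ge0.
  move=> /(sqnormH1_eq0 (rect_test_space _) (inV_bulk Vw i)); apply: aeS => z h Dz.
  by have := h Dz; rewrite /= mulN1r addrC => /eqP; rewrite subr_eq0 => /eqP.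
have : sqnormH1_1 (gam L) (intf (lcV (-1) u v)) = 0.
  by apply/eqP; rewrite eq_le -{1}N0 sqnormV_intf_le sqnormH1_ge0.
move=> /(sqnormH1_eq0 (itv_test_space _ _) (inV_intf Vw)); apply: aeS => z h Dz.
by have := h Dz; rewrite /= mulN1r addrC => /eqP; rewrite subr_eq0 => /eqP.
Qed.

Variables (d eox ech : R).
Local Notation a := (form_a L l d eox ech).

Lemma form_aC u v : a u v = a v u.
Proof.
rewrite /form_a; apply: (f_equal2 (fun s t => s + d * t)).
  apply: eq_bigr => i _; apply: eq_Rintegral => z _; congr (_ * _).
  by apply: eq_bigr => k _; rewrite mulrC.
by apply: eq_Rintegral => x _; rewrite mulrAC.
Qed.

(** Membership in V makes the weak gradients square integrable, so the integrals split into L^2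
    products, whose bilinearity is available. *)
Lemma form_aE u v : inV u -> inV v -> a u v =
  \sum_i eox * \sum_k dotL2 leb2 (Omegai L l i)
     (wpartial (Omegai L l i) k (bulk u i)) (wpartial (Omegai L l i) k (bulk v i)) +
  d * (ech * dotL2 leb1 (gam L) (wderiv (gam L) (intf u)) (wderiv (gam L) (intf v))).
Proof.
move=> Vu Vv; rewrite /form_a; apply: (f_equal2 (fun s t => s + d * t)).
  apply: eq_bigr => i _; apply: Rintegral_sum_dotL2; first exact: measurable_rect.
    by move=> k; rewrite wpartialE; exact: (L2_wgrad k (inV_bulk Vu i)).
  by move=> k; rewrite wpartialE; exact: (L2_wgrad k (inV_bulk Vv i)).
rewrite dotL2_def -RintegralZl; first by apply: eq_Rintegral => x _; rewrite mulrA.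
  exact: measurable_gam.
rewrite !(wderivE _ ord0); apply: (L2_mul (measurable_gam L)).
  exact: (L2_wgrad ord0 (inV_intf Vu)).
exact: (L2_wgrad ord0 (inV_intf Vv)).
Qed.

Lemma form_a_lc c u v w : inV u -> inV v -> inV w ->
  a (lcV c u v) w = c * a u w + a v w.
Proof.
move=> Vu Vv Vw.
rewrite (form_aE (inV_lc c Vu Vv) Vw) (form_aE Vu Vw) (form_aE Vv Vw).
have B i : \sum_k dotL2 leb2 (Omegai L l i)
     (wpartial (Omegai L l i) k (bulk (lcV c u v) i)) (wpartial (Omegai L l i) k (bulk w i)) =
   c * \sum_k dotL2 leb2 (Omegai L l i)
     (wpartial (Omegai L l i) k (bulk u i)) (wpartial (Omegai L l i) k (bulk w i)) +
   \sum_k dotL2 leb2 (Omegai L l i)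
     (wpartial (Omegai L l i) k (bulk v i)) (wpartial (Omegai L l i) k (bulk w i)).
  rewrite mulr_sumr -big_split; apply: eq_bigr => k _ /=; rewrite !wpartialE.
  exact: (dotL2_wgrad_linl (rect_test_space _) k c (inV_bulk Vu i) (inV_bulk Vv i)
    (inV_bulk Vw i)).
have I : dotL2 leb1 (gam L) (wderiv (gam L) (intf (lcV c u v))) (wderiv (gam L) (intf w)) =
    c * dotL2 leb1 (gam L) (wderiv (gam L) (intf u)) (wderiv (gam L) (intf w)) +
    dotL2 leb1 (gam L) (wderiv (gam L) (intf v)) (wderiv (gam L) (intf w)).
  rewrite !(wderivE _ ord0).
  exact: (dotL2_wgrad_linl (itv_test_space 0 L) ord0 c (inV_intf Vu) (inV_intf Vv)
    (inV_intf Vw)).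
exact: (weighted_sum_lin eox d ech B I).
Qed.

Lemma form_a0 w : inV w -> a zeroV w = 0.
Proof.
move=> Vw; have := form_a_lc (-1) inV_zero inV_zero Vw.
by rewrite lcV0 mulN1r addNr.
Qed.

Variable alpha1 : R.
Hypothesis a_cont : continuity_constant L l GD d eox ech alpha1.

(** The continuity constant bounds [a] from above only; the lower bound comes from applying it to
    [- u], encoded as [lcV (-1) u zeroV]. *)
Lemma form_a_le u v : inV u -> inV v ->
  `|a u v| <= alpha1 * normV L l u * normV L l v.
Proof.
move=> Vu Vv; rewrite ler_norml (a_cont Vu Vv) andbT lerNl.
have := a_cont (inV_lc (-1) Vu inV_zero) Vv.
by rewrite (form_a_lc (-1) Vu inV_zero Vv) (form_a0 Vv) mulN1r addr0 normV_opp.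
Qed.

Lemma form_a_sqnorm_le u : inV u -> a u u <= alpha1 * sqnormV u.
Proof. by move=> Vu; rewrite -normV_sqr expr2 mulrA; exact: (a_cont Vu Vu). Qed.

End ProductSpace.

(** * The kernel of the constraint *)

Section Kernel.
Context {R : realType}.
Local Notation TR := (measurableTypeR R).
Variables (L l : R) (GD : set (R * R)).
Hypothesis L0 : 0 < L.
Hypothesis l0 : 0 < l.
Implicit Types (i : 'I_2) (u v w : Velt (R := R)) (sigma tau : R -> R).
Local Notation inV := (inV L l GD).
Local Notation tr := (trace_gam L l).
Local Notation "f =g g" := (ae_eq leb1 (gam L) f g) (at level 70).
Let xQ i := OmegaQ_x l L0 i.
Let yQ i := OmegaQ_y L l0 i.

Definition jump i u : R -> R := fun x => tr i (bulk u i) x - intf u x.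

Lemma jump_lc c u v : inV u -> inV v -> forall i,
  jump i (lcV c u v) =g (fun x => c * jump i u x + jump i v x).
Proof.
move=> [u1 _] [v1 _] i; move: (trace_gam_lin L0 l0 c (u1 i) (v1 i)).
apply: aeS => x h Dx; rewrite /jump /= h//.
by move: (tr i _ x) (tr i _ x) (intf u x) (intf v x) => p q r s; ring.
Qed.

(** An almost everywhere condition rather than [form_b mu u = 0] for all [mu]: it passes to limits
    through an L^2 estimate of the jumps, and it forces [form_b mu u = 0] for every multiplier. *)
Definition kerB : set (Velt (R := R)) :=
  [set u | inV u /\ forall i, jump i u =g (fun=> 0)].

Lemma ae_eq_lin c sigma tau sigma' tau' : sigma =g sigma' -> tau =g tau' ->
  (fun x => c * sigma x + tau x) =g (fun x => c * sigma' x + tau' x).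
Proof. by apply: aeS2 => x h1 h2 Dx; rewrite h1// h2. Qed.

Lemma kerB_lc c u v : kerB u -> kerB v -> kerB (lcV c u v).
Proof.
move=> [Vu u0] [Vv v0]; split=> [|i]; first exact: (inV_lc L0 l0 c Vu Vv).
apply: (ae_eq_trans (jump_lc c Vu Vv i)); move: (ae_eq_lin c (u0 i) (v0 i)).
by apply: aeS => x h Dx; rewrite h// mulr0 addr0.
Qed.

Lemma same_jump_kerB u v : inV u -> inV v -> (forall i, jump i u =g jump i v) ->
  kerB (lcV (-1) u v).
Proof.
move=> Vu Vv uv; split=> [|i]; first exact: (inV_lc L0 l0 (-1) Vu Vv).
apply: (ae_eq_trans (jump_lc (-1) Vu Vv i)); move: (uv i).
by apply: aeS => x h Dx; rewrite h// mulN1r addNr.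
Qed.

Lemma kerB_neq0 : kerB !=set0.
Proof.
(* Zero, written as a difference so that only equality of jumps is to be checked. *)
exists (lcV (-1) zeroV zeroV).
have V0 := inV_zero GD L0 l0.
by apply: same_jump_kerB => // i; exact: ae_eq_refl.
Qed.

Lemma L2_jump u i : inV u -> L2 leb1 (gam L) (jump i u).
Proof.
move=> Vu; apply: (L2B (measurable_gam L)); first exact: (L2_trace_gam (Vu.1 i)).
by have [] := inV_intf Vu.
Qed.

Definition jumpK i : R := 2 * (bdryK (OmegaQ L l i) *+ 4) + 2.

(** The trace part contributes [bdryK *+ 4] and the interface part 1, each doubled by splitting the
    square. Continuity of the jumps into L^2 of the interface is what closes the kernel under
    limits. *)
Lemma jump_bound u v i : inV u -> inV v ->
  sqnormL2 leb1 (gam L) (fun x => jump i u x - jump i v x) <=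
  jumpK i * sqnormV L l (lcV (-1) v u).
Proof.
move=> Vu Vv.
have Lt (w : Velt) : inV w -> L2 leb1 (gam L) (tr i (bulk w i)).
  by move=> Vw; exact: (L2_trace_gam (Vw.1 i)).
have Li (w : Velt) : inV w -> L2 leb1 (gam L) (intf w).
  by move=> Vw; have [] := inV_intf Vw.
have h := sqnormL2D_le (measurable_gam L)
  (L2B (measurable_gam L) (Lt _ Vu) (Lt _ Vv)) (L2B (measurable_gam L) (Li _ Vv) (Li _ Vu)).
have -> : sqnormL2 leb1 (gam L) (fun x => jump i u x - jump i v x) =
    sqnormL2 leb1 (gam L) (fun x : TR =>
      (tr i (bulk u i) x - tr i (bulk v i) x) + (intf v x - intf u x)).
  apply: eq_sqnormL2 => x _; rewrite /jump.
  by move: (tr i _ x) (tr i _ x) (intf u x) (intf v x) => p q r s; ring.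
apply: (le_trans h) => {h}; rewrite /jumpK.
have B0 : 0 <= bdryK (OmegaQ L l i) *+ 4.
  by rewrite mulrn_wge0// (bdryK_ge0 (xQ i) (yQ i)).
have h1 : sqnormL2 leb1 (gam L) (fun x : TR => tr i (bulk u i) x - tr i (bulk v i) x) <=
    bdryK (OmegaQ L l i) *+ 4 * sqnormV L l (lcV (-1) v u).
  apply: (le_trans (trace_gam_bound_sub L0 l0 (Vu.1 i) (Vv.1 i))).
  apply: (ler_wpM2l B0).
  have -> : (fun z => bulk u i z - bulk v i z) = bulk (lcV (-1) v u) i.
    by apply/funext => z; rewrite /= mulN1r addrC.
  exact: sqnormV_bulk_le.
have h2 : sqnormL2 leb1 (gam L) (fun x : TR => intf v x - intf u x) <=
    sqnormV L l (lcV (-1) v u).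
  have -> : sqnormL2 leb1 (gam L) (fun x : TR => intf v x - intf u x) =
      sqnormL2 leb1 (gam L) (intf (lcV (-1) v u)).
    by rewrite sqnormL2_subC; apply: eq_sqnormL2 => x _; rewrite /= mulN1r addrC.
  apply: le_trans (sqnormV_intf_le _ _ _).
  exact: (sqnormL2_le_H1 leb1 (gam L) (test_function (V := R^o) (gam L)) partial1).
move: (bdryK _ *+ 4) (sqnormL2 _ _ _) (sqnormL2 _ _ _) (sqnormV _ _ _) h1 h2.
by move=> c p q r h1 h2; rewrite (mulrDl (2 * c)) -mulrA lerD// ler_wpM2l.
Qed.

Lemma jumpK_ge0 i : 0 <= jumpK i.
Proof.
by rewrite /jumpK addr_ge0// mulr_ge0// mulrn_wge0// (bdryK_ge0 (xQ i) (yQ i)).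
Qed.

Lemma kerB_complete (x : nat -> Velt (R := R)) (M : R) : (forall n, kerB (x n)) ->
  (forall n m, (n <= m)%N -> sqnormV L l (lcV (-1) (x m) (x n)) <= M / 8 ^+ n) ->
  exists u M', kerB u /\
    forall n, sqnormV L l (lcV (-1) u (x n)) <= M' / 8 ^+ n.
Proof.
move=> Kx xC; have Vx n : inV (x n) := (Kx n).1.
have bE (y z : Velt (R := R)) i : (fun t => bulk z i t - bulk y i t) = bulk (lcV (-1) y z) i.
  by apply/funext => t; rewrite /= mulN1r addrC.
have iE (y z : Velt (R := R)) : (fun t => intf z t - intf y t) = intf (lcV (-1) y z).
  by apply/funext => t; rewrite /= mulN1r addrC.
have /choice[w wP] i : exists w : R * R -> R, inH1_0 (OmegaQ L l i) (Gammai L l GD i) w /\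
    forall n, sqnormH1_2 (Omegai L l i) (fun z => bulk (x n) i z - w z) <=
      M *+ 3 / 8 ^+ n.
  apply: (inH1_0_complete (xQ i) (yQ i)) => [n|n m nm]; first exact: (Vx n).1.
  by apply: le_trans (xC n m nm); rewrite bE; exact: sqnormV_bulk_le.
have [g [Hg gx]] : exists g, inH10_1 (gam L) g /\
    forall n, sqnormH1_1 (gam L) (fun z => intf (x n) z - g z) <= M *+ 2 / 8 ^+ n.
  apply: (inH10_1_complete L0) => [n|n m nm]; first exact: (Vx n).2.
  by apply: le_trans (xC n m nm); rewrite iE; exact: sqnormV_intf_le.
pose u := MkV w g.
have Vu : inV u by split=> // i; exact: (wP i).1.
(* Two bulk components with factor 3 each and the interface component with factor 2. *)
have uM n : sqnormV L l (lcV (-1) u (x n)) <= (M *+ 8) / 8 ^+ n.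
  have h (i : 'I_2) := (wP i).2 n.
  have -> : M *+ 8 / 8 ^+ n = \sum_(i < 2) (M *+ 3 / 8 ^+ n) + M *+ 2 / 8 ^+ n.
    by rewrite sumr_const card_ord; move: (8 ^+ n)^-1 => t; ring.
  apply: lerD; last by have := gx n; rewrite -[g]/(intf u) iE.
  by apply: ler_sum => i _; rewrite -bE; exact: h.
exists u, (M *+ 8); split => //; split => // i.
apply: (sqnormL2_eq0 (measurable_gam L) (L2_jump i Vu)).
apply/eqP; rewrite eq_le sqnormL2_ge0 andbT; apply/ler_addgt0Pr => e e0; rewrite add0r.
have [n Cn] := pow8_small (jumpK i * (M *+ 8)) e0.
apply: le_trans Cn; rewrite -mulrA.
have -> : sqnormL2 leb1 (gam L) (jump i u) =
    sqnormL2 leb1 (gam L) (fun t => jump i (x n) t - jump i u t).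
  rewrite sqnormL2_subC; apply: ae_eq_sqnormL2.
  - exact: measurable_gam.
  - exact: (L2_jump i Vu).1.
  - exact: (L2B (measurable_gam L) (L2_jump i Vu) (L2_jump i (Vx n))).1.
  - by move: ((Kx n).2 i); apply: aeS => t h Dt; rewrite h// subr0.
apply: (le_trans (jump_bound i (Vx n) Vu)).
exact: (ler_wpM2l (jumpK_ge0 i) (uM n)).
Qed.

End Kernel.

(** * Multipliers *)

Section Multipliers.
Context {R : realType}.
Variables (L l : R) (GD GN : set (R * R)).
Hypothesis L0 : 0 < L.
Hypothesis l0 : 0 < l.
Hypothesis bdryP : admissible_bdry L l GD GN.
Implicit Types (i j : 'I_2) (u v : Velt (R := R)) (sigma tau : R -> R).
Local Notation inV := (inV L l GD).
Local Notation tr := (trace_gam L l).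
Local Notation jump := (jump L l).
Local Notation kerB := (kerB L l GD).
Local Notation "f =g g" := (ae_eq leb1 (gam L) f g) (at level 70).
Let xQ i := OmegaQ_x l L0 i.
Let yQ i := OmegaQ_y L l0 i.

Lemma normH1_2_0 i : normH1_2 (Omegai L l i) (fun=> 0) = 0.
Proof. by rewrite normH1_2E /sqnormH1_2 (sqnormH1_0 (rect_test_space _)) sqrtr0. Qed.

Lemma normH00_ae0 i sigma : sigma =g (fun=> 0) -> normH00 L l i sigma = 0.
Proof.
move=> s0; rewrite /normH00; set S := [set _ | _ in _].
have S0 : S 0.
  exists (fun=> 0); last exact: normH1_2_0.
  split; first exact: (inW0 L0 l0 i).
  exact: ae_eq_trans (trace_gam0 L0 l0 i) (ae_eq_sym s0).
have lb : lbound S 0 by move=> _ [v _ <-]; exact: sqrtr_ge0.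
apply/eqP; rewrite eq_le; apply/andP; split; first by apply: ge_inf S0; exists 0.
by apply: lb_le_inf lb; exists 0.
Qed.

Lemma inH00'_ae0 i lam sigma : inH00' L l i lam -> sigma =g (fun=> 0) ->
  lam sigma = 0.
Proof.
move=> [_ [C lamC]] s0; have := lamC _ (ae0_inH00 L0 l0 i s0).
by rewrite (normH00_ae0 i s0) mulr0 normr_le0 => /eqP.
Qed.

(** [tau] is [sigma] plus a null function, whose norm in H^(1/2)_00 is zero, so that a bounded
    functional vanishes on it. Identities for multipliers need this because traces are linear only
    almost everywhere. *)
Lemma inH00'_ae i lam sigma tau : inH00' L l i lam -> inH00 L l i sigma ->
  sigma =g tau -> lam sigma = lam tau.
Proof.
move=> Hlam Hs st.
have d0 : (fun x => tau x - sigma x) =g (fun=> 0).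
  by move: st; apply: aeS => x h Dx; rewrite h// subrr.
have := Hlam.1 1 sigma _ Hs (ae0_inH00 L0 l0 i d0).
rewrite (inH00'_ae0 Hlam d0) mul1r addr0 => <-.
by congr lam; apply/funext => x; rewrite mul1r addrC subrK.
Qed.

Lemma form_b_lc mu c u v : inL L l mu -> inV u -> inV v ->
  form_b L l mu (lcV c u v) = c * form_b L l mu u + form_b L l mu v.
Proof.
move=> Hmu Vu Vv; rewrite /form_b mulr_sumr -big_split /=; apply: eq_bigr => i _.
have Ju := jump_inH00 L0 l0 bdryP i Vu; have Jv := jump_inH00 L0 l0 bdryP i Vv.
rewrite -((Hmu i).1 c _ _ Ju Jv); apply: (inH00'_ae (Hmu i)).
  exact: (jump_inH00 L0 l0 bdryP i (inV_lc L0 l0 c Vu Vv)).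
exact: (jump_lc L0 l0 c Vu Vv i).
Qed.

Lemma form_b_kerB mu u : inL L l mu -> kerB u -> form_b L l mu u = 0.
Proof.
move=> Hmu [_ u0]; rewrite /form_b big1// => i _.
exact: (inH00'_ae0 (Hmu i) (u0 i)).
Qed.

Lemma normL_eq0 lam : eqL L l lam (zeroL (R := R)) -> normL L l lam = 0.
Proof.
move=> lam0; rewrite /normL big1 ?sqrtr0// => i _.
suff -> : normH00' L l i (lam i) = 0 by rewrite expr0n.
rewrite /normH00'; set S := [set _ | _ in _].
(* If the set is empty its [sup] is 0 by convention. *)
have /subset_set1[->|->] : S `<=` [set 0]; [|exact: sup0|exact: sup1].
move=> _ [v [Wv _] <-]; rewrite (lam0 i _ (trace_gam_inH00 Wv)).
exact: mul0r.
Qed.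

(** Its jump is the trace of [w] at index [i] and zero at the other index, so it isolates one
    component of a multiplier. *)
Definition embV i (w : R * R -> R) : Velt :=
  MkV (fun j => if j == i then w else fun=> 0) (fun=> 0).

Lemma inV_emb i w : inW L l i w -> inV (embV i w).
Proof.
move=> Ww; split => /=; last exact: (inH10_1_zero 0 L).
move=> j; case: eqVneq => [->|_]; first exact: (inW_inH1_0 l0 bdryP Ww).
exact: (inH1_0_zero (xQ j) (yQ j)).
Qed.

Lemma normV_emb i w : normV L l (embV i w) = normH1_2 (Omegai L l i) w.
Proof.
rewrite normVE normH1_2E; apply: (congr1 Num.sqrt); rewrite /sqnormV.
have -> : sqnormH1_1 (gam L) (intf (embV i w)) = 0 by exact: (sqnormH1_0 (itv_test_space 0 L)).
rewrite addr0 (bigD1 i)//= big1; first by rewrite addr0 eqxx.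
by move=> j /negPf ->; exact: (sqnormH1_0 (rect_test_space _)).
Qed.

Lemma jump_emb i w : inW L l i w -> forall j,
  jump j (embV i w) =g (fun x => if j == i then tr i w x else 0).
Proof.
move=> Ww j; rewrite /jump /=; case: eqVneq => [->|_].
  by apply: aeW => x _; rewrite subr0.
by move: (trace_gam0 L0 l0 j); apply: aeS => x h Dx; rewrite h// subr0.
Qed.

Lemma form_b_emb mu i w : inL L l mu -> inW L l i w ->
  form_b L l mu (embV i w) = mu i (tr i w).
Proof.
move=> Hmu Ww; rewrite /form_b (bigD1 i)//= big1.
  rewrite addr0; apply/esym/(inH00'_ae (Hmu i) (trace_gam_inH00 Ww)).
  by rewrite eqxx; apply: aeW => x _; rewrite subr0.
move=> j /negPf ji; apply: (inH00'_ae0 (Hmu j)).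
by rewrite ji; move: (trace_gam0 L0 l0 j); apply: aeS => x h Dx; rewrite h// subr0.
Qed.

Variables (d eox ech alpha1 alpha2 : R) (rho : R -> R).
Local Notation a := (form_a L l d eox ech).
Hypothesis alpha1_gt0 : 0 < alpha1.
Hypothesis alpha2_gt0 : 0 < alpha2.
Hypothesis a_cont : continuity_constant L l GD d eox ech alpha1.
Hypothesis a_coer : coercivity_constant L l GD d eox ech alpha2.
Hypothesis rho_L2 : L2 leb1 (gam L) rho.

Definition load v : R := dotL2 leb1 (gam L) rho (intf v).

Lemma load_lc c u v : inV u -> inV v -> load (lcV c u v) = c * load u + load v.
Proof.
move=> Vu Vv; apply: (dotL2_linr (measurable_gam L) c _ _ rho_L2).
  by have [] := inV_intf Vu.
by have [] := inV_intf Vv.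
Qed.

Lemma load_le v : inV v -> `|load v| <= normL2 leb1 (gam L) rho * normV L l v.
Proof.
move=> Vv; have [Lv _] := inV_intf Vv.
apply: (le_trans (dotL2_le (measurable_gam L) rho_L2 Lv)).
apply: ler_wpM2l; first exact: sqrtr_ge0.
rewrite normVE /normL2 ler_sqrt ?sqnormV_ge0//.
apply: le_trans (sqnormV_intf_le _ _ _).
exact: (sqnormL2_le_H1 leb1 (gam L) (test_function (V := R^o) (gam L)) partial1).
Qed.

Lemma coercive_sqnormV u : inV u -> sqnormV L l u <= a u u / alpha2.
Proof.
move=> Vu; rewrite ler_pdivlMr// mulrC -normV_sqr; exact: (a_coer Vu).
Qed.

Lemma form_a_ge0 u : inV u -> 0 <= a u u.
Proof.
by move=> Vu; apply: le_trans (a_coer Vu); rewrite mulr_ge0 ?sqr_ge0 ?(ltW alpha2_gt0).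
Qed.

Lemma kernel_problem : exists2 u, kerB u & forall v, kerB v -> a u v = load v.
Proof.
have kV v : kerB v -> inV v by case.
(* The Cauchy-Schwarz inequality and coercivity bound the square of [load u] by the first summand
   times [a u u]; adding 1 makes the constant positive even for [rho = 0]. *)
have C0 : 0 < sqnormL2 leb1 (gam L) rho / alpha2 + 1.
  by rewrite ltr_wpDl// divr_ge0 ?sqnormL2_ge0 ?(ltW alpha2_gt0).
apply: (riesz_representation (lc := lcV) (K := kerB) (C := sqnormL2 leb1 (gam L) rho / alpha2 + 1)).
- exact: (kerB_neq0 GD L0 l0).
- by move=> c u v; exact: (kerB_lc L0 l0).
- exact: form_aC.
- move=> c u v w /kV Vu /kV Vv /kV Vw; exact: (form_a_lc L0 l0 _ _ _ c Vu Vv Vw).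
- by move=> u /kV; exact: form_a_ge0.
- by move=> c u v /kV Vu /kV Vv; exact: load_lc.
- exact: C0.
- move=> u /kV Vu; have h := coercive_sqnormV Vu; have a0 := form_a_ge0 Vu.
  have : load u ^+ 2 <= sqnormL2 leb1 (gam L) rho * sqnormV L l u.
    rewrite -normV_sqr -normL2_sqr -exprMn -(real_normK (num_real (load u))).
    move: (load_le Vu) (mulr_ge0 (sqrtr_ge0 _ : 0 <= normL2 leb1 (gam L) rho)
      (normV_ge0 L l u)).
    by move: (_ * _) => p lp p0; rewrite lerXn2r ?nnegrE.
  move=> /le_trans; apply.
  apply: (le_trans (ler_wpM2l (sqnormL2_ge0 _ _ _) h)).
  move: (sqnormL2 _ _ _) (a u u) (alpha2^-1) a0 => p q r q0.
  by rewrite (mulrDl (p * r)) mul1r [p * r * q]mulrAC -mulrA lerDl.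
- move=> x M Kx xC.
  have Vl n m : inV (lcV (-1) (x m) (x n)).
    exact: (inV_lc L0 l0 (-1) (kV _ (Kx m)) (kV _ (Kx n))).
  (* Coercivity turns the rate in the energy into a rate in V; continuity of [a] turns the rate
     towards the limit back. *)
  have [n m nm|u [M' [Ku uM]]] := kerB_complete (M := M / alpha2) L0 l0 Kx.
    apply: (le_trans (coercive_sqnormV (Vl n m))).
    by rewrite mulrAC ler_wpM2r ?invr_ge0 ?(ltW alpha2_gt0)// xC.
  exists u, (alpha1 * M'); split => // n.
  have Vu := inV_lc L0 l0 (-1) (kV _ Ku) (kV _ (Kx n)).
  apply: (le_trans (form_a_sqnorm_le a_cont Vu)).
  by rewrite -mulrA ler_wpM2l ?(ltW alpha1_gt0).
Qed.

(* A trace-preserving right inverse, chosen arbitrarily: the multipliers do not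
   depend on it because the residual vanishes on [kerB]. *)
Definition lifting i sigma : R * R -> R :=
  xget (fun=> 0) [set v | inW L l i v /\ tr i v =g sigma].

Lemma liftingP i sigma : inH00 L l i sigma ->
  inW L l i (lifting i sigma) /\ tr i (lifting i sigma) =g sigma.
Proof.
move=> [v Wv vs]; rewrite /lifting.
by case: xgetP => [w -> //|/(_ v)]; case.
Qed.

Variable u : Velt (R := R).
Hypothesis Ku : kerB u.
Hypothesis uK : forall v, kerB v -> a u v = load v.
Let Vu : inV u := Ku.1.

Definition residual v : R := a u v - load v.

(** The only possible value: tested with [embV i w], the first equation equates the [i]-th
    multiplier at the trace of [w] with the residual. *)
Definition multiplier i sigma : R := residual (embV i (lifting i sigma)).

Lemma residual_lc c v w : inV v -> inV w ->
  residual (lcV c v w) = c * residual v + residual w.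
Proof.
move=> Vv Vw; rewrite /residual (load_lc c Vv Vw).
rewrite (form_aC _ _ _ _ _ u (lcV c v w)) (form_a_lc L0 l0 _ _ _ c Vv Vw Vu).
rewrite (form_aC _ _ _ _ _ v u) (form_aC _ _ _ _ _ w u).
by move: (a u v) (a u w) (load v) (load w) => p q r s; ring.
Qed.

Lemma residual_same_jump v w : inV v -> inV w ->
  (forall i, jump i v =g jump i w) -> residual v = residual w.
Proof.
move=> Vv Vw vw; have Kd := same_jump_kerB L0 l0 Vv Vw vw.
have := residual_lc (-1) Vv Vw.
have -> : residual (lcV (-1) v w) = 0 by rewrite /residual uK// subrr.
by rewrite mulN1r => /eqP; rewrite eq_sym addrC subr_eq0 => /eqP ->.
Qed.

Lemma multiplier_lift i w sigma : inW L l i w -> tr i w =g sigma ->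
  multiplier i sigma = residual (embV i w).
Proof.
move=> Ww ws; have [Wl ls] := liftingP (ex_intro2 _ _ w Ww ws).
apply: residual_same_jump; [exact: inV_emb|exact: inV_emb|move=> j].
apply: (ae_eq_trans (jump_emb Wl j)); apply: ae_eq_sym.
apply: (ae_eq_trans (jump_emb Ww j)); apply: ae_eq_sym.
case: (j == i); last exact: ae_eq_refl.
exact: (ae_eq_trans ls (ae_eq_sym ws)).
Qed.

Lemma multiplier_lin i c sigma tau : inH00 L l i sigma -> inH00 L l i tau ->
  multiplier i (fun x => c * sigma x + tau x) =
  c * multiplier i sigma + multiplier i tau.
Proof.
move=> /liftingP[Ws ls] /liftingP[Wt lt].
rewrite -(residual_lc c (inV_emb Ws) (inV_emb Wt)).
have Wl : inW L l i (fun z => c * lifting i sigma z + lifting i tau z).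
  exact: (inH1_0_lin (xQ i) (yQ i) c Ws Wt).
rewrite (multiplier_lift Wl); last first.
  exact: (ae_eq_trans (trace_gam_lin L0 l0 c Ws Wt) (ae_eq_lin c ls lt)).
congr residual; rewrite /lcV /embV /=; congr MkV; last first.
  by apply/funext => x; rewrite mulr0 addr0.
by apply/funext => j; apply/funext => z; case: eqP => // _; rewrite mulr0 addr0.
Qed.

(** The load vanishes on [embV i w], whose interface component is zero, so continuity of [a] bounds
    the residual by a multiple of the norm of [w]. The infimum over all [w] with the given trace is
    the norm of H^(1/2)_00. *)
Lemma multiplier_inL : inL L l multiplier.
Proof.
move=> i; split; first by move=> c sigma tau; exact: multiplier_lin.
(* Adding 1 allows division by [C] even when [u] has norm zero. *)
pose C := alpha1 * normV L l u + 1.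
have C0 : 0 < C by rewrite ltr_wpDl// mulr_ge0 ?normV_ge0 ?(ltW alpha1_gt0).
exists C => sigma [v Wv vs]; rewrite mulrC -ler_pdivrMr//.
apply: lb_le_inf; first by exists (normH1_2 (Omegai L l i) v), v.
move=> _ [w [Ww ws] <-]; rewrite ler_pdivrMr// (multiplier_lift Ww ws).
have -> : residual (embV i w) = a u (embV i w).
  by rewrite /residual /load dotL2C dotL20l subr0.
apply: (le_trans (form_a_le L0 l0 a_cont Vu (inV_emb Ww))).
rewrite normV_emb mulrC ler_wpM2l ?sqrtr_ge0// /C.
by rewrite lerDl.
Qed.

(** The sum of the two embedded liftings of the jumps of [v] has the same jumps as [v], hence the
    same residual. *)
Lemma multiplier_form_b v : inV v -> form_b L l multiplier v = residual v.
Proof.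
move=> Vv.
have [w wP] : exists w : 'I_2 -> R * R -> R, forall i, inW L l i (w i) /\ tr i (w i) =g jump i v.
  exists (fun i => lifting i (jump i v)) => i; exact: (liftingP (jump_inH00 L0 l0 bdryP i Vv)).
have VE i : inV (embV i (w i)) by apply: inV_emb; exact: (wP i).1.
rewrite /form_b (eq_bigr (fun i => residual (embV i (w i)))); last first.
  by move=> i _; exact: (multiplier_lift (wP i).1 (wP i).2).
pose k : 'I_2 := lift ord0 ord0.
have sumE (f : 'I_2 -> R) : \sum_i f i = f ord0 + f k.
  by rewrite !big_ord_recl big_ord0 addr0.
have rE := residual_lc 1 (VE ord0) (VE k); rewrite mul1r in rE.
rewrite sumE -rE.
apply: (residual_same_jump (inV_lc L0 l0 1 (VE ord0) (VE k)) Vv) => i.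
apply: (ae_eq_trans (jump_lc L0 l0 1 (VE ord0) (VE k) i)).
move: (ae_eq_lin 1 (jump_emb (wP ord0).1 i) (jump_emb (wP k).1 i)) (wP i).2.
apply: aeS2 => x h1 h2 Dx; rewrite h1// -h2// mul1r.
case: (unliftP ord0 i) => [j ->|->]; last by rewrite eqxx addr0.
by rewrite (ord1 j) -/k eqxx add0r.
Qed.

End Multipliers.

(** * Uniqueness, a priori bounds and existence *)

Section Solutions.
Context {R : realType}.
Variables (L l : R) (GD GN : set (R * R)).
Hypothesis L0 : 0 < L.
Hypothesis l0 : 0 < l.
Hypothesis bdryP : admissible_bdry L l GD GN.
Variables (d eox ech alpha1 alpha2 beta : R) (rho : R -> R).
Hypothesis alpha1_gt0 : 0 < alpha1.
Hypothesis alpha2_gt0 : 0 < alpha2.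
Hypothesis beta_gt0 : 0 < beta.
Hypothesis a_cont : continuity_constant L l GD d eox ech alpha1.
Hypothesis a_coer : coercivity_constant L l GD d eox ech alpha2.
Hypothesis b_infsup : infsup_constant L l GD beta.
Hypothesis rho_L2 : L2 leb1 (gam L) rho.
Implicit Types (i : 'I_2) (u v : Velt (R := R)) (lam : Lelt (R := R)).
Local Notation inV := (inV L l GD).
Local Notation a := (form_a L l d eox ech).
Local Notation b := (form_b L l).
Local Notation F := (load L rho).
Local Notation solution := (solution L l GD d eox ech rho).
Local Notation nrho := (normL2 leb1 (gam L) rho).

Lemma solutionE u lam v : solution u lam -> inV v -> b lam v = a u v - F v.
Proof.
move=> [_ _ h _] Vv; have := h v Vv; rewrite -dotL2_def -/(load L rho v).
by move=> <-; rewrite opprB addrC subrK.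
Qed.

(** The difference [w] is annihilated by [b], so [a w w = 0] and coercivity makes its norm zero. By
    continuity [a w v = 0] for every [v], and testing with [embV i v] identifies the multipliers. *)
Lemma solution_unique u lam u' lam' : solution u lam -> solution u' lam' ->
  eqV L l u' u /\ eqL L l lam' lam.
Proof.
move=> S S'; have [Vu Hlam _ u0] := S; have [Vu' Hlam' _ u0'] := S'.
set w := lcV (-1) u u'; have Vw : inV w by exact: (inV_lc L0 l0 (-1) Vu Vu').
have b0 mu : inL L l mu -> b mu w = 0.
  move=> Hmu; rewrite (form_b_lc L0 l0 bdryP (-1) Hmu Vu Vu') (u0 _ Hmu) (u0' _ Hmu).
  by rewrite mulr0 addr0.
have awE v : inV v -> a w v = b lam' v - b lam v.
  move=> Vv; rewrite (form_a_lc L0 l0 _ _ _ (-1) Vu Vu' Vv).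
  rewrite (solutionE S Vv) (solutionE S' Vv).
  by move: (a u v) (a u' v) (F v) => p q r; ring.
have N0 : sqnormV L l w = 0.
  apply/eqP; rewrite eq_le sqnormV_ge0 andbT.
  apply: (le_trans (coercive_sqnormV alpha2_gt0 a_coer Vw)).
  by rewrite awE// (b0 _ Hlam) (b0 _ Hlam') subrr mul0r.
split; first exact: (sqnormV_sub0 L0 l0 Vu Vu' N0).
move=> i sigma [v Wv vs].
have HvT := trace_gam_inH00 Wv.
have Vv := inV_emb L0 l0 bdryP Wv.
rewrite -(inH00'_ae L0 l0 (Hlam i) HvT vs) -(inH00'_ae L0 l0 (Hlam' i) HvT vs).
rewrite -(form_b_emb L0 l0 Hlam Wv) -(form_b_emb L0 l0 Hlam' Wv).
apply/eqP; rewrite -subr_eq0 -awE// -normr_le0.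
apply: (le_trans (form_a_le L0 l0 a_cont Vw Vv)).
by rewrite normVE N0 sqrtr0 mulr0 mul0r.
Qed.

Lemma solution_normV u lam : solution u lam -> normV L l u <= alpha2^-1 * nrho.
Proof.
move=> S; have [Vu Hlam _ u0] := S.
have [->|n0] := eqVneq (normV L l u) 0.
  by rewrite mulr_ge0 ?invr_ge0 ?sqrtr_ge0 ?(ltW alpha2_gt0).
have n_gt0 : 0 < normV L l u by rewrite lt_def n0 normV_ge0.
rewrite mulrC ler_pdivlMr// mulrC -(ler_pM2r n_gt0) -mulrA -expr2.
apply: (le_trans (a_coer Vu)).
have := solutionE S Vu; rewrite (u0 _ Hlam) => /esym/eqP; rewrite subr_eq0 => /eqP ->.
exact: (le_trans (ler_norm _) (load_le rho_L2 Vu)).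
Qed.

(** In [b lam v = a u v - F v] the load costs the norm of [rho] and the form costs [alpha1] times
    the bound on [u], both times the norm of [v]; this is the origin of [1 + alpha1 / alpha2]. *)
Lemma solution_normL u lam : solution u lam ->
  normL L l lam <= beta^-1 * (1 + alpha1 / alpha2) * nrho.
Proof.
move=> S; have [Vu Hlam _ u0] := S.
set M := (1 + alpha1 / alpha2) * nrho.
have M0 : 0 <= M.
  rewrite mulr_ge0 ?sqrtr_ge0// addr_ge0// divr_ge0 ?(ltW alpha1_gt0)//.
  exact: (ltW alpha2_gt0).
have bM v : inV v -> b lam v <= M * normV L l v.
  move=> Vv; rewrite (solutionE S Vv) /M (mulrDl 1) mul1r mulrDl addrC.
  apply: lerD.
    by apply: (le_trans (ler_norm _)); rewrite normrN; exact: (load_le rho_L2 Vv).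
  apply: (le_trans (a_cont Vu Vv)); apply: (ler_wpM2r (normV_ge0 L l v)).
  by rewrite -mulrA ler_wpM2l ?(ltW alpha1_gt0)//; exact: solution_normV S.
rewrite -mulrA -/M mulrC ler_pdivlMr//.
have [->|n0] := eqVneq (normL L l lam) 0; first by rewrite mul0r.
have n_gt0 : 0 < normL L l lam by rewrite lt_def n0 sqrtr_ge0.
rewrite mulrC -ler_pdivlMr// -lee_fin.
apply: (le_trans b_infsup); apply: ge_ereal_inf; eexists.
  exists lam => //; split => // /(normL_eq0 (l := l)); exact/eqP.
apply: ge_ereal_sup => _ [v [Vv _] <-]; rewrite lee_fin.
(* The supremum only excludes [v] almost everywhere zero; if the norm is zero, the quotient is 0 by
   the convention on division by zero. *)
have [->|v0] := eqVneq (normV L l v) 0.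
  by rewrite mulr0 invr0 mulr0 divr_ge0// ltW.
have v_gt0 : 0 < normV L l v by rewrite lt_def v0 normV_ge0.
rewrite ler_pdivrMr ?mulr_gt0// mulrA divfK//.
exact: bM.
Qed.

End Solutions.

Theorem theorem3p5 (R : realType) (L l : R) (GD GN : set (R * R))
    (d eox ech alpha1 alpha2 beta : R) (rho : R -> R)
    (L_gt0 : 0 < L) (l_gt0 : 0 < l)
    (bdryP : admissible_bdry L l GD GN)
    (d_gt0 : 0 < d) (eox_gt0 : 0 < eox) (ech_gt0 : 0 < ech)
    (alpha1_gt0 : 0 < alpha1) (alpha2_gt0 : 0 < alpha2) (beta_gt0 : 0 < beta)
    (a_cont : continuity_constant L l GD d eox ech alpha1)
    (a_coer : coercivity_constant L l GD d eox ech alpha2)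
    (b_infsup : infsup_constant L l GD beta)
    (rho_L2 : L2 leb1 (gam L) rho) :
  exists (u : Velt) (lam : Lelt),
    [/\ solution L l GD d eox ech rho u lam,
        forall u' lam', solution L l GD d eox ech rho u' lam' ->
          eqV L l u' u /\ eqL L l lam' lam,
        normV L l u <= alpha2^-1 * normL2 leb1 (gam L) rho &
        normL L l lam <=
          beta^-1 * (1 + alpha1 / alpha2) * normL2 leb1 (gam L) rho].
Proof.
have [u Ku uK] := kernel_problem L_gt0 l_gt0 alpha1_gt0 alpha2_gt0 a_cont a_coer rho_L2.
pose lam := multiplier L l d eox ech rho u.
have Hlam : inL L l lam.
  exact: (multiplier_inL L_gt0 l_gt0 bdryP alpha1_gt0 a_cont rho_L2 Ku uK).
have S : solution L l GD d eox ech rho u lam.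
  split; [exact: Ku.1|exact: Hlam| |].
    move=> v Vv.
    rewrite (multiplier_form_b L_gt0 l_gt0 bdryP rho_L2 Ku uK Vv) /residual.
    by rewrite subKr /load dotL2_def.
  by move=> mu Hmu; exact: (form_b_kerB L_gt0 l_gt0 Hmu Ku).
exists u, lam; split.
- exact: S.
- move=> u' lam' S'.
  exact: (solution_unique L_gt0 l_gt0 bdryP alpha2_gt0 a_cont a_coer S S').
- exact: (solution_normV alpha2_gt0 a_coer rho_L2 S).
- exact: (solution_normL alpha1_gt0 alpha2_gt0 beta_gt0 a_cont a_coer b_infsup rho_L2 S).
Qed.
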